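(* Consider the Gibbs sampler for the linear latent non-Gaussian model described in the context, and let $\tilde a:=a+\mu^2/\sigma^2$. The marginal chain $(V^{(t)})_{t\ge 0}$ on $(0,\infty)^n$ is geometrically ergodic in each of the following parameter regimes: (I) $a=\mu=0$ (equivalently $\tilde a=0$), so that necessarily $p<0$ and $b>0$ (no further condition); (II) $a=0$, $b>0$, $p<0$ and $\mu\ne 0$ (so $\tilde a=\mu^2/\sigma^2>0$), with the null-smallness assumption satisfied (which for $a=0$, $\mu\neq0$ reads $\sqrt{z^\top G^{-1}z}<1$ when $\mathrm{Null}(A)\ne\{0\}$); (III) $a>0$, $b=0$, $p>0$ (so $\tilde a>0$), with the null-smallness assumption satisfied.
   Context: GIG distribution: $\mathrm{GIG}(p,a,b)$ is the law on $(0,\infty)$ with density proportional to $x^{p-1}\exp\{-\tfrac12(ax+b/x)\}$, for parameters with ($a>0,b>0,p\in\mathbb{R}$) or ($a=0,b>0,p<0$) or ($a>0,b=0,p>0$). Model: fix $A\in\mathbb{R}^{m\times n}$, an invertible $K\in\mathbb{R}^{n\times n}$, a design matrix $X$ with coefficients $\beta$, $h\in\mathbb{R}^n$, $\mu\in\mathbb{R}$, $\sigma>0$, $\sigma_\epsilon>0$, GIG parameters $(p,a,b)$; put $B=AK^{-1}$. $Y\mid M,V\sim N(X\beta+B(M-\mu h),\sigma_\epsilon^2 I)$, $M\mid V\sim N(\mu V,\mathrm{diag}(\sigma^2V))$, $V_1,\dots,V_n$ independent $\mathrm{GIG}(p,a,b)$. The data $Y\in\mathbb{R}^m$ are fixed.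 Gibbs sampler: with $D_V=\mathrm{diag}(V)$, $\rho=\sigma^2\sigma_\epsilon^{-2}$, $\bar Q(V)=\rho B^\top B+D_V^{-1}$, $\bar m=\rho B^\top(Y-X\beta+\mu Bh)+\mu\mathbf 1$ ($\mathbf 1$ the all-ones vector), one step from $V$ draws $M\mid V,Y\sim N(\bar Q(V)^{-1}\bar m,\sigma^2\bar Q(V)^{-1})$ and then, independently over $i$, $\tilde V_i\mid M_i\sim\mathrm{GIG}(p-\tfrac12,\ \tilde a,\ b+M_i^2/\sigma^2)$ (defined for almost every $M$; in regime (I) this is an inverse-gamma law). The chain $V\to\tilde V$ has invariant probability measure $\pi$ with density $\pi(V\mid Y)$. Null-smallness assumption: with $r=\dim\mathrm{Null}(A)$, either $r=0$, or, for $U_A\in\mathbb{R}^{n\times r}$ an orthonormal basis of $\mathrm{Null}(A)$, $G=U_A^\top K^\top KU_A$ and $z=U_A^\top K^\top\mathbf 1$, one has $\frac{|\mu|}{\sqrt{\sigma^2a+\mu^2}}\sqrt{z^\top G^{-1}z}<1$. Geometric ergodicity: a chain with transition operator $P$ and stationary distribution $\pi$ is geometrically ergodic if there is $\gamma\in(0,1)$ such that for every probability measure $\nu\ll\pi$ with $d\nu/d\pi\in L_2(\pi)$ there is $C=C(\nu)<\infty$ with $\|\nu P^t-\pi\|_{\mathrm{TV}}\le C\gamma^t$ for all $t\in\mathbb{N}$. *)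

(* Defs.v *)
From HB Require Import structures.
From mathcomp Require Import all_boot all_order all_algebra.
From mathcomp Require Import all_classical all_reals all_analysis.
Set Implicit Arguments.
Unset Strict Implicit.
Unset Printing Implicit Defensive.
Import Order.TTheory GRing.Theory Num.Theory.
Import numFieldNormedType.Exports.
Local Open Scope classical_set_scope.
Local Open Scope ring_scope.

(* R^n with its product (Borel) sigma-algebra, as used for integration;
   linear algebra is done on the column vectors [vcol v]. *)
Notation Rn R n := (n.-tuple (measurableTypeR R)).

Definition vcol (R : realType) n (v : Rn R n) : 'cV[R]_n :=
  \col_i (tnth v i : R).

(* Lebesgue measure on R^n, by recursion on n: the image of the product measure
   on R^n * R under (v, x) |-> (x, v_1, ..., v_n); a point mass for n = 0. *)
Section lebesgue_step.
Context {R : realType} (n : nat).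
Variable l : {sigma_finite_measure set (Rn R n) -> \bar R}.

Definition tcons (u : Rn R n * measurableTypeR R) : Rn R n.+1 :=
  [tuple of u.2 :: u.1].

Let tsplit (t : Rn R n.+1) : Rn R n * measurableTypeR R :=
  ([tuple of behead t], thead t).

Lemma measurable_tcons : measurable_fun setT tcons.
Proof. exact: measurable_cons. Qed.

Let measurable_tsplit : measurable_fun setT tsplit.
Proof.
apply: measurable_fun_pair; first exact: measurable_behead.
exact: measurable_tnth.
Qed.

Let tconsK u : tsplit (tcons u) = u.
Proof.
case: u => t x; rewrite /tsplit/= theadE; congr pair.
exact/val_inj.
Qed.

Definition lebesgue_step : set (Rn R n.+1) -> \bar R :=
  pushforward (l \x lebesgue_measure)%E tcons.

Let step0 : lebesgue_step set0 = 0%E.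
Proof. by rewrite /lebesgue_step /pushforward preimage_set0 measure0. Qed.

Let mpre A : measurable A -> measurable (tcons @^-1` A).
Proof.
by move=> mA; rewrite -[X in measurable X]setTI; exact: measurable_tcons.
Qed.

Let step_ge0 A : (0 <= lebesgue_step A)%E.
Proof. by rewrite /lebesgue_step /pushforward measure_ge0. Qed.

Let step_sigma_additive : semi_sigma_additive lebesgue_step.
Proof.
move=> F mF tF mUF; rewrite /lebesgue_step /pushforward preimage_bigcup.
apply: measure_semi_sigma_additive.
- by move=> i; exact: mpre.
- apply/trivIsetP => /= i j _ _ ij; rewrite -preimage_setI.
  by move/trivIsetP : tF => /(_ _ _ _ _ ij) ->//; rewrite preimage_set0.
- by rewrite -preimage_bigcup; exact: mpre.
Qed.

HB.instance Definition _ := isMeasure.Build _ _ _ lebesgue_step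
  step0 step_ge0 step_sigma_additive.

Let step_sigma_finite : sigma_finite setT lebesgue_step.
Proof.
have /sigma_finiteP[F [TF ndF Foo]] := sigma_finiteT l.
have /sigma_finiteP[G [TG ndG Goo]] := sigma_finiteT (@lebesgue_measure R).
exists (fun i => tsplit @^-1` (F i `*` G i)).
  apply/esym; rewrite -subTset => t _.
  have [i _ Fi] : (\bigcup_i F i) (tsplit t).1 by rewrite -TF.
  have [j _ Gj] : (\bigcup_i G i) (tsplit t).2 by rewrite -TG.
  exists (maxn i j) => //; split.
    by move: Fi; exact/subsetPset/ndF/leq_maxl.
  by move: Gj; exact/subsetPset/ndG/leq_maxr.
move=> i; have [mF Fi] := Foo i; have [mG Gi] := Goo i.
split.
  by rewrite -[X in measurable X]setTI; apply: measurable_tsplit => //;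
    exact: measurableX.
rewrite /lebesgue_step /pushforward.
rewrite -comp_preimage (_ : tsplit \o tcons = id) ?preimage_id; last first.
  by apply/funext => u; exact: tconsK.
by rewrite product_measure1E// lte_mul_pinfty// ge0_fin_numE.
Qed.

HB.instance Definition _ := Measure_isSigmaFinite.Build _ _ _ lebesgue_step
  step_sigma_finite.

End lebesgue_step.

Fixpoint lebesgue_Rn (R : realType) (n : nat) :
    {sigma_finite_measure set (Rn R n) -> \bar R} :=
  match n with
  | 0 => dirac ([tuple] : Rn R 0)
  | n'.+1 => lebesgue_step (lebesgue_Rn R n')
  end.

(* Density of N(m, S), for a symmetric positive definite covariance S. *)
Definition mvn_pdf (R : realType) k (m : 'cV[R]_k) (S : 'M[R]_k)
    (x : 'cV[R]_k) : R :=
  (Num.sqrt ((2 * pi) ^+ k * \det S))^-1 *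
  expR (- 2^-1 * ((x - m)^T *m invmx S *m (x - m)) 0 0).

Section gig.
Context {R : realType}.
Implicit Types p a b x : R.

Definition gig_params p a b :=
  [\/ [/\ 0 < a & 0 < b],
      [/\ a = 0, 0 < b & p < 0] |
      [/\ 0 < a, b = 0 & 0 < p]].

Definition gig_kernel p a b x : R :=
  if 0 < x then x `^ (p - 1) * expR (- 2^-1 * (a * x + b / x)) else 0.

Definition gig_pdf p a b x : R :=
  gig_kernel p a b x /
  (\int[lebesgue_measure]_(y in `]0, +oo[) gig_kernel p a b y).

(* Joint density of n independent GIG(p, a, b_i) variables. *)
Definition gig_prod_pdf n p a (b : 'I_n -> R) (v : Rn R n) : R :=
  \prod_(i < n) gig_pdf p a (b i) (tnth v i).

End gig.

Section latent_model.
Context {R : realType} (m n q : nat).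
Variables (A : 'M[R]_(m, n)) (K : 'M[R]_n) (X : 'M[R]_(m, q)) (beta : 'cV[R]_q).
Variables (h : 'cV[R]_n) (mu sigma sigma_eps p a b : R) (Y : 'cV[R]_m).

Let B : 'M[R]_(m, n) := A *m invmx K.
Let D (V : Rn R n) : 'M[R]_n := diag_mx (vcol V)^T.

(* Density at (Y, M, V) of the joint law of the hierarchical model. *)
Definition joint_pdf (M V : Rn R n) : R :=
  mvn_pdf (X *m beta + B *m (vcol M - mu *: h)) (sigma_eps ^+ 2)%:M Y *
  mvn_pdf (mu *: vcol V) (sigma ^+ 2 *: D V) (vcol M) *
  gig_prod_pdf p a (fun=> b) V.

(* pi(V | Y): Bayes' formula, with M integrated out. *)
Definition posterior_pdf (V : Rn R n) : R :=
  (\int[lebesgue_Rn R n]_M joint_pdf M V) /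
  (\int[lebesgue_Rn R n]_W (\int[lebesgue_Rn R n]_M joint_pdf M W)).

Definition has_posterior_density (post : set (Rn R n) -> \bar R) :=
  forall E, measurable E ->
    post E = (\int[lebesgue_Rn R n]_(V in E) (posterior_pdf V)%:E)%E.

Definition tilde_a : R := a + mu ^+ 2 / sigma ^+ 2.

Let rho : R := sigma ^+ 2 * sigma_eps ^- 2.
Let Qbar (V : Rn R n) : 'M[R]_n := rho *: (B^T *m B) + invmx (D V).
Let mbar : 'cV[R]_n :=
  rho *: (B^T *m (Y - X *m beta + mu *: (B *m h))) + mu *: const_mx 1.

Definition M_pdf (V M : Rn R n) : R :=
  mvn_pdf (invmx (Qbar V) *m mbar) (sigma ^+ 2 *: invmx (Qbar V)) (vcol M).

(* If b = 0 and M_i = 0 for some i, the GIG normalizing integral can be infinite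
   and this density is then 0; such M form a Lebesgue-null set. *)
Definition V_pdf (M V : Rn R n) : R :=
  gig_prod_pdf (p - 2^-1) tilde_a
    (fun i => b + (tnth M i : R) ^+ 2 / sigma ^+ 2) V.

(* Transition operator (P f)(V) = E[f(V~) | V] of the Gibbs sampler, where
   M is drawn given V and then V~ given M. It is meaningful for V in
   (0, oo)^n, which carries all the mass of the laws of M -> V~. *)
Definition gibbs_operator (f : Rn R n -> \bar R) (V : Rn R n) : \bar R :=
  (\int[lebesgue_Rn R n]_M ((M_pdf V M)%:E *
     \int[lebesgue_Rn R n]_W ((V_pdf M W)%:E * f W)))%E.

(* The columns of U form an orthonormal basis of Null(A); as [kermx] is a left
   kernel spanned by rows, Null(A) is the row space of [kermx A^T]. *)
Definition null_orthonormal_basis r (U : 'M[R]_(n, r)) :=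
  U^T *m U = 1%:M /\ (U^T == kermx A^T)%MS.

Definition null_smallness :=
  let r := \rank (kermx A^T) in
  r = 0%N \/
  exists2 U : 'M[R]_(n, r), null_orthonormal_basis U &
    let G := U^T *m K^T *m K *m U in
    let z := U^T *m K^T *m (const_mx 1 : 'cV[R]_n) in
    `|mu| / Num.sqrt (sigma ^+ 2 * a + mu ^+ 2) *
      Num.sqrt ((z^T *m invmx G *m z) 0 0) < 1.

End latent_model.

Section geometric_ergodicity.
Context d (T : measurableType d) (R : realType).
Local Open Scope charge_scope.
Local Open Scope ereal_scope.
Implicit Types (P : (T -> \bar R) -> T -> \bar R) (nu post : probability T R).

(* nu P^t, where P^t is the t-th iterate of the operator P on functions. *)
Definition law_after P nu (t : nat) (E : set T) : \bar R :=
  \int[nu]_x iter t P (fun y => (\1_E y)%:E) x.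

Definition stationary P post :=
  forall E, measurable E -> law_after P post 1 E = post E.

Definition tv_dist (m1 m2 : set T -> \bar R) : \bar R :=
  ereal_sup [set `|m1 E - m2 E| | E in measurable].

Definition geometrically_ergodic P post :=
  stationary P post /\
  exists2 gamma : R, (0 < gamma < 1)%R &
    forall nu, nu `<< post ->
      'N[post]_2%:E['d (charge_of_finite_measure nu) '/d post] < +oo ->
      exists C : R, forall t,
        tv_dist (law_after P nu t) post <= (C * gamma ^+ t)%:E.

End geometric_ergodicity.

(* Main.v *)
Require Import Defs.
From HB Require Import structures.
From mathcomp Require Import all_boot all_order all_algebra.
From mathcomp Require Import all_classical all_reals all_analysis.
From mathcomp Require Import measurable_realfun ring lra.
Set Implicit Arguments.
Unset Strict Implicit.
Unset Printing Implicit Defensive.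
Import Order.TTheory GRing.Theory Num.Theory.
Import numFieldNormedType.Exports.
Local Open Scope classical_set_scope.
Local Open Scope ring_scope.

(* One step of the sampler is V -> M -> V~, where M is Gaussian given V and the
   moments of V~ given M are ratios of the integrals [gw l a b] of
   exp (l u - (a e^u + b e^-u) / 2). For
     (I) L = sum V_i^s,  (II) L = sum V_i^2,  (III) L = sum V_i^2 + sum V_i^-s
   with a small s > 0, this gives E[L(V~) | V] <= lam L(V) + C with lam < 1.
   For the powers s and -s, lam < 1 is Chebyshev's association inequality and, in
   (I), the mean of M is bounded uniformly in V. For the power 2, the mean of M grows
   at most like |mu| |P 1| max V, with 1 = (1, ..., 1) and P the orthogonal projection onto
   Null(A K^-1), and null smallness says that |mu| |P 1| < sqrt (sigma^2 a + mu^2).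
   On the sublevel sets of L the laws of V~ given V have a common component.
   Harris' theorem, as a contraction of the oscillation of functions weighted by
   1 + beta sqrt L, then gives the geometric rate; sqrt L is nu-integrable when
   dnu/dpi is in L_2(pi) because pi(L) < oo. *)

(** * Changes of variables on the line *)

(** The power 2 is dictated by the geometry of the mean of M. Given M, the square of V~_i has mean
    close to M_i^2 / (sigma^2 a + mu^2), so the sum over i is the squared Euclidean norm of M, for
    which a projection bound is available, and max V is at most the root of sum V_i^2. To leading
    order nothing else is lost, and [lam] can be taken close to the square of the null-smallness
    quantity. In (I) V~_i is inverse gamma and has moments only of order below 1/2 - p, whence a
    small power. In (III) the parameter b + M_i^2 / sigma^2 reduces to M_i^2 / sigma^2; for p <= 1/2
    the law of V~_i concentrates at 0 as M_i tends to 0, and a bound on sum V_i^2 does not keep M_i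
    away from 0. The term V_i^-s does. The kernels are Markov only for V in the positive orthant [D]
    and, given M, only on a set [E] of full measure, where no coordinate vanishes. Hence all
    estimates are relative to [D] and [E]. Functions take values in [0, +oo], so the contraction is
    written with sums in place of differences. *)

Lemma measurable_affine (R : realType) (c t : R) :
  measurable_fun setT (fun x : measurableTypeR R => c + t * x : measurableTypeR R).
Proof.
apply: measurable_funD => //; exact: measurable_funM.
Qed.

Lemma lebesgue_measure_affine (R : realType) (c t : R) (A : set (measurableTypeR R)) :
  t != 0 -> measurable A ->
  (@lebesgue_measure R) A =
  (`|t|%:E * (@lebesgue_measure R) ((fun x => (c + t * x)%R) @^-1` A))%E.
Proof.
move=> t0 mA.
pose phi := (fun x : measurableTypeR R => c + t * x : measurableTypeR R).
have mphi : measurable_fun setT phi by exact: measurable_affine.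
pose nu m := mscale (NngNum (normr_ge0 t))
  (measure_function_pushforward__canonical__measure_function_Measure (@lebesgue_measure R) m).
have -> : (`|t|%:E * (@lebesgue_measure R) ((fun x => (c + t * x)%R) @^-1` A))%E = nu _ _ _ mphi A by [].
apply: lebesgue_measure_unique => // _ [[a b] _ <-].
rewrite [RHS](_ : _ = (`|t|%:E * lebesgue_measure (phi @^-1` `]a, b]%classic))%E)//.
rewrite lebesgue_measure_itv/= lte_fin.
have [t_gt0|t_le0] := ltP 0 t.
  have -> : phi @^-1` `]a, b] = `](a - c) / t, (b - c) / t]%classic.
    apply/seteqP; split => x; rewrite /phi /= !in_itv/= ltr_pdivrMr// ler_pdivlMr//; lra.
  rewrite lebesgue_measure_itv/= lte_fin ltr_pM2r ?invr_gt0// ltrD2r.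
  case: ifPn => ab; last by rewrite mule0.
  by rewrite gtr0_norm// -!EFinB -EFinM; congr EFin; field.
have {t_le0} t_lt0 : t < 0 by rewrite lt_neqAle t0.
have -> : phi @^-1` `]a, b] = `[(b - c) / t, (a - c) / t[%classic.
  apply/seteqP; split => x; rewrite /phi /= !in_itv/= ltr_ndivlMr// ler_ndivrMr//; lra.
rewrite lebesgue_measure_itv/= lte_fin ltr_nM2r ?invr_lt0// ltrD2r.
case: ifPn => ab; last by rewrite mule0.
by rewrite ltr0_norm// -!EFinB -EFinM; congr EFin; field.
Qed.

Lemma ge0_integral_affine (R : realType) (c t : R) (f : measurableTypeR R -> \bar R) :
  t != 0 -> measurable_fun setT f -> (forall x, 0 <= f x)%E ->
  (\int[lebesgue_measure]_x f x =
   `|t|%:E * \int[lebesgue_measure]_x f (c + t * x)%R)%E.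
Proof.
move=> t0 mf f0.
pose phi := (fun x : measurableTypeR R => c + t * x : measurableTypeR R).
have mphi : measurable_fun setT phi by exact: measurable_affine.
have := ge0_integral_pushforward mphi (@lebesgue_measure R) measurableT mf (fun _ _ => f0 _).
rewrite preimage_setT /= => <-.
rewrite -(ge0_integral_mscale _ measurableT (NngNum (normr_ge0 t)))//.
apply: eq_measure_integral => A mA _.
exact: (lebesgue_measure_affine c t0 mA).
Qed.

Section exp_substitution.
Context {R : realType}.
Local Notation mu := (@lebesgue_measure R).
Local Open Scope ereal_scope.

(** The image under exp of the measure e^u du. Identifying it with Lebesgue measure on the half-line
    gives the substitution x = e^u for all nonnegative measurable functions at once. *)
Definition exp_image (A : set (measurableTypeR R)) : \bar R :=
  \int[mu]_(u in expR @^-1` A) (expR u)%:E.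

Lemma measurable_expR_preimage (A : set (measurableTypeR R)) :
  measurable A -> measurable (expR @^-1` A : set (measurableTypeR R)).
Proof. by move=> mA; rewrite -[X in measurable X]setTI; exact: measurable_expR. Qed.

Lemma exp_image_itv (a b : R) : (0 < a)%R -> (a < b)%R ->
  exp_image `]a, b] = (b - a)%:E.
Proof.
move=> a0 ab; have b0 := lt_trans a0 ab.
have -> : exp_image `]a, b] = \int[mu]_(u in `]ln a, ln b]) (expR u)%:E.
  rewrite /exp_image; congr (integral _ _ _).
  have ea u : (a < expR u)%R = (ln a < u)%R by rewrite -{1}[a]lnK// ltr_expR.
  have eb u : (expR u <= b)%R = (u <= ln b)%R by rewrite -{1}[b]lnK// ler_expR.
  by apply/seteqP; split => u /=; rewrite !in_itv/= ea eb.
rewrite integral_itv_obnd_cbnd; last first.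
  by apply/measurable_EFinP; apply: measurable_funTS; exact: measurable_expR.
rewrite (@continuous_FTC2 _ expR expR) ?lnK//.
- by rewrite ltr_ln.
- exact/continuous_subspaceT/continuous_expR.
- split.
  + by move=> x _; exact: derivable_expR.
  + by apply: cvg_at_right_filter; exact: continuous_expR.
  + by apply: cvg_at_left_filter; exact: continuous_expR.
- by move=> x _; rewrite derive1E; have /funeqP -> := @derive_expR R.
Qed.

Let exp_image0 : exp_image set0 = 0.
Proof. by rewrite /exp_image preimage_set0 integral_set0. Qed.

Let exp_image_ge0 A : 0 <= exp_image A.
Proof. by apply: integral_ge0 => u _; rewrite lee_fin expR_ge0. Qed.

Let exp_image_sigma_additive : semi_sigma_additive exp_image.
Proof.
move=> F mF tF mUF; rewrite /exp_image preimage_bigcup ge0_integral_bigcup//.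
- apply: is_cvg_ereal_nneg_natsum_cond => n _ _; exact: exp_image_ge0.
- by move=> i; exact: measurable_expR_preimage.
- by apply/measurable_EFinP; apply: measurable_funTS; exact: measurable_expR.
- apply/trivIsetP => /= i j _ _ ij; rewrite -preimage_setI.
  by move/trivIsetP : tF => /(_ _ _ _ _ ij) ->//; rewrite preimage_set0.
Qed.

HB.instance Definition _ := isMeasure.Build _ _ _ exp_image
  exp_image0 exp_image_ge0 exp_image_sigma_additive.

Lemma exp_image_itv0 (b : R) : (0 < b)%R -> exp_image `]0%R, b] = b%:E.
Proof.
(* The fundamental theorem of calculus needs a positive left end, so the interval is exhausted from
   inside. With [n.+2] the left end is below [b] already at n = 0. *)
move=> b0; pose F n : set (measurableTypeR R) := `](b / n.+2%:R)%R, b]%classic.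
have bn n : (0 < b / n.+2%:R)%R by rewrite divr_gt0.
have UF : \bigcup_n F n = `]0%R, b]%classic.
  apply/seteqP; split => x.
    by move=> [n _]; rewrite /F /= !in_itv/= => /andP[/(lt_trans (bn n)) -> ->].
  rewrite /= in_itv/= => /andP[x0 xb].
  have /ltr_add_invr[k] : (0 < x / b)%R by rewrite divr_gt0.
  rewrite add0r => kx; exists k => //; rewrite /F /= in_itv/= xb andbT.
  rewrite (@lt_le_trans _ _ (b * k.+1%:R^-1)%R)//.
    by rewrite ltr_pM2l// ltf_pV2 ?posrE// ltr_nat.
  by rewrite mulrC -ler_pdivlMr// ltW.
have ndF : nondecreasing_seq F.
  move=> i j ij; apply/subsetPset => x; rewrite /F /= !in_itv/= => /andP[+ ->].
  rewrite andbT; apply: le_lt_trans; rewrite ler_pM2l// lef_pV2 ?posrE//.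
  by rewrite ler_nat !ltnS.
have mF i : measurable (F i) by exact: measurable_itv.
have := @nondecreasing_cvg_mu _ _ _ exp_image F mF _ ndF.
rewrite UF => /(_ (measurable_itv _)) /cvg_lim <- //.
have -> : exp_image \o F = mu \o F.
  apply/funext => n /=; rewrite /F exp_image_itv//; last first.
    by rewrite ltr_pdivrMr// ltr_pMr// ltr1n.
  rewrite lebesgue_measure_itv/= lte_fin ltr_pdivrMr// ltr_pMr// ltr1n//.
have := @nondecreasing_cvg_mu _ _ _ mu F mF _ ndF.
rewrite UF => /(_ (measurable_itv _)) /cvg_lim -> //.
by have := lebesgue_measure_itv `]0%R, b]; rewrite /= lte_fin b0 oppr0 adde0.
Qed.

Lemma exp_image_gt0 A : measurable A -> exp_image A = mu (A `&` `]0%R, +oo[).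
Proof.
move=> mA.
have m0y : measurable (`]0%R, +oo[ : set (measurableTypeR R)) by [].
have mNy0 : measurable (`]-oo, 0%R] : set (measurableTypeR R)) by [].
(* Lebesgue measure is characterized by its values on intervals of the whole line, so the missing
   half-line is added. *)
pose nu := measure_add exp_image (mrestr mu mNy0).
have nuE X : nu X = exp_image X + mu (X `&` `]-oo, 0%R]) by exact: measure_addE.
suff : mu (A `&` `]0%R, +oo[) = nu (A `&` `]0%R, +oo[).
  move=> ->; rewrite nuE -setIA.
  rewrite (_ : `]0%R, +oo[ `&` `]-oo, 0%R] = set0)%classic; last first.
    apply/seteqP; split => x //=; rewrite !in_itv/= andbT => -[x0].
    by rewrite leNgt x0.
  rewrite setI0 measure0 adde0 /exp_image; congr (integral _ _ _).
  by apply/seteqP; split => u //=; [move=> ?|case]; rewrite ?in_itv/= ?expR_gt0.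
apply: lebesgue_measure_unique; last exact: measurableI.
move=> _ [[a b] _ <-]; rewrite [RHS]nuE.
have [ab|ba] := ltP a b; last first.
  by rewrite set_itv_ge ?bnd_simp -?leNgt// set0I !measure0 adde0.
have [a0|a0] := ltP 0%R a.
  rewrite (_ : `]a, b] `&` `]-oo, 0%R] = set0)%classic; last first.
    apply/seteqP; split => x //=; rewrite !in_itv/= => -[/andP[ax _]].
    by rewrite leNgt (lt_trans a0 ax).
  by rewrite measure0 adde0 exp_image_itv// lebesgue_measure_itv/= lte_fin ab.
have [b0|b0] := ltP 0%R b; last first.
  rewrite (_ : exp_image `]a, b] = 0); last first.
    rewrite /exp_image (_ : expR @^-1` _ = set0) ?integral_set0//.
    apply/seteqP; split => u //=; rewrite in_itv/= => /andP[_ ub].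
    by have := lt_le_trans (expR_gt0 u) ub; rewrite ltNge b0.
  rewrite add0e; congr (mu _); apply/seteqP; split => x //=; last by case.
  by rewrite !in_itv/= => /andP[ax xb]; split; rewrite ?ax ?xb// (le_trans xb).
rewrite (_ : exp_image `]a, b] = exp_image `]0%R, b]); last first.
  rewrite /exp_image; congr (integral _ _ _); apply/seteqP; split => u /=.
    by rewrite !in_itv/= expR_gt0 => /andP[].
  by rewrite !in_itv/= (le_lt_trans a0 (expR_gt0 u)) => /andP[].
rewrite exp_image_itv0// (_ : `]a, b] `&` `]-oo, 0%R] = `]a, 0%R])%classic; last first.
  apply/seteqP; split => x /=; rewrite !in_itv/=; first by case=> /andP[-> _].
  by move=> /andP[-> x0]; rewrite x0 (le_trans x0)// ltW.
rewrite !lebesgue_measure_itv/= !lte_fin ab.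
have [a00|] := ltP a 0%R; first by rewrite -!EFinB -EFinD; congr EFin; ring.
by move=> a00; rewrite (@le_anti _ _ a 0%R) ?a0// oppr0.
Qed.

End exp_substitution.

Section weighted_pushforward.
Local Open Scope ereal_scope.
Context d1 d2 (X : measurableType d1) (Y : measurableType d2) (R : realType).
Variables (phi : X -> Y) (g : X -> R).
Variables (mu : {measure set X -> \bar R}) (nu : {measure set Y -> \bar R}).

Import HBNNSimple.

(** Simple functions, then monotone convergence. With [phi] = exp this is the substitution x = e^u;
    with [phi] the identity it is integration against a density. *)
Lemma ge0_integral_weighted_pushforward (f : Y -> \bar R) :
  measurable_fun setT phi -> measurable_fun setT g -> (forall x, 0 <= g x)%R ->
  (forall A, measurable A -> nu A = \int[mu]_(x in phi @^-1` A) (g x)%:E) ->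
  measurable_fun setT f -> (forall y, 0 <= f y) ->
  \int[nu]_y f y = \int[mu]_x (f (phi x) * (g x)%:E).
Proof.
move=> mphi mg' g0' nuE mf f0.
have g0 x : 0 <= (g x)%:E by rewrite lee_fin.
have mg : measurable_fun setT (EFin \o g) by exact/measurable_EFinP.
pose f_ := nnsfun_approx measurableT mf.
have mf_ n : measurable_fun setT (fun x => (f_ n (phi x))%:E).
  by apply/measurable_EFinP; exact: measurableT_comp.
transitivity (limn (fun n => \int[nu]_y (f_ n y)%:E)).
  rewrite -monotone_convergence//.
  - apply: eq_integral => y _; apply/esym/cvg_lim => //.
    by apply: cvg_nnsfun_approx.
  - by move=> n; exact/measurable_EFinP/measurable_funP.
  - by move=> n y _; rewrite lee_fin.
  - by move=> y _ m n mn; rewrite lee_fin; exact/lefP/nd_nnsfun_approx.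
rewrite (_ : \int[mu]_x _ = limn (fun n => \int[mu]_x ((f_ n (phi x))%:E * (g x)%:E))); last first.
  rewrite -monotone_convergence//.
  - apply: eq_integral => x _; apply/esym/cvg_lim => //.
    by apply: cvgeZr => //; exact: cvg_nnsfun_approx.
  - by move=> n; exact: emeasurable_funM.
  - by move=> n x _; rewrite mule_ge0// lee_fin.
  - by move=> x _ m n mn; rewrite lee_wpmul2r// lee_fin; exact/lefP/nd_nnsfun_approx.
congr (limn _); apply/funext => n.
have mE r : measurable (f_ n @^-1` [set r]) by [].
have mI r : measurable_fun setT (fun x => (\1_(phi @^-1` (f_ n @^-1` [set r])) x : R)).
  apply: measurable_indic; rewrite -(setTI (_ @^-1` _)); exact: mphi.
transitivity (\sum_(k \in range (f_ n))
    \int[mu]_x ((k * \1_(phi @^-1` (f_ n @^-1` [set k])) x)%:E * (g x)%:E)).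
  under eq_integral do rewrite fimfunE -fsumEFin//.
  rewrite ge0_integral_fsum//; last 2 first.
  - by move=> y; exact/measurable_EFinP/measurable_funM.
  - by move=> y x _; rewrite nnfun_muleindic_ge0.
  apply: eq_fsbigr => r _; rewrite integralZl_indic_nnsfun// integral_indic//=.
  rewrite setIT nuE//.
  under [RHS]eq_integral do rewrite EFinM -muleA.
  have [r0|r0] := ltP r 0%R.
    rewrite preimage_nnfun0// preimage_set0 integral_set0 mule0.
    by rewrite integral0_eq// => x _; rewrite indic0 mul0e mule0.
  rewrite ge0_integralZl//; last 2 first.
  - by apply: emeasurable_funM => //; exact/measurable_EFinP.
  - by move=> x _; rewrite mule_ge0// lee_fin.
  congr (_ * _); rewrite integral_mkcond; apply: eq_integral => x _.
  rewrite patchE indicE; case: ifPn => _; rewrite ?mul1e ?mul0e//.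
rewrite -ge0_integral_fsum//.
- apply: eq_integral => x _.
  rewrite [in RHS]fimfunE -fsumEFin// ge0_mule_fsuml//.
  by move=> r; rewrite nnfun_muleindic_ge0.
- move=> r; apply: emeasurable_funM => //; apply/measurable_EFinP.
  exact: measurable_funM.
- by move=> r x _; rewrite mule_ge0// nnfun_muleindic_ge0.
Qed.

End weighted_pushforward.

Lemma ge0_integral_exp {R : realType} (f : measurableTypeR R -> \bar R) :
  measurable_fun setT f -> (forall x, 0 <= f x)%E ->
  (\int[lebesgue_measure]_(x in `]0%R, +oo[) f x =
   \int[lebesgue_measure]_u (f (expR u) * (expR u)%:E))%E.
Proof.
move=> mf f0.
have m0y : measurable (`]0%R, +oo[ : set (measurableTypeR R)) by [].
transitivity (\int[exp_image]_(x in `]0%R, +oo[) f x)%E.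
  apply: eq_measure_integral => A mA A0; rewrite [RHS](exp_image_gt0 mA).
  by congr (lebesgue_measure _); apply/esym/setIidPl.
rewrite integral_mkcond.
rewrite (@ge0_integral_weighted_pushforward _ _ (measurableTypeR R) (measurableTypeR R) R
  expR expR lebesgue_measure exp_image)//.
- apply: eq_integral => u _; rewrite patchE mem_set//= in_itv/= expR_gt0//.
- exact/(measurable_restrictT _ _).1/measurable_funTS.
- by move=> y; exact: erestrict_ge0.
Qed.

Section measurable_composition.
Context d (T : measurableType d) (R : realType) (D : set T) (f : T -> R).
Hypothesis mf : measurable_fun D f.

Lemma measurable_fun_expR : measurable_fun D (fun x => expR (f x)).
Proof. exact: measurableT_comp. Qed.

Lemma measurable_fun_powR q : measurable_fun D (fun x => f x `^ q).
Proof. exact: (measurableT_comp (measurable_powR q)). Qed.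

Lemma measurable_fun_normr : measurable_fun D (fun x => `|f x|).
Proof. exact: measurableT_comp. Qed.

End measurable_composition.

(* Reduces measurability of a real expression in a variable to that of its
   atoms; pattern matching on the head symbol keeps unification first-order. *)
Ltac mfun := repeat (
  lazymatch goal with
  | |- measurable_fun _ (fun _ => ?c) => exact: measurable_cst
  | |- measurable_fun _ (fun x => x) => exact: measurable_id
  | |- measurable_fun _ (fun x => EFin (@?f x)) => apply/(@measurable_EFinP _ _ _ _ f)
  | |- measurable_fun _ (EFin \o _) => apply/measurable_EFinP
  | |- measurable_fun _ (fun x => GRing.add (@?f x) (GRing.opp (@?g x))) => apply: (@measurable_funB _ _ _ _ f g)
  | |- measurable_fun _ (fun x => GRing.add (@?f x) (@?g x)) => apply: (@measurable_funD _ _ _ _ f g)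
  | |- measurable_fun _ (fun x => GRing.mul (@?f x) (@?g x)) => apply: (@measurable_funM _ _ _ _ f g)
  | |- measurable_fun _ (fun x => GRing.opp (@?f x)) => apply: (@measurable_funN _ _ _ _ f)
  | |- measurable_fun _ (fun x => GRing.exp (@?f x) ?n) => apply: (@measurable_funX _ _ _ _ f n)
  | |- measurable_fun _ (fun x => expR (@?f x)) => apply: (@measurable_fun_expR _ _ _ _ f)
  | |- measurable_fun _ (fun x => powR (@?f x) ?q) => apply: (@measurable_fun_powR _ _ _ _ f)
  | |- measurable_fun _ (fun x => Num.norm (@?f x)) => apply: (@measurable_fun_normr _ _ _ _ f)
  end; cbv beta); try assumption.

Section nonneg_integral.
Local Open Scope ereal_scope.
Context d (T : measurableType d) (R : realType) (mu : {measure set T -> \bar R}).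

Lemma integral_gt0 (D : set T) (f : T -> \bar R) : measurable D ->
  measurable_fun D f -> (forall x, D x -> 0 < f x) -> 0 < mu D ->
  0 < \int[mu]_(x in D) f x.
Proof.
move=> mD mf f0 D0; rewrite lt_neqAle; apply/andP; split; last first.
  by apply: integral_ge0 => x Dx; exact/ltW/f0.
apply/eqP => if0.
have /(ae_eq_integral_abs _ mD mf)[N [mN N0 sN]] : \int[mu]_(x in D) `|f x| = 0.
  rewrite if0; apply: eq_integral => x; rewrite inE => Dx.
  by rewrite gee0_abs// ltW// f0.
have : mu D <= mu N.
  apply: le_measure; rewrite ?inE//; apply: subset_trans sN => x Dx /= /(_ Dx).
  by move=> fx0; have := f0 _ Dx; rewrite fx0 ltxx.
by rewrite N0 leNgt D0.
Qed.

Implicit Types f g : T -> R.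

Lemma ge0_integralZ_EFin (k : R) f : (0 <= k)%R -> measurable_fun setT f ->
  (forall x, 0 <= f x)%R ->
  \int[mu]_x (k * f x)%:E = k%:E * \int[mu]_x (f x)%:E.
Proof.
move=> k0 mf f0; rewrite -ge0_integralZl_EFin//.
- by move=> x _; rewrite lee_fin.
- exact/measurable_EFinP.
Qed.

Lemma ge0_integralD_EFin f g : measurable_fun setT f -> measurable_fun setT g ->
  (forall x, 0 <= f x)%R -> (forall x, 0 <= g x)%R ->
  \int[mu]_x (f x + g x)%:E = \int[mu]_x (f x)%:E + \int[mu]_x (g x)%:E.
Proof.
move=> mf mg f0 g0; rewrite -ge0_integralD//.
- by move=> x _; rewrite lee_fin.
- exact/measurable_EFinP.
- by move=> x _; rewrite lee_fin.
- exact/measurable_EFinP.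
Qed.

Lemma ge0_le_integral_EFin f g : measurable_fun setT f -> measurable_fun setT g ->
  (forall x, 0 <= f x)%R -> (forall x, f x <= g x)%R ->
  \int[mu]_x (f x)%:E <= \int[mu]_x (g x)%:E.
Proof.
move=> mf mg f0 fg; apply: ge0_le_integral => //.
- by move=> x _; rewrite lee_fin.
- exact/measurable_EFinP.
- exact/measurable_EFinP.
- by move=> x _; rewrite lee_fin.
Qed.

Lemma ge0_integral_lin f g (k1 k2 F G : R) : (0 <= k1)%R -> (0 <= k2)%R ->
  measurable_fun setT f -> measurable_fun setT g ->
  (forall x, 0 <= f x)%R -> (forall x, 0 <= g x)%R ->
  \int[mu]_x (f x)%:E = F%:E -> \int[mu]_x (g x)%:E = G%:E ->
  \int[mu]_x (k1 * f x + k2 * g x)%:E = (k1 * F + k2 * G)%:E.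
Proof.
move=> k10 k20 mf mg f0 g0 fF gG.
rewrite (@ge0_integralD_EFin (fun x => k1 * f x)%R (fun x => k2 * g x)%R).
- by rewrite !ge0_integralZ_EFin// fF gG.
- exact: measurable_funM.
- exact: measurable_funM.
- by move=> x; rewrite mulr_ge0.
- by move=> x; rewrite mulr_ge0.
Qed.

Lemma ge0_le_integral_val f g (F G : R) :
  measurable_fun setT f -> measurable_fun setT g ->
  (forall x, 0 <= f x)%R -> (forall x, f x <= g x)%R ->
  \int[mu]_x (f x)%:E = F%:E -> \int[mu]_x (g x)%:E = G%:E -> (F <= G)%R.
Proof. by move=> mf mg f0 fg fF gG; rewrite -lee_fin -fF -gG ge0_le_integral_EFin. Qed.

End nonneg_integral.

Lemma lebesgue_measure_itv_gt0 (R : realType) (a b : R) : a < b ->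
  (0 < (@lebesgue_measure R) `]a, b])%E.
Proof. by move=> ab; rewrite lebesgue_measure_itv/= lte_fin ab -EFinB lte_fin subr_gt0. Qed.

Lemma ge0_integral_even (R : realType) (f : measurableTypeR R -> \bar R) :
  measurable_fun setT f -> (forall x, 0 <= f x)%E -> (forall x, f (- x)%R = f x) ->
  (\int[lebesgue_measure]_x f x =
   2%:E * \int[lebesgue_measure]_(x in `]0%R, +oo[) f x)%E.
Proof.
move=> mf f0 ef.
rewrite -(setUv (`[0%R, +oo[ : set (measurableTypeR R))) ge0_integral_setU//; last 3 first.
- exact: measurableC.
- by rewrite setUv.
- by rewrite disj_set2E setICr.
rewrite setCitvr.
rewrite integral_itv_bndo_bndc; last exact: measurable_funTS.
rewrite (integral_itv_obnd_cbnd (measurable_funTS mf)).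
rewrite [X in (_ + X)%E](_ : _ = \int[lebesgue_measure]_(x in `[0%R, +oo[) f x)%E.
  by rewrite -[(_ + _)%E]/(_) -{1 2}[X in (X + X)%E]mul1e -ge0_muleDl.
rewrite ge0_integration_by_substitution0//.
by apply: eq_integral => x _; rewrite ef.
Qed.

(** * Generalized inverse Gaussian and Gaussian integrals *)

Section gig_integral.
Context {R : realType}.
Implicit Types l a b c q t u : R.
Local Notation mu := (@lebesgue_measure R).

(* [gig_kernel l a b] in the coordinate [u = ln x], with the Jacobian. *)
Definition gigw l a b u := expR (l * u - 2^-1 * (a * expR u + b * expR (- u))).

Definition gigW l a b : \bar R := (\int[mu]_u (gigw l a b u)%:E)%E.

Lemma measurable_gigw l a b : measurable_fun setT (gigw l a b).
Proof. by rewrite (_ : gigw l a b = fun u => expR (l * u - 2^-1 * (a * expR u + b * expR (- u)))) //; mfun. Qed.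

Lemma gigw_gt0 l a b u : 0 < gigw l a b u. Proof. exact: expR_gt0. Qed.

Lemma gigW_gt0 l a b : (0 < gigW l a b)%E.
Proof.
apply: integral_gt0 => //.
- by apply/measurable_EFinP; exact: measurable_gigw.
- by move=> u _; rewrite lte_fin gigw_gt0.
- apply: (@lt_le_trans _ _ (mu `]0, 1])); last by apply: le_measure; rewrite ?inE.
  by rewrite lebesgue_measure_itv/= lte_fin ltr01 oppr0 adde0 lte_fin.
Qed.

(** Integrability of [gigw]: the third condition is decay as u tends to +oo, the fourth decay as u
    tends to -oo. *)
Definition gig_fin l a b := [/\ 0 <= a, 0 <= b, (0 < a) || (l < 0) & (0 < b) || (0 < l)].

(** If a = 0 the exponent is already linear with negative slope. If a > 0, e^u >= u^2 / 4 and
    completing the square absorbs (l + 1) u, which leaves slope -1. *)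
Lemma gigw_tail l a : 0 <= a -> (0 < a) || (l < 0) ->
  exists C d : R, 0 < d /\ forall u, 0 <= u -> l * u - 2^-1 * (a * expR u) <= C - d * u.
Proof.
move=> a0; have [a_gt0 _|a_le0 /= l0] := ltP 0 a; last first.
  exists 0, (- l); split; first by rewrite oppr_gt0.
  move=> u u0; have : a = 0 by apply/le_anti; rewrite a_le0 a0.
  by move=> ->; rewrite !mul0r mulr0; lra.
exists (2 * (l + 1) ^+ 2 / a), 1; split=> // u u0.
have eu : u ^+ 2 / 4 <= expR u.
  have h : 1 + u / 2 <= expR (u / 2) := expR_ge1Dx _.
  have -> : expR u = expR (u / 2) ^+ 2 by rewrite -expRM_natr; congr expR; field.
  rewrite (le_trans (_ : _ <= (1 + u / 2) ^+ 2))//; first by nra.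
  by rewrite lerXn2r// nnegrE; [lra|exact: expR_ge0].
have h : (l + 1) * u <= 2 * (l + 1) ^+ 2 / a + a * u ^+ 2 / 8.
  have : 0 <= a / 8 * (u - 4 * (l + 1) / a) ^+ 2 by rewrite mulr_ge0 ?sqr_ge0//; lra.
  have -> : a / 8 * (u - 4 * (l + 1) / a) ^+ 2 =
    a * u ^+ 2 / 8 - (l + 1) * u + 2 * (l + 1) ^+ 2 / a by field; exact: lt0r_neq0.
  by lra.
have h2 : a * (u ^+ 2 / 4) <= a * expR u by rewrite ler_pM2l.
lra.
Qed.

(** The reflection u -> -u exchanges [a] and [b] and changes the sign of [l], so the tail estimate
    at +oo serves both ends. *)
Lemma gigw_ub l a b : gig_fin l a b -> exists C d : R, 0 < d /\
  forall u, gigw l a b u <= C * (exponential_pdf d u + exponential_pdf d (- u)).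
Proof.
move=> [a0 b0 al bl].
have [C1 [d1 [d10 h1]]] := gigw_tail a0 al.
have [|C2 [d2 [d20 h2]]] := @gigw_tail (- l) b b0; first by rewrite oppr_lt0.
pose d := Num.min d1 d2; have d0 : 0 < d by rewrite lt_min d10.
pose C := Num.max C1 C2.
exists (expR C / d), d; split=> // u.
have [u0|u0] := leP 0 u.
  rewrite (@le_trans _ _ (expR C / d * exponential_pdf d u))//; last first.
    rewrite ler_wpM2l ?divr_ge0 ?expR_ge0 ?(ltW d0)// lerDl exponential_pdf_ge0//.
    exact: ltW.
  rewrite exponential_pdfE// mulrA divfK ?lt0r_neq0// -expRD ler_expR.
  have := h1 _ u0; have : 0 <= b * expR (- u) by rewrite mulr_ge0 ?expR_ge0.
  have : C1 <= C by rewrite le_max lexx.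
  have : d * u <= d1 * u by rewrite ler_wpM2r// ge_min lexx.
  lra.
rewrite (@le_trans _ _ (expR C / d * exponential_pdf d (- u)))//; last first.
  rewrite ler_wpM2l ?divr_ge0 ?expR_ge0 ?(ltW d0)// lerDr exponential_pdf_ge0//.
  exact: ltW.
rewrite exponential_pdfE ?mulrA ?divfK ?lt0r_neq0// -?expRD ?ler_expR; last lra.
have u0' : 0 <= - u by lra.
have := h2 _ u0'; have : 0 <= a * expR u by rewrite mulr_ge0 ?expR_ge0.
have : C2 <= C by rewrite le_max lexx orbT.
have : d * (- u) <= d2 * (- u) by rewrite ler_wpM2r// ge_min lexx orbT.
lra.
Qed.

Lemma gigW_lty l a b : gig_fin l a b -> (gigW l a b < +oo)%E.
Proof.
move=> /gigw_ub[C [d [d0 h]]].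
have mp : measurable_fun setT (exponential_pdf d : measurableTypeR R -> R).
  exact: measurable_exponential_pdf.
have p0 u : 0 <= exponential_pdf d u by apply: exponential_pdf_ge0; exact: ltW.
have C0 : 0 <= C.
  have := lt_le_trans (gigw_gt0 l a b 0) (h 0); rewrite oppr0.
  by have := p0 0; nra.
have mNp : measurable_fun setT (fun u : measurableTypeR R => exponential_pdf d (- u)).
  by apply: (measurableT_comp mp); exact: oppr_measurable.
rewrite (@le_lt_trans _ _ (C%:E * (1 + 1))%E)//; last by rewrite -EFinD -EFinM ltry.
rewrite -{1}(integral_exponential_pdf d0).
have -> : (1 = \int[mu]_u (exponential_pdf d (- u))%:E)%E.
  rewrite -(integral_exponential_pdf d0) (@ge0_integral_affine _ 0 (-1))//.
  - by rewrite normrN1 mul1e; apply: eq_integral => u _; rewrite add0r mulN1r.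
  - exact/measurable_EFinP.
rewrite -ge0_integralD//; last 4 first.
- by move=> u _; rewrite lee_fin.
- exact/measurable_EFinP.
- by move=> u _; rewrite lee_fin.
- exact/measurable_EFinP.
rewrite -ge0_integralZl//; last 2 first.
- by apply: emeasurable_funD; exact/measurable_EFinP.
- by move=> u _; rewrite adde_ge0// lee_fin.
apply: ge0_le_integral => //.
- by move=> u _; rewrite lee_fin ltW// gigw_gt0.
- by apply/measurable_EFinP; exact: measurable_gigw.
- by apply: measurable_funeM; apply: emeasurable_funD; exact/measurable_EFinP.
- by move=> u _; rewrite -EFinD -EFinM lee_fin.
Qed.

Lemma gigW_affine l a b c t : t != 0 ->
  gigW l a b = (`|t|%:E * \int[mu]_u (gigw l a b (c + t * u))%:E)%E.
Proof.
move=> t0; apply: (@ge0_integral_affine _ c t (EFin \o gigw l a b) t0).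
  by apply/measurable_EFinP; exact: measurable_gigw.
by move=> u; rewrite lee_fin ltW// gigw_gt0.
Qed.

Lemma gigW_scale l a b c : 0 < c ->
  (gigW l a b = (c `^ l)%:E * gigW l (c * a) (b / c))%E.
Proof.
move=> c0; rewrite (gigW_affine _ _ _ (ln c) (oner_neq0 R)).
rewrite normr1 mul1e -ge0_integralZ_EFin ?powR_ge0//; last 2 first.
- exact: measurable_gigw.
- by move=> u; rewrite ltW// gigw_gt0.
apply: eq_integral => u _; congr EFin.
rewrite /gigw /powR gt_eqF// -expRD mul1r.
have -> : expR (ln c + u) = c * expR u by rewrite expRD lnK.
have -> : expR (- (ln c + u)) = expR (- u) / c by rewrite opprD expRD mulrC (expRN (ln c)) lnK.
by congr expR; field; exact: lt0r_neq0.
Qed.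

Lemma gigW_reflect l a b : gigW l a b = gigW (- l) b a.
Proof.
have N1 : -1 != 0 :> R by rewrite oppr_eq0 oner_neq0.
rewrite (gigW_affine _ _ _ 0 N1).
rewrite normrN1 mul1e; apply: eq_integral => u _; congr EFin.
by rewrite /gigw; congr expR; rewrite add0r mulN1r opprK; ring.
Qed.

(** The substitution x = e^(u/2) on the half-line. Gaussian absolute moments thus lie in the family
    of the GIG integrals, which is what lets [gw_ratio_index] weigh one half-step of the sampler
    against the other. *)
Lemma integral_normr_gauss q t :
  (\int[mu]_x (`|x| `^ q * expR (- (t * x ^+ 2 / 2)))%:E = gigW ((q + 1) / 2) t 0)%E.
Proof.
have mf : measurable_fun setT (fun x : measurableTypeR R => (`|x| `^ q * expR (- (t * x ^+ 2 / 2)))%:E).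
  by mfun.
have f0 (x : R) : (0 <= (`|x| `^ q * expR (- (t * x ^+ 2 / 2)))%:E)%E.
  by rewrite lee_fin mulr_ge0 ?powR_ge0 ?expR_ge0.
rewrite (ge0_integral_even mf f0); last by move=> x; rewrite normrN sqrrN.
rewrite (ge0_integral_exp mf f0).
have h0 : 2^-1 != 0 :> R by rewrite invr_eq0.
rewrite (@ge0_integral_affine _ 0 2^-1
  (fun u => (`|expR u| `^ q * expR (- (t * expR u ^+ 2 / 2)))%:E * (expR u)%:E)%E h0); last 2 first.
- by apply: emeasurable_funM; mfun.
- by move=> x; rewrite -EFinM lee_fin !mulr_ge0 ?powR_ge0 ?expR_ge0.
rewrite muleA -EFinM ger0_norm ?invr_ge0// divff// mul1e.
apply: eq_integral => u _; rewrite -EFinM; congr EFin.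
rewrite /gigw add0r ger0_norm ?expR_ge0// -expRM -!expRD; congr expR.
have -> : expR (2^-1 * u) ^+ 2 = expR u by rewrite -expRM_natr; congr expR; field.
by field.
Qed.

Lemma gigW_half t : 0 < t -> gigW 2^-1 t 0 = (Num.sqrt (2 * pi / t))%:E.
Proof.
move=> t0.
have -> : gigW 2^-1 t 0 = (\int[mu]_x (expR (- (t * x ^+ 2 / 2)))%:E)%E.
  rewrite (_ : gigW 2^-1 t 0 = gigW ((0 + 1) / 2) t 0); last by rewrite add0r mul1r.
  rewrite -integral_normr_gauss; apply: eq_integral => x _.
  by rewrite powRr0 mul1r.
have s0 : 0 < Num.sqrt (2 / t) by rewrite sqrtr_gt0 divr_gt0.
rewrite (@ge0_integral_affine _ 0 _ (fun x => (expR (- (t * x ^+ 2 / 2)))%:E) (lt0r_neq0 s0)); last 2 first.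
- by mfun.
- by move=> x; rewrite lee_fin expR_ge0.
rewrite gtr0_norm// (_ : 2 * pi / t = (2 / t) * pi); last by field; exact: lt0r_neq0.
have -> : (Num.sqrt (2 / t * pi))%:E = ((Num.sqrt (2 / t))%:E * (Num.sqrt pi)%:E)%E.
  by rewrite sqrtrM ?divr_ge0 ?(ltW t0)// EFinM.
have <- := @integralT_gauss R; congr (_ * _)%E.
apply: eq_integral => x _; congr EFin; rewrite /gauss_fun; congr expR.
rewrite add0r exprMn sqr_sqrtr ?divr_ge0 ?(ltW t0)//.
by field; exact: lt0r_neq0.
Qed.

End gig_integral.

(* Locked, as unification would otherwise compare integrals. *)
HB.lock Definition gw (R : realType) (l a b : R) : R := fine (gigW l a b).
Canonical gw_unlockable := Unlockable gw.unlock.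

(** * Ratios of GIG moments *)

Section moment_comparison.
Context {R : realType}.
Implicit Types (l a b c q t u s : R) (w r : R -> R).
Local Notation mu := (@lebesgue_measure R).

(* Chebyshev's association inequality: with [c] the [w]-mean of [f u = e^(su)],
   attained at [u0], the integrand of [D] is [(f - c) (r - r u0) w]. *)
Lemma chebyshev_expR s w r (I F B G : R) : 0 < s ->
  measurable_fun setT w -> measurable_fun setT r ->
  (forall u, 0 < w u) -> (forall u, 0 <= r u) -> {homo r : x y / x <= y} ->
  (\int[mu]_u (w u)%:E = I%:E)%E ->
  (\int[mu]_u (expR (s * u) * w u)%:E = F%:E)%E ->
  (\int[mu]_u (r u * w u)%:E = B%:E)%E ->
  (\int[mu]_u (expR (s * u) * r u * w u)%:E = G%:E)%E ->
  F * B <= G * I /\ ({homo r : x y / x < y} -> F * B < G * I).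
Proof.
move=> s0 mw mr w0 r0 hr EI EF EB EG.
have w0' u : 0 <= w u by exact/ltW.
have posint (f : R -> R) (x : R) : measurable_fun setT f -> (forall u, 0 < f u) ->
    (\int[mu]_u (f u)%:E = x%:E)%E -> 0 < x.
  move=> mf f0 fx; rewrite -lte_fin -fx; apply: integral_gt0 => //.
  - exact/measurable_EFinP.
  - by move=> u _; rewrite lte_fin.
  - apply: (@lt_le_trans _ _ (mu `]0, 1])); last by apply: le_measure; rewrite ?inE.
    by rewrite lebesgue_measure_itv/= lte_fin ltr01 oppr0 adde0 lte_fin.
have I0 : 0 < I by apply: posint EI.
have F0 : 0 < F.
  by apply: posint EF => [|u]; [mfun|rewrite mulr_gt0 ?expR_gt0].
pose c := F / I; have c0 : 0 < c by rewrite divr_gt0.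
pose u0 := ln c / s.
have eu0 : expR (s * u0) = c by rewrite /u0 mulrCA divff ?lt0r_neq0// mulr1 lnK.
pose D u := (expR (s * u) - c) * (r u - r u0) * w u.
have mD : measurable_fun setT D.
  rewrite (_ : D = fun u => (expR (s * u) - c) * (r u - r u0) * w u)//.
  by mfun.
have D0 u : 0 <= D u.
  rewrite /D mulr_ge0//; have [uu|uu] := leP u0 u.
    by rewrite mulr_ge0// subr_ge0 ?hr// -eu0 ler_expR ler_pM2l.
  by rewrite mulr_le0// subr_le0 ?hr ?(ltW uu)// -eu0 ler_expR ler_pM2l// ltW.
have iD : (\int[mu]_u (D u)%:E = (G - c * B)%:E)%E.
  have mc1 : measurable_fun setT (fun u => expR (s * u) * r u * w u) by mfun.
  have mc5 : measurable_fun setT (fun u => r u * w u) by mfun.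
  have mc6 : measurable_fun setT (fun u => expR (s * u) * w u) by mfun.
  have cr0 : 0 <= c * r u0 by rewrite mulr_ge0// ltW.
  have n1 u : 0 <= expR (s * u) * r u * w u by rewrite !mulr_ge0 ?expR_ge0.
  have n5 u : 0 <= r u * w u by rewrite !mulr_ge0.
  have n6 u : 0 <= expR (s * u) * w u by rewrite !mulr_ge0 ?expR_ge0.
  have e1 := (@ge0_integral_lin _ (measurableTypeR R) R mu _ _ _ _ _ _) ler01 cr0 mc1 mw n1 w0' EG EI.
  have e2 := (@ge0_integral_lin _ (measurableTypeR R) R mu _ _ _ _ _ _) (ltW c0) (r0 u0) mc5 mc6 n5 n6 EB EF.
  (* Both [h] and [h + D] are nonnegative combinations of the four given integrands, so the integral
     of [D] is found without integrating signed functions. *)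
  pose h u := c * (r u * w u) + r u0 * (expR (s * u) * w u).
  have e3 : (\int[mu]_u (h u + D u)%:E = \int[mu]_u (h u)%:E + \int[mu]_u (D u)%:E)%E.
    apply: ge0_integralD_EFin => //; first by rewrite /h; mfun.
    by move=> u; rewrite /h addr_ge0// mulr_ge0// ltW.
  have e4 : (\int[mu]_u (h u + D u)%:E = (1 * G + c * r u0 * I)%:E)%E.
    by rewrite -e1; apply: eq_integral => u _; congr EFin; rewrite /h /D; ring.
  have e5 : (\int[mu]_u (h u)%:E = (c * B + r u0 * F)%:E)%E by exact: e2.
  move: e3; rewrite e4 e5.
  case: (\int[mu]_u (D u)%:E)%E => [x| |] //.
  rewrite -EFinD => -[] hh; congr EFin.
  have : c * r u0 * I = r u0 * F by rewrite /c; field; exact: lt0r_neq0.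
  by move: hh; lra.
have GcB : G - c * B = (G * I - F * B) / I.
  by rewrite /c; field; exact: lt0r_neq0.
split.
  rewrite -subr_ge0 -(pmulr_lge0 _ (_ : 0 < I^-1)) ?invr_gt0// -GcB -lee_fin -iD.
  by apply: integral_ge0 => u _; rewrite lee_fin.
move=> sr; rewrite -subr_gt0 -(pmulr_lgt0 _ (_ : 0 < I^-1)) ?invr_gt0// -GcB -lte_fin -iD.
(* For strictness it is enough that [D] is positive on an interval to the right of [u0]. *)
apply: (@lt_le_trans _ _ (\int[mu]_(u in `]u0, (u0 + 1)%R]) (D u)%:E)%E); last first.
  apply: ge0_subset_integral => //; first exact/measurable_EFinP.
  by move=> u _; rewrite lee_fin.
apply: integral_gt0 => //.
- by apply/measurable_EFinP; exact: measurable_funTS.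
- move=> u; rewrite /= in_itv/= => /andP[uu _]; rewrite lte_fin /D !mulr_gt0//.
  + by rewrite subr_gt0 -eu0 ltr_expR ltr_pM2l.
  + by rewrite subr_gt0 sr.
- by apply: lebesgue_measure_itv_gt0; rewrite ltrDl.
Qed.

Lemma gw_def l a b : gw l a b = fine (gigW l a b).
Proof. by rewrite unlock. Qed.

Lemma gwE l a b : gig_fin l a b -> gigW l a b = (gw l a b)%:E.
Proof. by move=> h; rewrite gw_def fineK// ge0_fin_numE ?gigW_lty// ltW// gigW_gt0. Qed.

Lemma integral_gigw l a b : gig_fin l a b ->
  (\int[mu]_u (gigw l a b u)%:E = (gw l a b)%:E)%E.
Proof. exact: gwE. Qed.

Lemma gw_gt0 l a b : gig_fin l a b -> 0 < gw l a b.
Proof. by move=> h; rewrite -lte_fin -gwE// gigW_gt0. Qed.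

Lemma gw_scale l a b c : 0 < c -> gw l a b = c `^ l * gw l (c * a) (b / c).
Proof.
move=> c0; rewrite !gw_def (gigW_scale _ _ _ c0).
(* A positive factor keeps an infinite integral infinite, and [fine] then makes both sides 0. *)
case: (gigW l (c * a) (b / c)) => [x| |]//=.
  by rewrite gt0_muley ?lte_fin ?powR_gt0//= mulr0.
by rewrite gt0_muleNy ?lte_fin ?powR_gt0//= mulr0.
Qed.

Lemma gw_reflect l a b : gw l a b = gw (- l) b a.
Proof. by rewrite !gw_def gigW_reflect. Qed.

Lemma gigw_shift s l a b u : expR (s * u) * gigw l a b u = gigw (l + s) a b u.
Proof. by rewrite /gigw -expRD; congr expR; ring. Qed.

(** Association of e^(su) and e^((l'-l)u) under the weight of index [l]: the ratio gw (l + s) / gw l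
    increases with [l]. The strict form is the origin of lam < 1 for the powers s and -s. *)
Lemma gw_ratio_index s l l' a b : 0 < s -> l <= l' ->
  gig_fin l a b -> gig_fin l' a b -> gig_fin (l + s) a b -> gig_fin (l' + s) a b ->
  gw (l + s) a b * gw l' a b <= gw (l' + s) a b * gw l a b /\
  (l < l' -> gw (l + s) a b * gw l' a b < gw (l' + s) a b * gw l a b).
Proof.
move=> s0 ll f1 f2 f3 f4.
have [|||||||||h1 h2] := @chebyshev_expR s (gigw l a b) (fun u => expR ((l' - l) * u))
  (gw l a b) (gw (l + s) a b) (gw l' a b) (gw (l' + s) a b) s0.
- exact: measurable_gigw.
- by mfun.
- by move=> u; exact: gigw_gt0.
- by move=> u; exact: expR_ge0.
- by move=> x y xy; rewrite ler_expR ler_wpM2l// subr_ge0.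
- exact: gwE.
- by rewrite -gwE//; apply: eq_integral => u _; rewrite gigw_shift.
- by rewrite -gwE//; apply: eq_integral => u _; rewrite gigw_shift subrKC.
- by rewrite -gwE//; apply: eq_integral => u _; rewrite -mulrA !gigw_shift subrKC.
split=> // lt; apply: h2 => x y xy; rewrite ltr_expR ltr_pM2l// subr_gt0//.
Qed.

(** Passing from [b] to [b'] multiplies the weight by a factor that increases in u, so association
    applies again and the ratio increases with [b]. *)
Lemma gw_ratio_scale s l a b b' : 0 < s -> b <= b' ->
  gig_fin l a b -> gig_fin l a b' -> gig_fin (l + s) a b -> gig_fin (l + s) a b' ->
  gw (l + s) a b * gw l a b' <= gw (l + s) a b' * gw l a b.
Proof.
move=> s0 bb f1 f2 f3 f4.
pose r u := expR (- (2^-1 * ((b' - b) * expR (- u)))).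
have rw u : r u * gigw l a b u = gigw l a b' u.
  by rewrite /r /gigw -expRD; congr expR; ring.
have [|||||||||h1 h2] := @chebyshev_expR s (gigw l a b) r
  (gw l a b) (gw (l + s) a b) (gw l a b') (gw (l + s) a b') s0.
- exact: measurable_gigw.
- by rewrite /r; mfun.
- by move=> u; exact: gigw_gt0.
- by move=> u; exact: expR_ge0.
- move=> x y xy; rewrite ler_expR lerN2 ler_pM2l// ler_wpM2l ?subr_ge0//.
  by rewrite ler_expR lerN2.
- exact: gwE.
- by rewrite -gwE//; apply: eq_integral => u _; rewrite gigw_shift.
- by rewrite -gwE//; apply: eq_integral => u _; rewrite rw.
- by rewrite -gwE//; apply: eq_integral => u _; rewrite -mulrA rw gigw_shift.
by [].
Qed.

(** With t = e e^(-u) / 2 this is 1 <= e^(-t) + t^d: for t <= 1 because t <= t^d, for t > 1 because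
    t^d >= 1. *)
Lemma gigw_le_sum d l e u : 0 < d <= 1 -> 0 <= e ->
  gigw l 1 0 u <= gigw l 1 e u + (2^-1 * e) `^ d * gigw (l - d) 1 0 u.
Proof.
move=> /andP[d0 d1] e0; pose t := 2^-1 * e * expR (- u).
have t0 : 0 <= t by rewrite !mulr_ge0// ?invr_ge0// expR_ge0.
have td : t `^ d = (2^-1 * e) `^ d * expR (- d * u).
  by rewrite powRM ?mulr_ge0 ?invr_ge0 ?expR_ge0// -expRM; congr (_ * expR _); ring.
have -> : gigw l 1 e u = expR (- t) * gigw l 1 0 u.
  by rewrite /gigw /t -expRD; congr expR; ring.
rewrite -gigw_shift mulrA -td -mulrDl ler_peMl ?expR_ge0//.
have [t1|t1] := leP t 1.
  have := expR_ge1Dx (- t).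
  suff : t <= t `^ d by lra.
  have [->|tn0] := eqVneq t 0; first exact: powR_ge0.
  by rewrite ger1_powR// lt0r tn0 t0.
have : 0 <= expR (- t) := expR_ge0 _.
suff : 1 <= t `^ d by lra.
by rewrite -(powRr0 t) ler_powR// ltW.
Qed.

Lemma gw_small d l e : 0 < d <= 1 -> d < l -> 0 <= e ->
  gw l 1 0 <= gw l 1 e + (2^-1 * e) `^ d * gw (l - d) 1 0.
Proof.
move=> /andP[d0 d1] dl e0; have l0 := lt_trans d0 dl.
have f1 : gig_fin l 1 0 by split; rewrite ?ltr01 ?l0 ?orbT.
have f2 : gig_fin l 1 e by split; rewrite ?ltr01 ?l0 ?orbT.
have f3 : gig_fin (l - d) 1 0 by split; rewrite ?ltr01 ?subr_gt0 ?dl ?orbT.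
have g0 l' a b u : 0 <= gigw l' a b u by exact/ltW/gigw_gt0.
have c0 : 0 <= (2^-1 * e) `^ d := powR_ge0 _ _.
have mg l' a b := measurable_gigw l' a b.
have e1 := (@ge0_integral_lin _ (measurableTypeR R) R mu _ _ _ _ _ _) ler01 c0 (mg l 1 e) (mg (l - d) 1 0) (g0 _ _ _) (g0 _ _ _)
  (integral_gigw f2) (integral_gigw f3).
rewrite -(mul1r (gw l 1 e)); apply: (@ge0_le_integral_val _ (measurableTypeR R) R mu) e1; last exact: (integral_gigw f1).
- exact: mg.
- by mfun; exact: mg.
- exact: g0.
- by move=> u; rewrite mul1r; apply: gigw_le_sum => //; rewrite d0.
Qed.

(** Scaling by 1/b removes [b] when a = 0, so inverse-gamma moments are exact powers of [b]. *)
Lemma gw_a0 l b s : 0 < b -> l + s < 0 -> l < 0 ->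
  gw (l + s) 0 b = b `^ s * gw (- l - s) 1 0 / gw (- l) 1 0 * gw l 0 b.
Proof.
move=> b0 ls l0; rewrite !(gw_reflect _ 0 b).
have bV : 0 < b^-1 by rewrite invr_gt0.
rewrite !(gw_scale _ b 0 bV) mul0r mulVf ?lt0r_neq0//.
have Gn0 : gw (- l) 1 0 != 0.
  by rewrite gt_eqF// gw_gt0//; split; rewrite ?ltr01 ?oppr_gt0 ?l0 ?orbT.
have -> : b^-1 `^ (- (l + s)) = b `^ s * b^-1 `^ (- l).
  rewrite opprD addrC powRD; last by rewrite (gt_eqF bV) implybT.
  by rewrite -powR_inv1 ?ltW// -powRrM mulN1r opprK.
have -> : - (l + s) = - l - s by rewrite opprD.
by field.
Qed.

Lemma gw_neg_moment_bounds m s : 0 < m -> 0 < s ->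
  exists d Gd : R, [/\ 0 < d, 0 < Gd,
    forall e, 0 <= e -> gw (m + s) 1 e <= gw (m + s) 1 0 &
    forall e, 0 <= e -> gw m 1 0 <= gw m 1 e + (2^-1 * e) `^ d * Gd].
Proof.
(* [gw_small] requires d <= 1, and d < m keeps the integral of index m - d finite at b = 0. *)
move=> m0 s0; pose d := Num.min 1 (m / 2).
have d0 : 0 < d by rewrite lt_min ltr01/= divr_gt0.
have dm : d < m by rewrite gt_min; apply/orP; right; lra.
have d1 : 0 < d <= 1 by rewrite d0/= ge_min lexx.
have fin_m (x : R) : 0 < x -> gig_fin x 1 0 by move=> x0; split; rewrite ?ltr01 ?x0 ?orbT.
exists d, (gw (m - d) 1 0); split=> //.
- by apply/gw_gt0/fin_m; rewrite subr_gt0.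
- move=> e e0.
  have fs : gig_fin (m + s) 1 e by split; rewrite ?ltr01 ?(addr_gt0 m0 s0) ?orbT.
  have fs' : gig_fin (m + s) 1 0 by apply: fin_m; rewrite addr_gt0.
  apply: (@ge0_le_integral_val _ (measurableTypeR R) R mu) (integral_gigw fs) (integral_gigw fs');
    try exact: measurable_gigw.
    by move=> u; exact/ltW/gigw_gt0.
  move=> u; rewrite /gigw ler_expR lerD2l lerN2 ler_pM2l ?invr_gt0// lerD2l mul0r.
  by rewrite mulr_ge0 ?expR_ge0.
- by move=> e e0; apply: gw_small.
Qed.

Lemma gw_neg_scale m s a b : 0 < b ->
  gw (- m - s) a b = b^-1 `^ m * b `^ (- s) * gw (m + s) 1 (a * b) /\
  gw (- m) a b = b^-1 `^ m * gw m 1 (a * b).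
Proof.
move=> bp; have bV : 0 < b^-1 by rewrite invr_gt0.
rewrite -opprD !(gw_reflect _ a b) !opprK !(gw_scale _ b a bV) mulVf ?lt0r_neq0// invrK.
split=> //; rewrite powRD; last by rewrite (gt_eqF bV) implybT.
by rewrite -(powR_inv1 (ltW bp)) -!powRrM !mulN1r.
Qed.

(** After scaling, the ratio of the two weights is b^(-s) gw (m + s) 1 (a b) / gw m 1 (a b), whose
    second factor is below [k] for small b. For b above the threshold [b0] the ratio is at most its
    value at [b0], by monotonicity in [b]; that value is [C]. *)
Lemma gw_neg_moment m a s k : 0 < m -> 0 < a -> 0 < s ->
  gw (m + s) 1 0 / gw m 1 0 < k ->
  exists2 C, 0 <= C & forall b, 0 < b ->
    gw (- m - s) a b <= (k * b `^ (- s) + C) * gw (- m) a b.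
Proof.
move=> m0 a0 s0.
have [d [Gd [d0 Gd0 H1 H2]]] := gw_neg_moment_bounds m0 s0.
have : 0 < gw m 1 0 by apply: gw_gt0; split; rewrite ?ltr01 ?m0 ?orbT.
have : 0 < gw (m + s) 1 0.
  by apply: gw_gt0; split; rewrite ?ltr01 ?(addr_gt0 m0 s0) ?orbT.
move: (gw m 1 0) (gw (m + s) 1 0) H1 H2 => G Gs H1 H2 Gs0 G0 hk.
have k0 : 0 < k by apply: le_lt_trans hk; rewrite divr_ge0 ?ltW.
have [y [y0 yE]] : exists y : R, 0 < y /\ y * Gd = G - Gs / k.
  exists ((G - Gs / k) / Gd); rewrite divfK ?lt0r_neq0//; split=> //.
  by rewrite divr_gt0// subr_gt0 ltr_pdivrMr// mulrC -ltr_pdivrMr.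
(* [b0] is the largest [b] for which the error term of [H2] stays within the slack G - Gs / k. *)
have [b0 [b00 yb0]] : exists b0 : R, 0 < b0 /\ (2^-1 * (a * b0)) `^ d = y.
  exists (2 / a * y `^ d^-1); split; first by rewrite mulr_gt0 ?divr_gt0 ?powR_gt0.
  have -> : 2^-1 * (a * (2 / a * y `^ d^-1)) = y `^ d^-1 by field; exact: lt0r_neq0.
  by rewrite -powRrM mulVf ?lt0r_neq0// powRr1// ltW.
have fin_ab (x b : R) : 0 < b -> gig_fin x a b by move=> bp; split; rewrite ?a0 ?bp// ltW.
have small b : 0 < b -> b <= b0 -> gw (- m - s) a b <= k * b `^ (- s) * gw (- m) a b.
  move=> bp bb0; have [-> ->] := gw_neg_scale m s a bp.
  have ab0 : 0 <= a * b by rewrite mulr_ge0// ltW.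
  have h1 := H1 _ ab0; have h2 := H2 _ ab0.
  have h3 : (2^-1 * (a * b)) `^ d <= y.
    rewrite -yb0 ge0_ler_powR ?nnegrE ?(ltW d0)//.
    - by rewrite mulr_ge0 ?invr_ge0.
    - by rewrite mulr_ge0 ?invr_ge0// mulr_ge0// ltW.
    - by rewrite !ler_pM2l ?invr_gt0.
  have h4 : (2^-1 * (a * b)) `^ d * Gd <= G - Gs / k by rewrite -yE ler_pM2r.
  have h5 : Gs <= k * gw m 1 (a * b).
    by rewrite mulrC -ler_pdivrMr//; lra.
  rewrite [leRHS](_ : _ = b^-1 `^ m * b `^ (- s) * (k * gw m 1 (a * b))); last by ring.
  rewrite ler_wpM2l ?mulr_ge0 ?powR_ge0//; exact: le_trans h1 h5.
have W0 (l b : R) : 0 < b -> 0 < gw l a b by move=> /(fin_ab l)/gw_gt0.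
have [C [C0 CE]] : exists C, 0 <= C /\ C * gw (- m) a b0 = gw (- m - s) a b0.
  exists (gw (- m - s) a b0 / gw (- m) a b0).
  by rewrite divfK ?lt0r_neq0 ?W0// divr_ge0// ltW// W0.
exists C => // b bp; rewrite mulrDl; have [bb0|bb0] := leP b b0.
  by rewrite (le_trans (small b bp bb0))// lerDl mulr_ge0// ltW// W0.
rewrite (@le_trans _ _ (C * gw (- m) a b))//; last first.
  by rewrite lerDr !mulr_ge0 ?powR_ge0 ?(ltW k0)// ltW// W0.
have := @gw_ratio_scale s (- m - s) a b0 b s0 (ltW bb0).
rewrite subrK => /(_ (fin_ab _ _ b00) (fin_ab _ _ bp) (fin_ab _ _ b00) (fin_ab _ _ bp)).
rewrite -CE => h; rewrite -(ler_pM2l (W0 (- m) b0 b00)).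
by rewrite (le_trans h)// le_eqVlt; apply/orP; left; apply/eqP; ring.
Qed.

(* The translation [u := u + ln th] multiplies the weight of index [l + 1] by
   [exp ((1 - th)(a x - b / (th x)) / 2) >= 1 + (1 - th)(a x - b / (th x)) / 2]. *)
Lemma gw_dilation l a b th : 0 < th < 1 -> 0 < a -> 0 <= b ->
  gig_fin l a b -> gig_fin (l + 1) a b -> gig_fin (l + 2) a b ->
  gw (l + 1) a b + 2^-1 * (1 - th) * a * gw (l + 2) a b <=
  th `^ (- (l + 1)) * gw (l + 1) a b + 2^-1 * (1 - th) * (b / th) * gw l a b.
Proof.
move=> /andP[th0 th1] a0 b0 f0 f1 f2.
have fth : gig_fin (l + 1) (th * a) (b / th).
  case: f1 => _ _ _ h; split.
  - by rewrite mulr_ge0// ltW.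
  - by rewrite divr_ge0// ltW.
  - by rewrite mulr_gt0.
  - by move/orP : h => [h|->]; rewrite ?orbT// divr_gt0.
have -> : th `^ (- (l + 1)) * gw (l + 1) a b = gw (l + 1) (th * a) (b / th).
  rewrite (gw_scale (l + 1) a b th0) mulrA -powRD ?addNr ?powRr0 ?mul1r//.
  by rewrite (gt_eqF th0) implybT.
have g0 l' a' b' u : 0 <= gigw l' a' b' u by exact/ltW/gigw_gt0.
have mg l' a' b' := measurable_gigw l' a' b'.
have t1 : 0 <= 2^-1 * (1 - th) * a by rewrite !mulr_ge0 ?invr_ge0 ?subr_ge0// ltW.
have t2 : 0 <= 2^-1 * (1 - th) * (b / th).
  by rewrite !mulr_ge0 ?invr_ge0 ?subr_ge0// ltW.
move: t1 t2; set k1 := _ * a; set k2 := _ * (b / th) => t1 t2.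
have e1 := (@ge0_integral_lin _ (measurableTypeR R) R mu _ _ _ _ _ _) ler01 t1 (mg (l + 1) a b) (mg (l + 2) a b) (g0 _ _ _) (g0 _ _ _)
  (integral_gigw f1) (integral_gigw f2).
have e2 := (@ge0_integral_lin _ (measurableTypeR R) R mu _ _ _ _ _ _) ler01 t2 (mg (l + 1) (th * a) (b / th)) (mg l a b)
  (g0 _ _ _) (g0 _ _ _) (integral_gigw fth) (integral_gigw f0).
rewrite -(mul1r (gw (l + 1) a b)) -(mul1r (gw (l + 1) (th * a) (b / th))).
apply: (@ge0_le_integral_val _ (measurableTypeR R) R mu) e1 e2; [by mfun; exact: mg|by mfun; exact: mg|by move=> u; rewrite addr_ge0// mulr_ge0|].
move=> u; rewrite !mul1r -(gigw_shift 2) -(gigw_shift 1 l) mul1r.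
pose z := 2^-1 * (1 - th) * (a * expR u - b / th * expR (- u)).
have -> : gigw (l + 1) (th * a) (b / th) u = expR z * (expR u * gigw l a b u).
  have -> : expR u * gigw l a b u = gigw (l + 1) a b u by rewrite -gigw_shift mul1r.
  rewrite /gigw /z -expRD; congr expR.
  by field; exact: lt0r_neq0.
have e1 : expR u * expR (- u) = 1 by rewrite -expRD subrr expR0.
have -> : expR (2 * u) = expR u * expR u by rewrite -expRD; congr expR; ring.
have := expR_ge1Dx z.
have w0 : 0 <= expR u * gigw l a b u by rewrite mulr_ge0 ?expR_ge0.
move=> /(ler_wpM2r w0) h.
rewrite -lerBlDr; apply: le_trans h.
rewrite /k1 /k2 [leRHS](_ : _ = expR u * gigw l a b u + 2^-1 * (1 - th) * a * (expR u * expR u * gigw l a b u)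
  - 2^-1 * (1 - th) * (b / th) * ((expR u * expR (- u)) * gigw l a b u)).
  by rewrite e1 mul1r.
by rewrite /z; ring.
Qed.

(** The dilation inequality is a difference quotient of the recurrence a W2 = b W0 + 2 (l + 1) W1
    and does not require differentiating. One factor 1 + e pays for th < 1, the other for absorbing
    W1 into W2. *)
Lemma gw_second_moment l a e : 0 < a -> 0 < e ->
  exists2 C, 0 <= C & forall b, 0 <= b -> gig_fin l a b ->
    gw (l + 2) a b <= ((1 + e) ^+ 2 * (b / a) + C) * gw l a b.
Proof.
move=> a0 e0; pose th := (1 + e)^-1.
have e1 : 0 < 1 + e by rewrite addr_gt0.
have th0 : 0 < th by rewrite invr_gt0.
have th1 : th < 1 by rewrite invf_lt1// ltrDl.
pose K := 2 * (th `^ (- (l + 1)) - 1) / (1 - th).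
(* Chosen so that in x <= n x^2 + 1 / (4 n) the multiple of W2 that bounds K W1 is a e / (1 + e),
   which leaves a / (1 + e) on the left. The [+ 1] keeps the denominator positive. *)
pose n := a * e / ((1 + e) * (`|K| + 1)).
have K1 : 0 < `|K| + 1 by rewrite ltr_wpDl.
have n0 : 0 < n by rewrite divr_gt0 ?mulr_gt0.
pose C := (1 + e) / a * ((`|K| + 1) / (4 * n)).
have C0 : 0 <= C by rewrite /C ltW// !(mulr_gt0, invr_gt0).
exists C => // b b0 f0.
have f1 : gig_fin (l + 1) a b.
  by case: f0 => ? ? _ /orP h; split; rewrite ?a0//; case: h => h;
    rewrite ?h// ?(addr_gt0 h ltr01) ?orbT.
have f2 : gig_fin (l + 2) a b.
  by case: f0 => ? ? _ /orP h; split; rewrite ?a0//; case: h => h;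
    rewrite ?h// ?(addr_gt0 h (ltr0n _ 2)) ?orbT.
have th01 : 0 < th < 1 by rewrite th0.
have := gw_dilation th01 a0 b0 f0 f1 f2.
set W0 := gw l a b; set W1 := gw (l + 1) a b; set W2 := gw (l + 2) a b => h.
have W00 : 0 < W0 by exact: gw_gt0.
have W10 : 0 < W1 by exact: gw_gt0.
have W20 : 0 < W2 by exact: gw_gt0.
have h1 : W1 <= n * W2 + (4 * n)^-1 * W0.
  have g0 l' a' b' u : 0 <= gigw l' a' b' u by exact/ltW/gigw_gt0.
  have mg l' a' b' := measurable_gigw l' a' b'.
  have n4 : 0 <= (4 * n)^-1 by rewrite invr_ge0 mulr_ge0// ltW.
  have e1' := (@ge0_integral_lin _ (measurableTypeR R) R mu _ _ _ _ _ _) (ltW n0) n4 (mg (l + 2) a b) (mg l a b) (g0 _ _ _) (g0 _ _ _)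
    (integral_gigw f2) (integral_gigw f0).
  apply: (@ge0_le_integral_val _ (measurableTypeR R) R mu) (integral_gigw f1) e1';
    [exact: mg|by mfun; exact: mg|exact: g0|].
  move=> u; rewrite -(gigw_shift 2) -(gigw_shift 1 l) mul1r mulrA -mulrDl.
  rewrite ler_wpM2r//.
  have -> : expR (2 * u) = expR u ^+ 2 by rewrite -expRM_natl.
  have : 0 <= n * (expR u - (2 * n)^-1) ^+ 2 by rewrite mulr_ge0 ?sqr_ge0// ltW.
  have -> : n * (expR u - (2 * n)^-1) ^+ 2 = n * expR u ^+ 2 - expR u + (4 * n)^-1.
    by field; exact: lt0r_neq0.
  lra.
have h2 : a * W2 <= b / th * W0 + K * W1.
  have {}h : 2^-1 * (1 - th) * (a * W2) <= 2^-1 * (1 - th) * (b / th * W0 + K * W1).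
    have -> : 2^-1 * (1 - th) * (b / th * W0 + K * W1) =
      2^-1 * (1 - th) * (b / th) * W0 + (th `^ (- (l + 1)) - 1) * W1.
      by rewrite /K; field; rewrite subr_eq0 gt_eqF//= gt_eqF.
    by lra.
  by rewrite -(ler_pM2l (_ : 0 < 2^-1 * (1 - th)))// mulr_gt0 ?invr_gt0// subr_gt0.
have h3 : K * W1 <= (`|K| + 1) * (n * W2 + (4 * n)^-1 * W0).
  apply: (@le_trans _ _ ((`|K| + 1) * W1)); last by rewrite ler_pM2l.
  by rewrite ler_pM2r//; have := ler_norm K; lra.
have n1 : (`|K| + 1) * n = a * e / (1 + e).
  by rewrite /n; field; rewrite !gt_eqF.
have thV : b / th = b * (1 + e) by rewrite /th invrK.
have h4 : a * W2 <= b * (1 + e) * W0 + (a * e / (1 + e) * W2 + (`|K| + 1) / (4 * n) * W0).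
  rewrite -thV; apply: (le_trans h2); rewrite lerD2l; apply: (le_trans h3).
  by rewrite mulrDr mulrA n1 mulrA.
have h5 : a / (1 + e) * W2 <= (b * (1 + e) + (`|K| + 1) / (4 * n)) * W0.
  have -> : a / (1 + e) * W2 = a * W2 - a * e / (1 + e) * W2.
    by field; exact: lt0r_neq0.
  by lra.
have -> : ((1 + e) ^+ 2 * (b / a) + C) * W0 =
    (1 + e) / a * ((b * (1 + e) + (`|K| + 1) / (4 * n)) * W0).
  by rewrite /C; field; rewrite !gt_eqF.
rewrite (_ : W2 = (1 + e) / a * (a / (1 + e) * W2)); last by field; rewrite !gt_eqF.
by rewrite ler_pM2l// divr_gt0.
Qed.

End moment_comparison.

(** A number u in (0, 1] satisfies u <= u^q; apply this to x / (x + y) and y / (x + y). *)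
Lemma powRD_le (R : realType) (x y q : R) : 0 <= x -> 0 <= y -> 0 < q <= 1 ->
  (x + y) `^ q <= x `^ q + y `^ q.
Proof.
move=> x0 y0 /andP[q0 q1].
have [->|x1] := eqVneq x 0; first by rewrite add0r lerDr powR_ge0.
have [->|y1] := eqVneq y 0; first by rewrite addr0 lerDl powR_ge0.
have {x1}x0 : 0 < x by rewrite lt0r x1.
have {y1}y0 : 0 < y by rewrite lt0r y1.
have z0 : 0 < x + y by rewrite addr_gt0.
have h (u : R) : 0 < u -> u <= x + y -> u / (x + y) * (x + y) `^ q <= u `^ q.
  move=> u0 uz; have -> : u `^ q = (u / (x + y)) `^ q * (x + y) `^ q.
    by rewrite -powRM ?divr_ge0 ?ltW// divfK// gt_eqF.
  rewrite ler_wpM2r ?powR_ge0// ger1_powR// divr_gt0//= ler_pdivrMr// mul1r//.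
have hx := h x x0; have hy := h y y0.
have xz : x <= x + y by rewrite lerDl ltW.
have yz : y <= x + y by rewrite lerDr ltW.
apply: le_trans (lerD (hx xz) (hy yz)).
by rewrite -mulrDl -mulrDl divff ?mul1r// gt_eqF.
Qed.

(** * Moments of Gaussian laws on the line *)

Section gauss_moments.
Context {R : realType}.
Implicit Types (m t s q x : R).
Local Notation mu := (@lebesgue_measure R).

Definition gauss_shape t m x := expR (- (t * (x - m) ^+ 2 / 2)).

Lemma measurable_gauss_shape t m : measurable_fun setT (gauss_shape t m : measurableTypeR R -> R).
Proof. by rewrite (_ : gauss_shape t m = fun x => expR (- (t * (x - m) ^+ 2 / 2)))//; mfun. Qed.

Lemma gauss_shape_ge0 t m x : 0 <= gauss_shape t m x. Proof. exact: expR_ge0. Qed.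

Lemma gig_fin_gauss (l t : R) : 0 < l -> 0 < t -> gig_fin l t 0.
Proof. by move=> l0 t0; split; rewrite ?t0 ?l0 ?orbT// ltW. Qed.

Lemma integral_shift (c : R) (f : measurableTypeR R -> R) : measurable_fun setT f ->
  (forall x, 0 <= f x) ->
  (\int[mu]_x (f (x + c)%R)%:E = \int[mu]_x (f x)%:E)%E.
Proof.
move=> mf f0; rewrite [RHS](@ge0_integral_affine _ c 1 (EFin \o f) (oner_neq0 R)).
- by rewrite normr1 mul1e; apply: eq_integral => x _ /=; rewrite mul1r addrC.
- exact/measurable_EFinP.
- by move=> x; rewrite lee_fin.
Qed.

Lemma integral_neg (f : measurableTypeR R -> R) : measurable_fun setT f ->
  (forall x, 0 <= f x) ->
  (\int[mu]_x (f (- x)%R)%:E = \int[mu]_x (f x)%:E)%E.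
Proof.
move=> mf f0.
have N1 : -1 != 0 :> R by rewrite oppr_eq0 oner_neq0.
rewrite [RHS](@ge0_integral_affine _ 0 (-1) (EFin \o f) N1).
- by rewrite normrN1 mul1e; apply: eq_integral => x _ /=; rewrite mulN1r add0r.
- exact/measurable_EFinP.
- by move=> x; rewrite lee_fin.
Qed.

Lemma integral_gauss_centered q t m : -1 < q -> 0 < t ->
  (\int[mu]_x (`|x - m| `^ q * gauss_shape t m x)%:E = (gw ((q + 1) / 2) t 0)%:E)%E.
Proof.
move=> q1 t0; rewrite -gwE; last by apply: gig_fin_gauss => //; rewrite divr_gt0//; lra.
rewrite -integral_normr_gauss.
rewrite -[RHS](@integral_shift (- m) (fun x => `|x| `^ q * expR (- (t * x ^+ 2 / 2))))//.
by mfun.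
Qed.

Lemma integral_gauss_shape t m : 0 < t ->
  (\int[mu]_x (gauss_shape t m x)%:E = (gw 2^-1 t 0)%:E)%E.
Proof.
move=> t0; have -> : 2^-1 = (0 + 1) / 2 :> R by rewrite add0r mul1r.
rewrite -(@integral_gauss_centered 0 t m)//.
by apply: eq_integral => x _; rewrite powRr0 mul1r.
Qed.

Lemma gw_half t : 0 < t -> gw 2^-1 t 0 = Num.sqrt (2 * pi / t).
Proof. by move=> t0; rewrite gw_def gigW_half. Qed.

Lemma gw_b0 (l t : R) : 0 < t -> gw l t 0 = t `^ (- l) * gw l 1 0.
Proof.
move=> t0; have tV : 0 < t^-1 by rewrite invr_gt0.
by rewrite (gw_scale l t 0 tV) mul0r mulVf ?gt_eqF// -(powR_inv1 (ltW t0)) -powRrM mulN1r.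
Qed.

Lemma gw_b0_ratio (l q t : R) : 0 < t -> 0 < l ->
  gw (l + q) t 0 = t `^ (- q) * (gw (l + q) 1 0 / gw l 1 0) * gw l t 0.
Proof.
move=> t0 l0; have G0 : 0 < gw l 1 0 by apply/gw_gt0/gig_fin_gauss.
rewrite !(gw_b0 _ t0) opprD powRD; last by rewrite (gt_eqF t0) implybT.
by field; rewrite gt_eqF.
Qed.

(** Bounding x^2 by (1 + e) m^2 + (1 + 1/e) (x - m)^2 avoids the signed cross term. Only the
    coefficient of m^2 enters [lam], and it is as close to 1 as desired; the variance term is of
    lower order in V. *)
Lemma gauss_second_moment t m e : 0 < t -> 0 < e ->
  (\int[mu]_x (x ^+ 2 * gauss_shape t m x)%:E <=
   (((1 + e) * m ^+ 2 + (1 + e^-1) * (gw (2^-1 + 1) 1 0 / gw 2^-1 1 0) / t) * gw 2^-1 t 0)%:E)%E.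
Proof.
move=> t0 e0.
have e1 := integral_gauss_shape m t0.
have e2 : (\int[mu]_x ((x - m) ^+ 2 * gauss_shape t m x)%:E = (gw (2^-1 + 1) t 0)%:E)%E.
  have -> : 2^-1 + 1 = (2 + 1) / 2 :> R by field.
  rewrite -(@integral_gauss_centered 2 t m)//; last by lra.
  apply: eq_integral => x _; congr (_ * _)%:E.
  by rewrite -real_normK ?num_real// powR_mulrn.
have k1 : 0 <= (1 + e) * m ^+ 2 by rewrite mulr_ge0 ?sqr_ge0// ltW// addr_gt0.
have k2 : 0 <= 1 + e^-1 by rewrite ltW// addr_gt0// invr_gt0.
have mg := measurable_gauss_shape t m.
have mg2 : measurable_fun setT (fun x : measurableTypeR R => (x - m) ^+ 2 * gauss_shape t m x).
  by mfun.
have g0 := gauss_shape_ge0 t m.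
have g2 x : 0 <= (x - m) ^+ 2 * gauss_shape t m x by rewrite mulr_ge0 ?sqr_ge0.
have e3 := @ge0_integral_lin _ (measurableTypeR R) R mu _ _ _ _ _ _ k1 k2 mg mg2 g0 g2 e1 e2.
rewrite (_ : _ * gw 2^-1 t 0 = (1 + e) * m ^+ 2 * gw 2^-1 t 0 + (1 + e^-1) * gw (2^-1 + 1) t 0).
  rewrite -e3; apply: ge0_le_integral_EFin; [by mfun|by mfun| |].
    by move=> x; rewrite mulr_ge0 ?sqr_ge0.
  move=> x; rewrite mulrA -mulrDl ler_wpM2r//.
  have : 0 <= e^-1 * (x - (1 + e) * m) ^+ 2 by rewrite mulr_ge0 ?sqr_ge0// invr_ge0 ltW.
  have -> : e^-1 * (x - (1 + e) * m) ^+ 2 =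
    (1 + e) * m ^+ 2 + (1 + e^-1) * (x - m) ^+ 2 - x ^+ 2 by field; rewrite gt_eqF.
  lra.
rewrite (gw_b0_ratio 1 t0) ?invr_gt0//.
rewrite (powRN t 1) powRr1 ?ltW//.
by ring.
Qed.

Lemma gauss_pos_moment t m s : 0 < t -> 0 < s <= 2^-1 ->
  (\int[mu]_x (`|x| `^ (2 * s) * gauss_shape t m x)%:E <=
   ((`|m| `^ (2 * s) + t `^ (- s) * (gw (2^-1 + s) 1 0 / gw 2^-1 1 0)) * gw 2^-1 t 0)%:E)%E.
Proof.
move=> t0 /andP[s0 s1].
have e1 := integral_gauss_shape m t0.
have e2 : (\int[mu]_x (`|x - m| `^ (2 * s) * gauss_shape t m x)%:E = (gw (2^-1 + s) t 0)%:E)%E.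
  have -> : 2^-1 + s = (2 * s + 1) / 2 :> R by field.
  by rewrite -(@integral_gauss_centered (2 * s) t m)//; lra.
have k1 : 0 <= `|m| `^ (2 * s) by exact: powR_ge0.
have mg := measurable_gauss_shape t m.
have mg2 : measurable_fun setT (fun x : measurableTypeR R => `|x - m| `^ (2 * s) * gauss_shape t m x).
  by mfun.
have g0 := gauss_shape_ge0 t m.
have g2 x : 0 <= `|x - m| `^ (2 * s) * gauss_shape t m x by rewrite mulr_ge0 ?powR_ge0.
have e3 := @ge0_integral_lin _ (measurableTypeR R) R mu _ _ _ _ _ _ k1 ler01 mg mg2 g0 g2 e1 e2.
have h0 : 0 < 2^-1 :> R by rewrite invr_gt0.
rewrite (mulrDl (`|m| `^ (2 * s))) -(gw_b0_ratio s t0 h0) -[X in _ + X]mul1r -e3.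
apply: ge0_le_integral_EFin; [by mfun|by mfun| |].
  by move=> x; rewrite mulr_ge0 ?powR_ge0.
move=> x; rewrite mul1r -mulrDl ler_wpM2r//.
rewrite -{1}(subrKC m x); apply: (@le_trans _ _ ((`|m| + `|x - m|) `^ (2 * s))).
  by rewrite ge0_ler_powR ?nnegrE ?addr_ge0 ?ler_normD//; lra.
by apply: powRD_le => //; lra.
Qed.

(* Both [|x|^(-2s)] and the Gaussian decrease in [|x|], so
   [(f x - f (x - m)) (g x - g (x - m)) >= 0]; integrate. *)
Lemma gauss_neg_moment t m s : 0 < t -> 0 < s < 2^-1 ->
  (\int[mu]_x (`|x| `^ (- (2 * s)) * gauss_shape t m x)%:E <=
   (t `^ s * (gw (2^-1 - s) 1 0 / gw 2^-1 1 0) * gw 2^-1 t 0)%:E)%E.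
Proof.
move=> t0 /andP[s0 s1].
pose f x := `|x| `^ (- (2 * s)).
have mf : measurable_fun setT (f : measurableTypeR R -> R).
  by rewrite (_ : f = fun x => `|x| `^ (- (2 * s)))//; mfun.
have f0 x : 0 <= f x by exact: powR_ge0.
have mg c : measurable_fun setT (gauss_shape t c : measurableTypeR R -> R).
  exact: measurable_gauss_shape.
have g0 := gauss_shape_ge0 t.
have mfm : measurable_fun setT (fun x : measurableTypeR R => f (x - m)).
  by rewrite (_ : (fun x => f (x - m)) = fun x => `|x - m| `^ (- (2 * s)))//; mfun.
have key : (\int[mu]_x (f x * gauss_shape t m x + f (x - m) * gauss_shape t 0 x)%:E <=
            \int[mu]_x (f x * gauss_shape t 0 x + f (x - m) * gauss_shape t m x)%:E)%E.
  apply: ae_ge0_le_integral => //.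
  - by move=> x _; rewrite lee_fin addr_ge0// mulr_ge0.
  - by apply/measurable_EFinP; apply: measurable_funD; exact: measurable_funM.
  - by move=> x _; rewrite lee_fin addr_ge0// mulr_ge0.
  - by apply/measurable_EFinP; apply: measurable_funD; exact: measurable_funM.
  (* A negative power of 0 is 0 by convention, so |x|^(-2s) is not decreasing at x = 0, nor its
     translate at x = m. The comparison holds off these two points. *)
  exists ([set 0] `|` [set m]); split.
  - exact: measurableU.
  - by apply: null_set_setU => //; exact: lebesgue_measure_set1.
  move=> x /= H; apply: contrapT => /not_orP[x0 xm]; apply: H => _; rewrite lee_fin.
  rewrite -subr_ge0 (_ : _ - _ = (f x - f (x - m)) * (gauss_shape t 0 x - gauss_shape t m x)); last by ring.
  have fle (y z : R) : 0 < `|y| -> `|y| <= `|z| -> f z <= f y.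
    move=> y0 yz; rewrite /f !powRN lef_pV2 ?posrE ?powR_gt0//; last exact: lt_le_trans yz.
    by rewrite ge0_ler_powR ?nnegrE//; lra.
  have gle (y z : R) : `|y| <= `|z| -> expR (- (t * z ^+ 2 / 2)) <= expR (- (t * y ^+ 2 / 2)).
    move=> yz; rewrite ler_expR lerN2 ler_pM2r ?invr_gt0// ler_pM2l//.
    by rewrite -(real_normK (num_real y)) -(real_normK (num_real z)) lerXn2r ?nnegrE.
  rewrite /gauss_shape subr0; have [h|/ltW h] := leP `|x| `|x - m|.
    by rewrite mulr_ge0// subr_ge0 ?gle// fle// normr_gt0; exact/eqP.
  by rewrite mulr_le0// subr_le0 ?gle// fle// normr_gt0 subr_eq0; exact/eqP.
have A : (\int[mu]_x (f x * gauss_shape t 0 x)%:E =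
    (t `^ s * (gw (2^-1 - s) 1 0 / gw 2^-1 1 0) * gw 2^-1 t 0)%:E)%E.
  have h0 : 0 < 2^-1 :> R by rewrite invr_gt0.
  have := gw_b0_ratio (- s) t0 h0; rewrite opprK => <-.
  have s2 : -1 < - (2 * s) by lra.
  have := integral_gauss_centered 0 s2 t0.
  have -> : (- (2 * s) + 1) / 2 = 2^-1 - s :> R by field.
  by move=> <-; apply: eq_integral => x _; rewrite subr0.
have Am : (\int[mu]_x (f (x - m) * gauss_shape t m x)%:E =
           \int[mu]_x (f x * gauss_shape t 0 x)%:E)%E.
  rewrite -[RHS](@integral_shift (- m) (fun x => f x * gauss_shape t 0 x)).
  - by apply: eq_integral => x _; rewrite /gauss_shape subr0.
  - exact: measurable_funM.
  - by move=> x; rewrite mulr_ge0.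
(* Translation by m followed by x -> -x turns this cross term into the integral to be bounded, so
   [key] says that twice that integral is at most twice the centred one. *)
have B : (\int[mu]_x (f (x - m) * gauss_shape t 0 x)%:E =
          \int[mu]_x (f x * gauss_shape t m x)%:E)%E.
  have mh : measurable_fun setT (fun x : measurableTypeR R => f x * gauss_shape t m x).
    exact: measurable_funM.
  rewrite -[RHS](integral_shift m mh); last by move=> x; rewrite mulr_ge0.
  rewrite -[LHS]integral_neg; last 2 first.
  - exact: measurable_funM.
  - by move=> x; rewrite mulr_ge0.
  apply: eq_integral => x _; congr (_ * _)%:E.
    by rewrite /f -opprD normrN.
  by rewrite /gauss_shape addrK subr0 sqrrN.
have gm c : measurable_fun setT (fun x : measurableTypeR R => f x * gauss_shape t c x).
  exact: measurable_funM.
have gm' c : measurable_fun setT (fun x : measurableTypeR R => f (x - m) * gauss_shape t c x).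
  exact: measurable_funM.
have gp c x : 0 <= f x * gauss_shape t c x by rewrite mulr_ge0.
have gp' c x : 0 <= f (x - m) * gauss_shape t c x by rewrite mulr_ge0.
move: key; rewrite (ge0_integralD_EFin _ (gm _) (gm' _) (gp _) (gp' _)).
rewrite (ge0_integralD_EFin _ (gm _) (gm' _) (gp _) (gp' _)) Am B A.
have := @integral_ge0 _ _ _ mu setT (fun x => (f x * gauss_shape t m x)%:E)
  (fun x _ => gp m x).
case: (\int[mu]_x (f x * gauss_shape t m x)%:E)%E => [x| |]//.
by rewrite -!EFinD !lee_fin => _; lra.
Qed.

End gauss_moments.

(** * Harris' theorem *)

Lemma integral_probability_cst d (T : measurableType d) (R : realType)
    (nu : probability T R) (c : \bar R) : (\int[nu]_x c = c)%E.
Proof.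
have := integral_cst nu measurableT c.
rewrite [X in (_ = _ * X)%E -> _](_ : _ = 1%E) ?mule1//; exact: probability_setT.
Qed.

Section harris.
Local Open Scope charge_scope.
Context d (T : measurableType d) (R : realType).
Local Open Scope ereal_scope.
Implicit Types (f g : T -> \bar R) (x y : T).

(* A Markov operator on nonnegative functions whose kernel is carried by [D];
   its values outside [D] are irrelevant. *)
Record markov_on (D : set T) (P : (T -> \bar R) -> T -> \bar R) : Prop := MarkovOn {
  markov_meas : forall f, measurable_fun setT f -> (forall x, 0 <= f x) ->
    measurable_fun setT (P f) ;
  markov_ge0 : forall f x, (forall x, 0 <= f x) -> 0 <= P f x ;
  markovD : forall f g x, measurable_fun setT f -> measurable_fun setT g ->
    (forall x, 0 <= f x) -> (forall x, 0 <= g x) -> D x ->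
    P (fun y => f y + g y) x = P f x + P g x ;
  markovZ : forall (k : R) f x, (0 <= k)%R -> measurable_fun setT f ->
    (forall x, 0 <= f x) -> D x -> P (fun y => k%:E * f y) x = k%:E * P f x ;
  markov_le : forall f g x, measurable_fun setT f -> measurable_fun setT g ->
    (forall x, 0 <= f x) -> (forall x, 0 <= g x) -> (forall y, D y -> f y <= g y) ->
    D x -> P f x <= P g x ;
  markov1 : forall x, D x -> P (fun=> 1) x = 1 }.

Variables (D : set T) (P : (T -> \bar R) -> T -> \bar R).
Hypothesis mP : markov_on D P.

Lemma markov_lin (a b : R) f x : (0 <= a)%R -> (0 <= b)%R -> measurable_fun setT f ->
  (forall x, 0 <= f x) -> D x -> P (fun y => a%:E + b%:E * f y) x = a%:E + b%:E * P f x.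
Proof.
move=> a0 b0 mf f0 Dx.
rewrite (markovD mP) ?(markovZ mP)//.
- congr (_ + _); rewrite -[in RHS](mule1 a%:E) -(markov1 mP Dx) -(markovZ mP)//.
  by congr (P _ x); apply/funext => y; rewrite mule1.
- exact: measurable_funeM.
- by move=> y; rewrite mule_ge0.
Qed.

Section contraction.
Variables (W : T -> R) (l K : R).
Hypotheses (mW : measurable_fun setT W) (W0 : forall x, (0 <= W x)%R).
Hypotheses (l0 : (0 <= l)%R) (K0 : (0 <= K)%R).
Hypothesis drift : forall x, D x -> P (EFin \o W) x <= (l * W x + K)%:E.

(** A Lipschitz bound [th] for the distance 2 + b (W x + W y) between distinct points, written
    additively since [f] has extended real values. *)
Definition osc_le (b th : R) (f : T -> \bar R) := forall x y, D x -> D y ->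
  f x <= f y + (th * (2 + b * (W x + W y)))%:E.

(** The distance splits as (1 + b W x) + (1 + b W y). Hence the infimum over y of f y + th (1 + b W
    y) is a constant that differs from f x by at most th (1 + b W x): a Lipschitz bound becomes a
    weighted supremum bound. *)
Lemma osc_center (b th : R) f : (0 <= b)%R -> (0 <= th)%R ->
  (forall x, 0 <= f x) -> (forall x, D x -> f x <= 1) -> osc_le b th f -> D !=set0 ->
  exists2 c : R, (0 <= c)%R & forall x, D x ->
    f x <= c%:E + (th * (1 + b * W x))%:E /\ c%:E <= f x + (th * (1 + b * W x))%:E.
Proof.
move=> b0 th0 f0 f1 osf [x0 Dx0].
have fE x : D x -> f x = (fine (f x))%:E.
  move=> Dx; rewrite fineK// fin_numElt (lt_le_trans _ (f0 x)) ?ltNyr//=.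
  by rewrite (le_lt_trans (f1 x Dx)) ?ltry.
pose S := [set (fine (f x) + th * (1 + b * W x))%R | x in D].
have g0 x : (0 <= th * (1 + b * W x))%R by rewrite mulr_ge0// addr_ge0// mulr_ge0.
have S0 : S !=set0 by exists (fine (f x0) + th * (1 + b * W x0))%R, x0.
have lbS : lbound S 0%R.
  by move=> _ [x Dx <-]; rewrite addr_ge0// fine_ge0.
have hS : has_inf S by split => //; exists 0%R.
exists (inf S); first by apply: lb_le_inf.
move=> x Dx; split; last first.
  rewrite fE// -EFinD lee_fin; apply: ge_inf; first by exists 0%R.
  by exists x.
rewrite fE// -EFinD lee_fin -lerBlDr; apply: lb_le_inf => // _ [y Dy <-].
have := osf x y Dx Dy; rewrite (fE x)// (fE y)// -EFinD lee_fin.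
rewrite (_ : th * (2 + b * (W x + W y)) = th * (1 + b * W x) + th * (1 + b * W y))%R; last by ring.
by lra.
Qed.

(* For [al = 0] this is the bound given by the drift condition alone; the
   minorization by [N] improves the constant [2] to [2 - 2 al]. *)
Lemma harris_step (b th al : R) (N : (T -> \bar R) -> \bar R) f x y :
  (0 <= b)%R -> (0 <= th)%R -> (0 <= al)%R ->
  measurable_fun setT f -> (forall x, 0 <= f x) -> (forall x, D x -> f x <= 1) ->
  osc_le b th f -> D x -> D y ->
  (forall g1 g2 (c : R), measurable_fun setT g1 -> measurable_fun setT g2 ->
    (forall z, 0 <= g1 z) -> (forall z, 0 <= g2 z) -> (0 <= c)%R ->
    (forall z, D z -> c%:E <= g1 z + g2 z) -> 0 <= N g1 /\ 0 <= N g2 /\ c%:E <= N g1 + N g2) ->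
  (forall g, measurable_fun setT g -> (forall z, 0 <= g z) ->
    al%:E * N g <= P g x /\ al%:E * N g <= P g y) ->
  P f x <= P f y + (th * (2 - 2 * al + b * (l * (W x + W y) + 2 * K)))%:E.
Proof.
move=> b0 th0 al0 mf f0 f1 osf Dx Dy NS Nle.
have [c c0 hc] : exists2 c : R, (0 <= c)%R & forall x, D x ->
    f x <= c%:E + (th * (1 + b * W x))%:E /\ c%:E <= f x + (th * (1 + b * W x))%:E.
  by apply: osc_center => //; exists x.
pose g z := (th * (1 + b * W z))%:E.
have g0 z : 0 <= g z by rewrite lee_fin mulr_ge0// addr_ge0// mulr_ge0.
have mg : measurable_fun setT g.
  by apply/measurable_EFinP; apply: measurable_funM => //; apply: measurable_funD => //;
     apply: measurable_funM.
have mc : measurable_fun setT (fun=> c%:E : \bar R) by [].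
have mWe : measurable_fun setT (EFin \o W) by exact/measurable_EFinP.
have Pc z : D z -> P (fun=> c%:E) z = c%:E.
  move=> Dz; rewrite -[RHS]mule1 -(markov1 mP Dz) -(markovZ mP)//.
  by congr (P _ z); apply/funext => w; rewrite mule1.
have Pg z : D z -> P g z <= (th + th * b * (l * W z + K))%:E.
  move=> Dz; rewrite (_ : g = fun w => th%:E + (th * b)%:E * (EFin \o W) w); last first.
    by apply/funext => w; rewrite /g /= -EFinM -EFinD; congr EFin; ring.
  rewrite markov_lin ?mulr_ge0// EFinD (EFinM (th * b)%R).
  by rewrite leeD2l// lee_wpmul2l ?lee_fin ?mulr_ge0// drift.
(* [g1] and [g2] are the slacks in the two bounds [hc]; on [D] they are nonnegative and add up to 2
   g >= 2 th, so the minorization yields 2 al th from P g1 x + P g2 y. Truncation at 0 gives them a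
   sign off [D] too. *)
pose g1 z := maxe 0 (c%:E + g z - f z).
pose g2 z := maxe 0 (f z + g z - c%:E).
have mg1 : measurable_fun setT g1.
  apply: measurable_maxe => //; apply: emeasurable_funB => //.
  exact: emeasurable_funD.
have mg2 : measurable_fun setT g2.
  apply: measurable_maxe => //; apply: emeasurable_funB => //.
  exact: emeasurable_funD.
have g10 z : 0 <= g1 z by rewrite /g1 le_max lexx.
have g20 z : 0 <= g2 z by rewrite /g2 le_max lexx.
have fE z : D z -> f z = (fine (f z))%:E.
  move=> Dz; rewrite fineK// fin_numElt (lt_le_trans _ (f0 z)) ?ltNyr//=.
  by rewrite (le_lt_trans (f1 z Dz)) ?ltry.
have fg1 z : D z -> f z + g1 z = c%:E + g z.
  move=> Dz; have [h _] := hc z Dz.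
  rewrite /g1; move: h; rewrite (fE z Dz) /g -!EFinD lee_fin => h.
  rewrite (_ : maxe 0 _ = (c + th * (1 + b * W z) - fine (f z))%:E); last first.
    by apply/max_idPr; rewrite lee_fin subr_ge0.
  by rewrite -EFinD; congr EFin; ring.
have fg2 z : D z -> c%:E + g2 z = f z + g z.
  move=> Dz; have [_ h] := hc z Dz.
  rewrite /g2; move: h; rewrite (fE z Dz) /g -!EFinD lee_fin => h.
  rewrite (_ : maxe 0 _ = (fine (f z) + th * (1 + b * W z) - c)%:E); last first.
    by apply/max_idPr; rewrite lee_fin subr_ge0.
  by rewrite -EFinD; congr EFin; ring.
have th2 : (0 <= 2 * th)%R by rewrite mulr_ge0.
have g12 z : D z -> (2 * th)%:E <= g1 z + g2 z.
  move=> Dz; have := fg1 z Dz; have := fg2 z Dz.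
  rewrite /g (fE z Dz); case: (g1 z) (g10 z) => [r1| |]//; case: (g2 z) (g20 z) => [r2| |]// _ _.
    rewrite -!EFinD => -[h2] [h1]; rewrite lee_fin.
    have : (0 <= th * (b * W z))%R by rewrite !mulr_ge0.
    by lra.
have [N1 [N2 N12]] := NS g1 g2 _ mg1 mg2 g10 g20 th2 g12.
(* Adding [e1] and [e2] eliminates [c]. *)
have e1 : P f x + P g1 x <= c%:E + (th + th * b * (l * W x + K))%:E.
  rewrite -(markovD mP)//; apply: (@le_trans _ _ (P (fun z => c%:E + g z) x)).
    apply: (markov_le mP) => //.
    - exact: emeasurable_funD.
    - exact: emeasurable_funD.
    - by move=> z; rewrite adde_ge0.
    - by move=> z; rewrite adde_ge0.
    - by move=> z Dz; rewrite fg1.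
  by rewrite (markovD mP)// Pc// leeD2l// Pg.
have e2 : c%:E + P g2 y <= P f y + (th + th * b * (l * W y + K))%:E.
  rewrite -(Pc y)// -(markovD mP)//; apply: (@le_trans _ _ (P (fun z => f z + g z) y)).
    apply: (markov_le mP) => //.
    - exact: emeasurable_funD.
    - exact: emeasurable_funD.
    - by move=> z; rewrite adde_ge0.
    - by move=> z; rewrite adde_ge0.
    - by move=> z Dz; rewrite fg2.
  by rewrite (markovD mP)// leeD2l// Pg.
have [a1 _] := Nle g1 mg1 g10; have [_ a2] := Nle g2 mg2 g20.
have := markov_ge0 mP x f0; have := markov_ge0 mP y f0.
have := markov_ge0 mP x g10; have := markov_ge0 mP y g20.
have al2 : (al * (2 * th))%:E <= P g1 x + P g2 y.
  apply: (@le_trans _ _ (al%:E * (N g1 + N g2))).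
    by rewrite EFinM lee_wpmul2l.
  by rewrite ge0_muleDr// leeD.
move: al2 e1 e2; case: (P f x) => [r1| |]//; case: (P f y) => [r2| |]//;
case: (P g1 x) => [r3| |]//; case: (P g2 y) => [r4| |]//.
- rewrite -!EFinD !lee_fin => al2 e1 e2 _ _ _ _.
  apply: (@le_trans _ _ (r2 + (th + th * b * (l * W x + K)) + (th + th * b * (l * W y + K)) - al * (2 * th))%R).
    by lra.
  by rewrite le_eqVlt; apply/orP; left; apply/eqP; ring.
all: by move=> *; rewrite ?addye// leey.
Qed.

Hypothesis l1 : (l < 1)%R.
(** [N] stands for integration against the minorizing probability measure. The contraction draws on
    one trait of it: two functions whose sum is at least [c] on [D] have values whose sum is at
    least [c]. *)
Hypothesis small_set : forall r : R, exists al : R, (0 < al <= 1)%R /\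
  exists N : (T -> \bar R) -> \bar R,
  (forall g1 g2 (c : R), measurable_fun setT g1 -> measurable_fun setT g2 ->
    (forall z, 0 <= g1 z) -> (forall z, 0 <= g2 z) -> (0 <= c)%R ->
    (forall z, D z -> c%:E <= g1 z + g2 z) -> 0 <= N g1 /\ 0 <= N g2 /\ c%:E <= N g1 + N g2) /\
  (forall g x, measurable_fun setT g -> (forall z, 0 <= g z) -> D x -> (W x <= r)%R ->
    al%:E * N g <= P g x).

Lemma harris_contraction : exists b gam : R, [/\ (0 <= b)%R, (0 < gam < 1)%R &
  forall th f, (0 <= th)%R -> measurable_fun setT f -> (forall x, 0 <= f x) ->
    (forall x, D x -> f x <= 1) -> osc_le b th f -> osc_le b (gam * th) (P f)].
Proof.
pose K1 := (K + 1)%R; have K10 : (0 < K1)%R by rewrite ltr_wpDl.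
(* Beyond W x + W y = r, the drift constant 2 K is at most half of the gain (1 - l) (W x + W y),
   which leaves the rate [l2]. *)
pose r := (4 * K1 / (1 - l))%R.
have l10 : (0 < 1 - l)%R by rewrite subr_gt0.
have r0 : (0 < r)%R by rewrite divr_gt0// mulr_gt0.
have [al [/andP[al0 al1] [N [NS Nle]]]] := small_set r.
(* With this weight 2 b K <= al, so on the small set the drift constant costs at most half of the
   gain 2 al. *)
pose b := (al / (2 * K1))%R.
have b0 : (0 < b)%R by rewrite divr_gt0// mulr_gt0.
pose l2 := ((1 + l) / 2)%R.
have l20 : (0 < l2)%R by rewrite divr_gt0// ltr_wpDr.
have l21 : (l2 < 1)%R by rewrite ltr_pdivrMr// mul1r -[X in (_ < X)%R]/(1 + 1)%R ltrD2l.
(* The quotient (2 + b l2 S) / (2 + b S) decreases in S; this is its value at S = r and thus the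
   contraction factor for distant pairs. *)
pose g1 := ((2 + b * l2 * r) / (2 + b * r))%R.
have br : (0 < b * r)%R by rewrite mulr_gt0.
have bl2 : (0 < b * l2)%R by exact: mulr_gt0.
have g10 : (0 < g1)%R.
  by apply: divr_gt0; apply: addr_gt0 => //; exact: mulr_gt0.
have g11 : (g1 < 1)%R.
  rewrite ltr_pdivrMr ?mul1r ?addr_gt0// ltrD2l mulrAC.
  by rewrite gtr_pMr.
pose gam := Num.max g1 (Num.max (1 - al / 2)%R l2).
have gg1 : (g1 <= gam)%R by rewrite le_max lexx.
have gal : (1 - al / 2 <= gam)%R by rewrite !le_max lexx orbT.
have gl2 : (l2 <= gam)%R by rewrite !le_max lexx !orbT.
exists b, gam; split; first exact: ltW.
  rewrite !gt_max !lt_max g11 g10 l21/= andbT.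
  by rewrite ltrBlDr ltrDl divr_gt0.
move=> th f th0 mf f0 f1 osf x y Dx Dy.
have S0 : (0 <= W x + W y)%R by rewrite addr_ge0.
have KK1 : (K <= K1)%R by rewrite lerDl.
have [Sr|Sr] := leP r (W x + W y)%R.
  (* No minorization for distant pairs: al = 0, and the constant +oo meets the conditions on [N]
     because 0 times +oo is 0. *)
  apply: (le_trans (@harris_step b th 0 (fun=> +oo) f x y (ltW b0) th0 (lexx _) mf f0 f1 osf Dx Dy _ _)).
  - by move=> *; rewrite !leey.
  - by move=> g mg g0; rewrite mul0e; split; exact: (markov_ge0 mP).
  rewrite leeD2l// lee_fin -mulrA mulrCA ler_wpM2l// mulr0 subr0.
  have h1 : (2 * K1 <= (1 - l) / 2 * (W x + W y))%R.
    rewrite (_ : 2 * K1 = (1 - l) / 2 * r)%R; last by rewrite /r; field; rewrite gt_eqF.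
    by rewrite ler_wpM2l// divr_ge0// ltW.
  apply: (@le_trans _ _ (2 + b * (l2 * (W x + W y)))%R).
    by rewrite lerD2l ler_wpM2l ?(ltW b0)// /l2; lra.
  apply: (@le_trans _ _ (g1 * (2 + b * (W x + W y)))%R); last first.
    by rewrite ler_wpM2r// addr_ge0// mulr_ge0// ltW.
  rewrite /g1 [leRHS]mulrAC ler_pdivlMr ?addr_gt0// -subr_ge0.
  rewrite (_ : _ - _ = 2 * b * (1 - l2) * (W x + W y - r))%R; last by ring.
  have l210 : (0 <= 1 - l2)%R by rewrite subr_ge0 ltW.
  have b20 : (0 <= 2 * b)%R by rewrite mulr_ge0// ltW.
  by rewrite mulr_ge0 ?subr_ge0//; exact: mulr_ge0.
have Wr : (W x <= r)%R /\ (W y <= r)%R.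
  by split; rewrite ltW// (le_lt_trans _ Sr)// ?lerDl ?lerDr.
apply: (le_trans (@harris_step b th al N f x y (ltW b0) th0 (ltW al0) mf f0 f1 osf Dx Dy NS _)).
  by move=> g mg g0; split; apply: Nle => //; case: Wr.
rewrite leeD2l// lee_fin -mulrA mulrCA ler_wpM2l//.
have h1 : (2 * b * K <= al)%R.
  rewrite (_ : al = 2 * b * K1)%R; last by rewrite /b; field; rewrite gt_eqF.
  by rewrite ler_wpM2l// mulr_ge0// ltW.
have h2 : (l * (W x + W y) <= gam * (W x + W y))%R.
  by rewrite ler_wpM2r// (le_trans _ gl2)// /l2; lra.
have h3 : (b * (l * (W x + W y)) <= b * (gam * (W x + W y)))%R by rewrite ler_wpM2l// ltW.
have -> : (2 - 2 * al + b * (l * (W x + W y) + 2 * K) = 2 - 2 * al + 2 * b * K + b * (l * (W x + W y)))%R by ring.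
have -> : (gam * (2 + b * (W x + W y)) = 2 * gam + b * (gam * (W x + W y)))%R by ring.
apply: lerD => //; apply: (@le_trans _ _ (2 * (1 - al / 2))%R); last by rewrite ler_pM2l.
have -> : (2 * (1 - al / 2) = 2 - al)%R by field.
by lra.
Qed.

End contraction.

(** Jensen's inequality through the tangent line: sqrt z <= s / 2 + z / (2 s), taken at s = sqrt (l
    L x + K). *)
Lemma markov_sqrt_drift (L : T -> R) (l K : R) :
  measurable_fun setT L -> (forall x, 0 <= L x)%R -> (0 <= l)%R -> (0 < K)%R ->
  (forall x, D x -> P (EFin \o L) x <= (l * L x + K)%:E) ->
  forall x, D x -> P (EFin \o (fun z => Num.sqrt (L z))) x <=
    (Num.sqrt l * Num.sqrt (L x) + Num.sqrt K)%:E.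
Proof.
move=> mL L0 l0 K0 drift x Dx.
have t0 : (0 < l * L x + K)%R by rewrite ltr_wpDl// mulr_ge0.
pose s := Num.sqrt (l * L x + K).
have s0 : (0 < s)%R by rewrite sqrtr_gt0.
have ss : (s * s = l * L x + K)%R by rewrite -expr2 sqr_sqrtr// ltW.
have msL : measurable_fun setT (EFin \o (fun z => Num.sqrt (L z))).
  apply/measurable_EFinP; apply: (measurableT_comp _ mL).
  apply: continuous_measurable_fun => z; exact: sqrt_continuous.
have mLe : measurable_fun setT (EFin \o L) by exact/measurable_EFinP.
have h0 : (0 <= s / 2)%R by rewrite divr_ge0// ltW.
have h1 : (0 <= s^-1 / 2)%R by rewrite divr_ge0// invr_ge0 ltW.
apply: (@le_trans _ _ (P (fun z => (s / 2)%:E + (s^-1 / 2)%:E * (EFin \o L) z) x)).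
  apply: (markov_le mP) => //.
  - apply: emeasurable_funD => //; exact: measurable_funeM.
  - by move=> z; rewrite lee_fin sqrtr_ge0.
  - by move=> z; rewrite adde_ge0 ?mule_ge0// ?lee_fin.
  - move=> z _ /=; rewrite -EFinM -EFinD lee_fin.
    have e : (Num.sqrt (L z) ^+ 2 = L z)%R by rewrite sqr_sqrtr.
    have : (0 <= s^-1 / 2 * (Num.sqrt (L z) - s) ^+ 2)%R by rewrite mulr_ge0 ?sqr_ge0.
    rewrite (_ : s^-1 / 2 * (_ ^+ 2) = s / 2 + s^-1 / 2 * Num.sqrt (L z) ^+ 2 - Num.sqrt (L z))%R.
      by rewrite e subr_ge0.
    by field; rewrite gt_eqF.
rewrite markov_lin//.
apply: (@le_trans _ _ ((s / 2)%:E + (s^-1 / 2)%:E * (l * L x + K)%:E)).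
  by rewrite leeD2l// lee_wpmul2l ?lee_fin ?drift.
rewrite -EFinM -EFinD lee_fin -ss (_ : _ + _ = s)%R; last by field; rewrite gt_eqF.
have a0 : (0 <= Num.sqrt l * Num.sqrt (L x) + Num.sqrt K)%R.
  by rewrite addr_ge0 ?mulr_ge0 ?sqrtr_ge0.
rewrite -(ler_sqr (_ : s \is Num.nneg)) ?nnegrE ?(ltW s0)// expr2 ss.
have e1 : (Num.sqrt l ^+ 2 = l)%R by rewrite sqr_sqrtr.
have e2 : (Num.sqrt (L x) ^+ 2 = L x)%R by rewrite sqr_sqrtr.
have e3 : (Num.sqrt K ^+ 2 = K)%R by rewrite sqr_sqrtr// ltW.
rewrite sqrrD exprMn e1 e2 e3 lerD2r lerDl mulrn_wge0// !mulr_ge0 ?sqrtr_ge0.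
Qed.

Section invariant.
Variable post : probability T R.
Hypotheses (mD : measurable D) (postD : post (~` D) = 0).
Hypothesis stat : forall f, measurable_fun setT f -> (forall x, 0 <= f x) ->
  \int[post]_x P f x = \int[post]_x f x.

Lemma ae_leD (nu : probability T R) f g : nu (~` D) = 0 ->
  (forall x, D x -> f x <= g x) -> {ae nu, forall x, setT x -> f x <= g x}.
Proof.
move=> nuD fg; exists (~` D); split => //; first exact: measurableC.
by move=> x /= h Dx; apply: h => _; exact: fg.
Qed.

Lemma integral_le_bounded (nu : {measure set T -> \bar R}) (L : T -> R) (C : \bar R) :
  measurable_fun setT L -> (forall x, 0 <= L x)%R ->
  (forall n : nat, \int[nu]_(x in [set x | (L x <= n%:R)%R]) (L x)%:E <= C) ->
  \int[nu]_x (L x)%:E <= C.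
Proof.
move=> mL L0 LC; pose F (n : nat) := [set x | (L x <= n%:R)%R].
have mF n : measurable (F n).
  rewrite -[F n]setTI (_ : F n = L @^-1` `]-oo, n%:R]).
    by apply: mL => //.
  by apply/seteqP; split => x /=; rewrite in_itv/=.
have ndF : nondecreasing_seq F.
  move=> i j ij; apply/subsetPset => x; rewrite /F /= => /le_trans; apply.
  by rewrite ler_nat.
have UF : \bigcup_n F n = setT.
  rewrite -subTset => x _; exists (Num.truncn (L x)).+1 => //; rewrite /F /= ltW//.
  by rewrite truncnS_gt.
have := @ge0_nondecreasing_set_cvg_integral _ _ _ F (EFin \o L) nu ndF mF _ _.
rewrite UF => cv.
have {}cv : \int[nu]_(x in F i) (L x)%:E @[i --> \oo] --> \int[nu]_x (L x)%:E.
  apply: cv => [i|i x _]; last by rewrite lee_fin.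
  by apply/measurable_EFinP; exact: measurable_funTS.
rewrite -(cvg_lim _ cv)//; apply: lime_le; first by apply/cvg_ex; exists (\int[nu]_x (L x)%:E).
exact: nearW.
Qed.

(* Integrate [min (l L + K) N + (1 - l) L 1_{L <= N} <= min L N + K] and use
   that [min L N] has the same integral as [P (min L N) <= min (l L + K) N]. *)
Lemma stationary_moment (L : T -> R) (l K : R) :
  measurable_fun setT L -> (forall x, 0 <= L x)%R -> (0 <= l < 1)%R -> (0 <= K)%R ->
  (forall x, D x -> P (EFin \o L) x <= (l * L x + K)%:E) ->
  \int[post]_x (L x)%:E <= (K / (1 - l))%:E.
Proof.
move=> mL L0 /andP[l0 l1] K0 drift; apply: integral_le_bounded => // n.
set F := [set x | _]; pose N : R := n%:R.
have mF : measurable F.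
  rewrite -[F]setTI (_ : F = L @^-1` `]-oo, n%:R]).
    by apply: mL => //.
  by apply/seteqP; split => x /=; rewrite in_itv/=.
have l10 : (0 < 1 - l)%R by rewrite subr_gt0.
pose f x := Num.min (L x) N; pose g x := Num.min (l * L x + K)%R N.
have mf : measurable_fun setT f by exact: measurable_minr.
have mg : measurable_fun setT g.
  by apply: measurable_minr => //; apply: measurable_funD => //; exact: measurable_funM.
have f0 x : (0 <= f x)%R by rewrite le_min L0 ler0n.
have g0 x : (0 <= g x)%R by rewrite le_min ler0n addr_ge0// mulr_ge0.
have mfe : measurable_fun setT (EFin \o f) by exact/measurable_EFinP.
have mge : measurable_fun setT (EFin \o g) by exact/measurable_EFinP.
have mLe : measurable_fun setT (EFin \o L) by exact/measurable_EFinP.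
have fg : \int[post]_x (f x)%:E <= \int[post]_x (g x)%:E.
  rewrite -(stat mfe); last by move=> x; rewrite lee_fin.
  apply: ae_ge0_le_integral => //.
  - by move=> x _; apply: (markov_ge0 mP) => y; rewrite lee_fin.
  - by apply: (markov_meas mP) => // y; rewrite lee_fin.
  - by move=> x _; rewrite lee_fin.
  apply: ae_leD => // x Dx; rewrite /g EFin_min le_min; apply/andP; split.
    apply: le_trans (drift x Dx); apply: (markov_le mP) => //; try by move=> z; rewrite lee_fin.
    by move=> z _; rewrite lee_fin ge_min lexx.
  have -> : N%:E = P (fun=> N%:E * 1) x.
    by rewrite (markovZ mP)// ?ler0n// (markov1 mP)// mule1.
  apply: (markov_le mP) => //; try by move=> z; rewrite ?mule1 lee_fin ?ler0n.
  by move=> z _; rewrite mule1 lee_fin ge_min lexx orbT.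
have gfin : \int[post]_x (g x)%:E < +oo.
  apply: (@le_lt_trans _ _ (\int[post]_x (cst N%:E) x)).
    apply: ge0_le_integral => //; first by move=> x _; rewrite lee_fin.
    by move=> x _; rewrite lee_fin ge_min lexx orbT.
  by rewrite integral_probability_cst ltry.
pose h x := (L x * \1_F x)%R.
have mh : measurable_fun setT h by apply: measurable_funM => //; exact: measurable_indic.
have h0 x : (0 <= h x)%R by rewrite mulr_ge0.
have hF : \int[post]_(x in F) (L x)%:E = \int[post]_x (h x)%:E.
  rewrite integral_mkcond; apply: eq_integral => x _; rewrite patchE /h indicE.
  by case: ifPn => _; rewrite ?mulr1 ?mulr0.
have key : \int[post]_x (1 * g x + (1 - l) * h x)%:E <= \int[post]_x (f x + K)%:E.
  apply: ge0_le_integral_EFin.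
  - by apply: measurable_funD; exact: measurable_funM.
  - exact: measurable_funD.
  - by move=> x; rewrite addr_ge0// mulr_ge0// ltW.
  move=> x; rewrite mul1r /g /f /h indicE; have [xF|xF] := boolP (x \in F).
    rewrite inE in xF; have {}xF : (L x <= N)%R by [].
    rewrite (min_idPl xF) mulr1.
    apply: (@le_trans _ _ (l * L x + K + (1 - l) * L x)%R); last by lra.
    by rewrite lerD2r ge_min lexx.
  have {}xF : (N < L x)%R.
    by rewrite ltNge; apply/negP => h1; move/negP: xF; apply; rewrite inE.
  rewrite (min_idPr (ltW xF)) mulr0 mulr0 addr0.
  by rewrite (@le_trans _ _ N)// ?ge_min ?lexx ?orbT// lerDl.
have e1 : \int[post]_x (f x + K)%:E = \int[post]_x (f x)%:E + K%:E.
  rewrite (@ge0_integralD_EFin _ T R post f (fun=> K))//.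
  have -> : \int[post]_x K%:E = K%:E.
    by rewrite integral_probability_cst.
  by [].
have e2 : \int[post]_x (1 * g x + (1 - l) * h x)%:E =
    \int[post]_x (g x)%:E + (1 - l)%:E * \int[post]_x (h x)%:E.
  rewrite (@ge0_integralD_EFin _ T R post (fun x => 1 * g x)%R (fun x => (1 - l) * h x)%R).
  - by rewrite !ge0_integralZ_EFin ?(ltW l10)// mul1e.
  - exact: measurable_funM.
  - exact: measurable_funM.
  - by move=> x; rewrite mul1r.
  - by move=> x; rewrite mulr_ge0// ltW.
rewrite hF; move: key; rewrite e1 e2; move: fg gfin.
have := @integral_ge0 _ T R post setT (EFin \o f) (fun x _ => f0 x).
have := @integral_ge0 _ T R post setT (EFin \o g) (fun x _ => g0 x).
have := @integral_ge0 _ T R post setT (EFin \o h) (fun x _ => h0 x).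
rewrite /comp /=.
case: (\int[post]_x (f x)%:E) => [r1| |]//; case: (\int[post]_x (g x)%:E) => [r2| |]//;
case: (\int[post]_x (h x)%:E) => [r3| |]//.
- rewrite -EFinM -!EFinD !lee_fin => _ _ _ r12 _ hh.
  rewrite ler_pdivlMr// mulrC.
  by lra.
- by move=> _ _ _ _ _; rewrite gt0_muley ?lte_fin// addey// leye_eq.
Qed.

(** W f <= W^2 + f^2 for the density f. The estimate is made on the sublevel sets of W, where W is
    bounded and hence integrable, as the change of variables to [post] requires. *)
Lemma L2_density_moment (nu : probability T R) (W : T -> R) :
  measurable_fun setT W -> (forall x, 0 <= W x)%R -> nu `<< post ->
  \int[post]_x (W x ^+ 2)%:E < +oo ->
  ('N[post]_2%:E[ 'd (charge_of_finite_measure nu) '/d post ] < +oo)%E ->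
  \int[nu]_x (W x)%:E < +oo.
Proof.
move=> mW W0 nupost W2 f2; set f := Radon_Nikodym _ _ in f2.
have mf : measurable_fun setT f.
  by apply: measurable_int; exact: Radon_Nikodym_integrable.
have fE x : f x = (fine (f x))%:E.
  by rewrite fineK//; exact: Radon_Nikodym_fin_num.
pose r x := fine (f x).
have mr : measurable_fun setT r.
  by apply: measurableT_comp mf.
have r2 : \int[post]_x (r x ^+ 2)%:E < +oo.
  have := @poweR_Lnorm _ T R post f 2 (lt0r_neq0 (ltr0n _ 2)).
  rewrite (_ : \int[post]_x _ = \int[post]_x (r x ^+ 2)%:E) => [<-|]; last first.
    apply: eq_integral => x _; rewrite {1}fE abse_EFin poweR_EFin powR_mulrn//.
    by rewrite real_normK ?num_real.
  by rewrite poweR_lty.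
have mW2 : measurable_fun setT (fun x => W x ^+ 2)%R by exact: measurable_funX.
have mr2 : measurable_fun setT (fun x => r x ^+ 2)%R by exact: measurable_funX.
pose C := \int[post]_x (W x ^+ 2 + r x ^+ 2)%:E.
have Cfin : C < +oo.
  rewrite /C (@ge0_integralD_EFin _ T R post (fun x => W x ^+ 2)%R (fun x => r x ^+ 2)%R)//.
  - exact: lte_add_pinfty.
  - by move=> x; exact: sqr_ge0.
  - by move=> x; exact: sqr_ge0.
apply: le_lt_trans Cfin; apply: integral_le_bounded => // n.
set F := [set x | _].
have mF : measurable F.
  rewrite -[F]setTI (_ : F = W @^-1` `]-oo, n%:R]).
    by apply: mW => //.
  by apply/seteqP; split => x /=; rewrite in_itv/=.
have Wint : nu.-integrable F (EFin \o W).
  apply: measurable_bounded_integrable => //.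
  - by rewrite (le_lt_trans (probability_le1 nu mF))// ltry.
  - exact: measurable_funTS.
  - exists n%:R; split; first exact: num_real.
    move=> M nM x Fx /=; rewrite ger0_norm//; exact: le_trans Fx (ltW nM).
rewrite -(Radon_Nikodym_change_of_variables nupost mF Wint).
apply: (@le_trans _ _ `| \int[post]_(x in F) ((W x)%:E * f x) |).
  by rewrite lee_abs.
have mWf : measurable_fun F (fun x => (W x)%:E * f x).
  by apply: measurable_funTS; apply: emeasurable_funM => //; exact/measurable_EFinP.
apply: (le_trans (le_abse_integral post mF mWf)).
apply: (@le_trans _ _ (\int[post]_(x in F) (W x ^+ 2 + r x ^+ 2)%:E)).
  apply: ge0_le_integral => //.
  - exact: measurableT_comp.
  - apply/measurable_EFinP; apply: measurable_funTS; exact: measurable_funD.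
  - move=> x _; rewrite fE -EFinM /= lee_fin normrM -/(r x).
    rewrite -(real_normK (num_real (W x))) -(real_normK (num_real (r x))).
    have : (0 <= (`|W x| - `|r x|) ^+ 2)%R by exact: sqr_ge0.
    have : (0 <= `|W x| * `|r x|)%R by rewrite mulr_ge0.
    by rewrite sqrrB; lra.
apply: ge0_subset_integral => //.
- by apply/measurable_EFinP; exact: measurable_funD.
- by move=> x _; rewrite lee_fin addr_ge0// sqr_ge0.
Qed.

Lemma harris_L2 (L : T -> R) (l K : R) :
  measurable_fun setT L -> (forall x, 0 <= L x)%R -> (0 <= l < 1)%R -> (0 < K)%R ->
  (forall x, D x -> P (EFin \o L) x <= (l * L x + K)%:E) ->
  (forall r : R, exists al : R, (0 < al <= 1)%R /\
  exists N : (T -> \bar R) -> \bar R,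
  (forall g1 g2 (c : R), measurable_fun setT g1 -> measurable_fun setT g2 ->
    (forall z, 0 <= g1 z) -> (forall z, 0 <= g2 z) -> (0 <= c)%R ->
    (forall z, D z -> c%:E <= g1 z + g2 z) -> 0 <= N g1 /\ 0 <= N g2 /\ c%:E <= N g1 + N g2) /\
  (forall g x, measurable_fun setT g -> (forall z, 0 <= g z) -> D x -> (L x <= r)%R ->
    al%:E * N g <= P g x)) ->
  geometrically_ergodic P post.
Proof.
move=> mL L0 l01 K0 drift small; have /andP[l0 l1] := l01.
have piL := stationary_moment mL L0 l01 (ltW K0) drift.
pose W x := Num.sqrt (L x).
have W0 x : (0 <= W x)%R by exact: sqrtr_ge0.
have W2 x : (W x ^+ 2 = L x)%R by rewrite sqr_sqrtr.
have mW : measurable_fun setT W.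
  apply: (measurableT_comp _ mL).
  by apply: continuous_measurable_fun => z; exact: sqrt_continuous.
have mWe : measurable_fun setT (EFin \o W) by exact/measurable_EFinP.
have Wdrift := markov_sqrt_drift mL L0 l0 K0 drift.
have sl0 : (0 <= Num.sqrt l)%R by exact: sqrtr_ge0.
have sl1 : (Num.sqrt l < 1)%R by rewrite -sqrtr1 ltr_sqrt.
have sK0 : (0 <= Num.sqrt K)%R by exact: sqrtr_ge0.
have [|b [gam [b0 /andP[gam0 gam1] contr]]] := harris_contraction mW W0 sl0 sK0 Wdrift sl1.
  (* The small sets are given as sublevel sets of [L], and sqrt L <= r means L <= r^2. *)
  move=> r; have [al [al01 [N [N1 N2]]]] := small (r ^+ 2)%R.
  exists al; split => //; exists N; split => // g x mg g0 Dx Wr.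
  apply: N2 => //; rewrite -W2 lerXn2r ?nnegrE//.
  exact: le_trans (W0 x) Wr.
pose phi E t := iter t P (fun y => (\1_E y)%:E).
have phi_meas E t : measurable E -> measurable_fun setT (phi E t) /\ (forall x, 0 <= phi E t x).
  move=> mE; elim: t => [|t [IH1 IH2]]; rewrite /phi /=.
    split; last by move=> x; rewrite lee_fin.
    by apply/measurable_EFinP; exact: measurable_indic.
  split; first exact: (markov_meas mP).
  by move=> x; exact: (markov_ge0 mP).
have phi_osc E t : measurable E -> (forall x, D x -> phi E t x <= 1) /\
    osc_le W b (gam ^+ t) (phi E t).
  move=> mE; elim: t => [|t [IH1 IH2]].
    split; first by move=> x _; rewrite /phi /= lee_fin indicE; case: (_ \in _).
    move=> x y _ _; rewrite /phi /= expr0 mul1r -EFinD lee_fin !indicE.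
    have : (0 <= b * (W x + W y))%R by rewrite mulr_ge0// addr_ge0.
    by case: (x \in E); case: (y \in E) => /=; lra.
  have [m1 n1] := phi_meas E t mE.
  split; last by rewrite exprS; apply: contr => //; rewrite exprn_ge0// ltW.
  move=> x Dx; rewrite -(markov1 mP Dx); apply: (markov_le mP) => //.
have phi_stat E t : measurable E -> \int[post]_x phi E t x = post E.
  move=> mE; elim: t => [|t IH].
    by rewrite /phi /= integral_indic// setIT.
  have [m1 n1] := phi_meas E t mE.
  by rewrite -IH -(stat m1 n1).
split; first by move=> E mE; exact: (phi_stat E 1%N mE).
exists gam; first by rewrite gam0.
move=> nu nupost nu2.
have nuD : nu (~` D) = 0.
  have /null_content_dominatesP := nupost; apply => //; exact: measurableC.
have postW2 : \int[post]_x (W x ^+ 2)%:E < +oo.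
  under eq_integral do rewrite W2.
  by apply: le_lt_trans piL _; rewrite ltry.
have nuW := L2_density_moment mW W0 nupost postW2 nu2.
have postW : \int[post]_x (W x)%:E < +oo.
  apply: (@le_lt_trans _ _ (\int[post]_x (W x ^+ 2 + 1)%:E)).
    apply: ge0_le_integral_EFin => //.
      by apply: measurable_funD => //; exact: measurable_funX.
    move=> x; have : (0 <= (W x - 1) ^+ 2)%R by exact: sqr_ge0.
    by rewrite sqrrB expr1n; have := W0 x; lra.
  rewrite (@ge0_integralD_EFin _ T R post (fun x => W x ^+ 2)%R (fun=> 1%R))//; last 2 first.
  - exact: measurable_funX.
  - by move=> x; exact: sqr_ge0.
  apply: lte_add_pinfty => //.
  by rewrite integral_probability_cst ltry.
pose wn := fine (\int[nu]_x (W x)%:E); pose wp := fine (\int[post]_x (W x)%:E).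
have wnE : \int[nu]_x (W x)%:E = wn%:E.
  by rewrite fineK// ge0_fin_numE// integral_ge0// => x _; rewrite lee_fin.
have wpE : \int[post]_x (W x)%:E = wp%:E.
  by rewrite fineK// ge0_fin_numE// integral_ge0// => x _; rewrite lee_fin.
have intW (rho : probability T R) (u v w : R) : (0 <= u)%R -> (0 <= v)%R ->
    \int[rho]_x (W x)%:E = w%:E -> \int[rho]_x (u + v * W x)%:E = (u + v * w)%:E.
  move=> u0 v0 h.
  have i1 : \int[rho]_x (1%R)%:E = 1%:E.
    by rewrite integral_probability_cst.
  have m1 : measurable_fun (setT : set T) (fun=> 1%R : R) by [].
  have := @ge0_integral_lin _ T R rho (fun=> 1%R) W u v 1%R w u0 v0 m1 mW (fun=> ler01) W0 i1 h.
  by rewrite mulr1.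
exists (2 + b * (wn + wp))%R => t; apply: ge_ereal_sup => _ [E mE <-].
have [m1 n1] := phi_meas E t mE; have [le1 os] := phi_osc E t mE.
rewrite /law_after -/(phi E t) -(phi_stat E t mE).
set g := (gam ^+ t)%R in os *.
have g0 : (0 <= g)%R by rewrite exprn_ge0// ltW.
have gb0 : (0 <= g * b)%R by rewrite mulr_ge0.
have h2 x : (0 <= g * (2 + b * W x))%R by rewrite mulr_ge0// addr_ge0// mulr_ge0.
(* integrate the oscillation bound in one variable, then in the other *)
have half (r1 r2 : probability T R) (w1 w2 : R) : r1 (~` D) = 0 -> r2 (~` D) = 0 ->
    \int[r1]_x (W x)%:E = w1%:E -> \int[r2]_x (W x)%:E = w2%:E ->
    \int[r1]_x phi E t x <= \int[r2]_x phi E t x + (g * (2 + b * (w1 + w2)))%:E.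
  move=> r1D r2D e1 e2.
  have step x : D x -> phi E t x <= \int[r2]_y phi E t y + (g * (2 + b * (W x + w2)))%:E.
    move=> Dx.
    have e3 := intW r2 _ _ _ (h2 x) gb0 e2.
    have -> : (g * (2 + b * (W x + w2)))%:E = \int[r2]_y (g * (2 + b * W x) + g * b * W y)%:E.
      by rewrite e3; congr EFin; ring.
    rewrite -ge0_integralD//; last 2 first.
    - by move=> y _; rewrite lee_fin addr_ge0// mulr_ge0.
    - by apply/measurable_EFinP; apply: measurable_funD => //; exact: measurable_funM.
    have -> : phi E t x = \int[r2]_y cst (phi E t x) y.
      by rewrite integral_probability_cst.
    apply: ae_ge0_le_integral => //.
    - by move=> y _; exact: n1.
    - by move=> y _; rewrite adde_ge0// lee_fin addr_ge0// mulr_ge0.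
    - apply: emeasurable_funD => //; apply/measurable_EFinP; apply: measurable_funD => //.
      exact: measurable_funM.
    apply: ae_leD => // y Dy; apply: le_trans (os x y Dx Dy) _; rewrite leeD2l// lee_fin.
    by rewrite le_eqVlt; apply/orP; left; apply/eqP; ring.
  have I0 : 0 <= \int[r2]_y phi E t y by apply: integral_ge0.
  have Ifin : \int[r2]_y phi E t y <= 1.
    apply: (@le_trans _ _ (\int[r2]_y cst 1 y)).
      apply: ae_ge0_le_integral => //; exact: ae_leD.
    by rewrite integral_probability_cst.
  move: I0 Ifin step; case: (\int[r2]_y phi E t y) => [i| |]// I0 _ step.
  have i0 : (0 <= i)%R by [].
  have hw2 : (0 <= w2)%R.
    by rewrite -lee_fin -e2; apply: integral_ge0 => y _; rewrite lee_fin.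
  have u0 : (0 <= i + g * (2 + b * w2))%R by rewrite addr_ge0// mulr_ge0// addr_ge0// mulr_ge0.
  have -> : i%:E + (g * (2 + b * (w1 + w2)))%:E = \int[r1]_x ((i + g * (2 + b * w2)) + g * b * W x)%:E.
    by rewrite (intW r1 _ _ _ u0 gb0 e1) -EFinD; congr EFin; ring.
  apply: ae_ge0_le_integral => //.
  - by move=> y _; rewrite lee_fin addr_ge0// mulr_ge0.
  - by apply/measurable_EFinP; apply: measurable_funD => //; exact: measurable_funM.
  apply: ae_leD => // x Dx; apply: le_trans (step x Dx) _; rewrite -EFinD lee_fin.
  by rewrite le_eqVlt; apply/orP; left; apply/eqP; ring.
have a1 := half nu post wn wp nuD postD wnE wpE.
have a2 := half post nu wp wn postD nuD wpE wnE.
have : 0 <= \int[nu]_x phi E t x by apply: integral_ge0.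
have : 0 <= \int[post]_x phi E t x by apply: integral_ge0.
move: a1 a2; rewrite [X in _ -> _ -> _ -> _ -> _ <= X](_ : _ = (g * (2 + b * (wn + wp)))%:E); last first.
  by rewrite mulrC.
rewrite (addrC wp wn).
have := phi_stat E t mE; have := probability_le1 post mE.
move=> + eE; rewrite -eE.
case: (\int[post]_x phi E t x) => [p| |]//; case: (\int[nu]_x phi E t x) => [q| |]//.
rewrite -!EFinD !lee_fin => _ a1 a2 _ _.
rewrite ler_distl; apply/andP; split; last by lra.
by rewrite lerBlDr.
Qed.

End invariant.
End harris.

(** * Gaussian measures on R^n *)

Section lebesgue_Rn_integral.
Context {R : realType}.
Local Notation mu := (@lebesgue_measure R).
Local Open Scope ereal_scope.

Lemma lebesgue_Rn0 (f : Rn R 0 -> \bar R) : measurable_fun setT f ->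
  \int[lebesgue_Rn R 0]_v f v = f [tuple].
Proof. by move=> mf; rewrite integral_dirac//= diracT mul1e. Qed.

Lemma measurable_tcons_comp n (f : Rn R n.+1 -> \bar R) : measurable_fun setT f ->
  measurable_fun setT (fun u : Rn R n * measurableTypeR R => f (tcons u)).
Proof. by move=> mf; apply: (measurableT_comp mf); exact: measurable_tcons. Qed.

Lemma lebesgue_RnS n (f : Rn R n.+1 -> \bar R) : measurable_fun setT f ->
  (forall v, 0 <= f v) ->
  \int[lebesgue_Rn R n.+1]_v f v =
  \int[lebesgue_Rn R n]_v \int[mu]_x f (tcons (v, x)).
Proof.
move=> mf f0.
have := ge0_integral_pushforward (@measurable_tcons R n)
  (lebesgue_Rn R n \x mu)%E measurableT mf (fun _ _ => f0 _).
rewrite preimage_setT => /= h.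
transitivity (\int[lebesgue_Rn R n \x mu]_u f (tcons u)).
  etransitivity; last exact: h.
  by apply: eq_measure_integral; first exact: measurable_tcons.
rewrite (fubini_tonelli1 (fun u => f (tcons u)))//.
exact: measurable_tcons_comp.
Qed.

Lemma lebesgue_RnS_swap n (f : Rn R n.+1 -> \bar R) : measurable_fun setT f ->
  (forall v, 0 <= f v) ->
  \int[lebesgue_Rn R n.+1]_v f v =
  \int[mu]_x \int[lebesgue_Rn R n]_v f (tcons (v, x)).
Proof.
move=> mf f0; rewrite lebesgue_RnS//.
rewrite (@fubini_tonelli _ _ _ _ _ (lebesgue_Rn R n) mu (fun u => f (tcons u)))//.
exact: measurable_tcons_comp.
Qed.

Lemma measurable_prod_tnth n (f : 'I_n -> R -> R) :
  (forall i, measurable_fun setT (f i : measurableTypeR R -> R)) ->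
  measurable_fun setT (fun v : Rn R n => \prod_(i < n) f i (tnth v i))%R.
Proof.
move=> mf; apply: measurable_prod => i _.
by apply: (measurableT_comp (mf i)); exact: measurable_tnth.
Qed.

Lemma integral_Rn_prod n (f : 'I_n -> R -> R) :
  (forall i, measurable_fun setT (f i : measurableTypeR R -> R)) ->
  (forall i x, 0 <= f i x)%R ->
  \int[lebesgue_Rn R n]_v (\prod_(i < n) f i (tnth v i))%:E =
  \prod_(i < n) \int[mu]_x (f i x)%:E.
Proof.
elim: n f => [|n IH] f mf f0.
  rewrite lebesgue_Rn0; last by apply/measurable_EFinP; exact: measurable_prod_tnth.
  by rewrite !big_ord0.
have mp := measurable_prod_tnth mf.
rewrite lebesgue_RnS; last 2 first.
- exact/measurable_EFinP.
- by move=> v; rewrite lee_fin prodr_ge0.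
rewrite big_ord_recl -IH; [|by move=> i; exact: mf|by move=> i x; exact: f0].
set I0 := \int[mu]_x (f ord0 x)%:E.
have I00 : 0 <= I0 by apply: integral_ge0 => x _; rewrite lee_fin.
have mp' := @measurable_prod_tnth n (fun i => f (lift ord0 i)) (fun i => mf _).
rewrite -ge0_integralZl//; last 2 first.
- exact/measurable_EFinP.
- by move=> v _; rewrite lee_fin prodr_ge0.
apply: eq_integral => v _.
have pv : 0 <= (\prod_(i < n) f (lift ord0 i) (tnth v i))%:E by rewrite lee_fin prodr_ge0.
rewrite -ge0_integralZr//; last 2 first.
- exact/measurable_EFinP.
- by move=> x _; rewrite lee_fin.
apply: eq_integral => x _; rewrite big_ord_recl -EFinM; congr (_ * _)%:E.
apply: eq_bigr => i _; congr (f _ _).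
by rewrite (tnth_nth 0%R) /= (tnth_nth 0%R).
Qed.

End lebesgue_Rn_integral.

(** * Positive definite forms and Schur complements *)

Section quadratic_form.
Context {R : realType}.

Definition qf n (Q : 'M[R]_n) (x : 'cV[R]_n) : R := (x^T *m Q *m x) 0 0.

Definition posdef n (Q : 'M[R]_n) := Q^T = Q /\ forall x, x != 0 -> 0 < qf Q x.

Lemma mx11D (A B : 'M[R]_1) : (A + B) 0 0 = A 0 0 + B 0 0.
Proof. by rewrite mxE. Qed.

Lemma mx11Z (c : R) (A : 'M[R]_1) : (c *: A) 0 0 = c * A 0 0.
Proof. by rewrite mxE. Qed.

Lemma mx11T (A : 'M[R]_1) : A^T 0 0 = A 0 0.
Proof. by rewrite mxE. Qed.

Lemma mx11C (c : R) : (c%:M : 'M[R]_1) 0 0 = c.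
Proof. by rewrite mxE eqxx. Qed.

Lemma qf0 n (Q : 'M[R]_n) : qf Q 0 = 0.
Proof. by rewrite /qf mulmx0 mxE. Qed.

Lemma posdef_ge0 n (Q : 'M[R]_n) x : posdef Q -> 0 <= qf Q x.
Proof.
move=> [_ h]; have [->|/h/ltW//] := eqVneq x 0; by rewrite qf0.
Qed.

Lemma qf_block n (q : R) (r : 'rV[R]_n) (S : 'M[R]_n) (z : R) (y : 'cV[R]_n) :
  qf (block_mx q%:M r (r^T) S : 'M[R]_(1 + n)) (col_mx z%:M y) =
  q * z ^+ 2 + 2 * z * (r *m y) 0 0 + qf S y.
Proof.
rewrite /qf tr_col_mx mul_row_block mul_row_col !mulmxDl tr_scalar_mx.
rewrite -!scalar_mxM !mul_scalar_mx !mul_mx_scalar -trmx_mul -scalemxAl.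
rewrite !(mx11D, mx11Z, mx11T, mx11C).
by ring.
Qed.

Lemma block_mx_sym n (Q : 'M[R]_(1 + n)) : Q^T = Q ->
  Q = block_mx (Q 0 0)%:M (ursubmx Q) (ursubmx Q)^T (drsubmx Q).
Proof.
move=> Qs; rewrite -[LHS]submxK; congr block_mx.
- by rewrite [LHS]mx11_scalar !mxE; congr (Q _ _)%:M; apply/val_inj.
- by rewrite trmx_ursub Qs.
Qed.

(** For a Gaussian law with precision matrix [Q], this is the precision matrix of the remaining
    coordinates once the first is integrated out. *)
Definition schur n (Q : 'M[R]_(1 + n)) : 'M[R]_n :=
  drsubmx Q - (Q 0 0)^-1 *: ((ursubmx Q)^T *m ursubmx Q).

Lemma qf_delta n (Q : 'M[R]_n) i : qf Q (delta_mx i 0) = Q i i.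
Proof. by rewrite /qf trmx_delta -rowE -colE !mxE. Qed.

Lemma posdef_diag n (Q : 'M[R]_n) i : posdef Q -> 0 < Q i i.
Proof.
move=> [_ h]; rewrite -qf_delta; apply: h; apply/eqP => /matrixP/(_ i 0).
by rewrite !mxE !eqxx /= => /eqP; rewrite oner_eq0.
Qed.

Lemma qf_schur n (Q : 'M[R]_(1 + n)) (z : R) (y : 'cV[R]_n) : Q^T = Q -> Q 0 0 != 0 ->
  qf Q (col_mx z%:M y) =
  Q 0 0 * (z + (ursubmx Q *m y) 0 0 / Q 0 0) ^+ 2 + qf (schur Q) y.
Proof.
move=> Qs q0; rewrite {1}(block_mx_sym Qs) qf_block.
set q := Q 0 0 in q0 *; set r := ursubmx Q.
have -> : qf (schur Q) y = qf (drsubmx Q) y - q^-1 * (r *m y) 0 0 ^+ 2.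
  rewrite /qf /schur mulmxBr mulmxBl -scalemxAr -scalemxAl mulmxA -trmx_mul.
  rewrite -mulmxA [LHS]mxE [X in _ + X]mxE; congr (_ - _).
  rewrite [LHS]mxE; congr (_ * _).
  by rewrite -mulmxA mxE big_ord1 mxE expr2.
by field.
Qed.

Lemma schur_sym n (Q : 'M[R]_(1 + n)) : Q^T = Q -> (schur Q)^T = schur Q.
Proof.
move=> Qs; rewrite /schur linearB linearZ /= trmx_mul trmxK; congr (_ - _).
by rewrite trmx_drsub Qs.
Qed.

Lemma schur_posdef n (Q : 'M[R]_(1 + n)) : posdef Q -> posdef (schur Q).
Proof.
move=> pQ; have q0 : 0 < Q 0 0 by exact: posdef_diag.
have [Qs h] := pQ; split; first exact: schur_sym.
move=> y y0; pose z := - ((ursubmx Q *m y) 0 0 / Q 0 0).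
have := h (col_mx z%:M y); rewrite qf_schur ?gt_eqF// addNr expr0n /= mulr0 add0r.
by apply; rewrite col_mx_eq0 negb_and y0 orbT.
Qed.

Lemma det_schur n (Q : 'M[R]_(1 + n)) : Q^T = Q -> Q 0 0 != 0 ->
  \det Q = Q 0 0 * \det (schur Q).
Proof.
move=> Qs q0; set q := Q 0 0 in q0 *; set r := ursubmx Q.
have E : Q = block_mx 1%:M 0 (q^-1 *: r^T) 1%:M *m block_mx q%:M r 0 (schur Q).
  rewrite mulmx_block !mul1mx !mul0mx !addr0 mul_mx_scalar scalerA mulfV// scale1r.
  by rewrite /schur -scalemxAl addrC subrK -block_mx_sym.
by rewrite {1}E det_mulmx det_lblock !det1 !mul1r det_ublock det_scalar1.
Qed.

Lemma posdef_det n (Q : 'M[R]_n) : posdef Q -> 0 < \det Q.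
Proof.
elim: n Q => [|n IH] Q pQ; first by rewrite det_mx00.
have q0 : 0 < Q 0 0 by exact: posdef_diag.
have [Qs _] := pQ; rewrite (@det_schur n)// ?gt_eqF// mulr_gt0// IH//.
exact: schur_posdef.
Qed.

Lemma posdef_unit n (Q : 'M[R]_n) : posdef Q -> Q \in unitmx.
Proof. by move=> pQ; rewrite unitmxE unitfE gt_eqF// posdef_det. Qed.

Lemma posdef_inv n (Q : 'M[R]_n) : posdef Q -> posdef (invmx Q).
Proof.
move=> pQ; have uQ := posdef_unit pQ; have [Qs h] := pQ.
have iQs : (invmx Q)^T = invmx Q by rewrite trmx_inv Qs.
split=> // x x0; have -> : qf (invmx Q) x = qf Q (invmx Q *m x).
  by rewrite /qf trmx_mul iQs !mulmxA mulmxKV// -!mulmxA.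
apply: h; apply: contra x0 => /eqP e; rewrite -[x]mul1mx -(mulmxV uQ) -mulmxA e.
by rewrite mulmx0.
Qed.

Lemma posdef_scale n (Q : 'M[R]_n) (c : R) : 0 < c -> posdef Q -> posdef (c *: Q).
Proof.
move=> c0 [Qs h]; split; first by rewrite linearZ /= Qs.
by move=> x x0; rewrite /qf -scalemxAr -scalemxAl mxE mulr_gt0//; exact: h.
Qed.

(** Completes the square in the tail [y] rather than in the head [z]: the coefficient of z^2 is the
    precision of the first coordinate once the tail is integrated out. *)
Lemma qf_schur_tail n (Q : 'M[R]_(1 + n)) (z : R) (y : 'cV[R]_n) : Q^T = Q ->
  drsubmx Q \in unitmx ->
  let c := invmx (drsubmx Q) *m (ursubmx Q)^T in
  qf Q (col_mx z%:M y) =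
  (Q 0 0 - (ursubmx Q *m c) 0 0) * z ^+ 2 + qf (drsubmx Q) (y + z *: c).
Proof.
move=> Qs uS c; rewrite {1}(block_mx_sym Qs) qf_block.
set r := ursubmx Q; set S := drsubmx Q in uS c *.
have Ss : S^T = S by rewrite trmx_drsub Qs.
have Sc : S *m c = r^T by rewrite /c mulmxA mulmxV// mul1mx.
have cS : c^T *m S = r by rewrite -Ss -trmx_mul Sc trmxK.
have eT : (y + z *: c)^T = y^T + z *: c^T by apply/matrixP => i j; rewrite !mxE.
rewrite /qf eT !mulmxDl !mulmxDr -!scalemxAl cS -!scalemxAr.
have -> : y^T *m S *m c = (r *m y)^T by rewrite -mulmxA Sc trmx_mul.
rewrite !(mx11D, mx11Z, mx11T).
by ring.
Qed.

Lemma tail_posdef n (Q : 'M[R]_(1 + n)) : posdef Q -> posdef (drsubmx Q).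
Proof.
move=> [Qs h]; split; first by rewrite trmx_drsub Qs.
move=> y y0; have := h (col_mx 0%:M y).
rewrite {1}(block_mx_sym Qs) qf_block expr0n /= !mulr0 mul0r !add0r.
by apply; rewrite col_mx_eq0 negb_and y0 orbT.
Qed.

Lemma vcol_tcons n (v : Rn R n) (x : R) :
  vcol (tcons (v, x) : Rn R n.+1) = col_mx x%:M (vcol v) :> 'cV[R]_(1 + n).
Proof.
apply/colP => i; rewrite !mxE; case: splitP => j ij.
  rewrite !mxE ord1 eqxx mulr1n (_ : i = ord0) ?tnth0//.
  by apply/val_inj; rewrite /= ij ord1.
rewrite !mxE (_ : i = lift ord0 j); last exact/val_inj.
by rewrite (tnth_nth 0) /= (tnth_nth 0).
Qed.

End quadratic_form.

Section gauss_Rn.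
Context {R : realType}.
Local Notation mu := (@lebesgue_measure R).

Definition gauss_fun_Rn n (Q : 'M[R]_n) (m : 'cV[R]_n) (v : Rn R n) : R :=
  expR (- 2^-1 * qf Q (vcol v - m)).

Lemma qf_sum n (Q : 'M[R]_n) (x : 'cV[R]_n) :
  qf Q x = \sum_i (\sum_j x j 0 * Q j i) * x i 0.
Proof.
rewrite /qf mxE; apply: eq_bigr => i _; rewrite mxE; congr (_ * _).
by apply: eq_bigr => j _; rewrite mxE.
Qed.

Lemma measurable_gauss_fun_Rn n (Q : 'M[R]_n) (m : 'cV[R]_n) :
  measurable_fun setT (gauss_fun_Rn Q m).
Proof.
rewrite (_ : gauss_fun_Rn Q m = fun v : Rn R n => expR (- 2^-1 *
  \sum_i (\sum_j (tnth v j - m j 0) * Q j i) * (tnth v i - m i 0))); last first.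
  apply/funext => v; rewrite /gauss_fun_Rn qf_sum; congr (expR (_ * _)).
  apply: eq_bigr => i _; rewrite !mxE; congr (_ * _).
  by apply: eq_bigr => j _; rewrite !mxE.
apply: measurable_fun_expR; apply: measurable_funM => //.
have mt (j : 'I_n) : measurable_fun setT (fun v : Rn R n => tnth v j - m j 0).
  by apply: measurable_funB => //; exact: measurable_tnth.
apply: measurable_sum => i; apply: measurable_funM => //.
by apply: measurable_sum => j; exact: measurable_funM.
Qed.

Lemma gauss_fun_Rn_ge0 n (Q : 'M[R]_n) m v : 0 <= gauss_fun_Rn Q m v.
Proof. exact: expR_ge0. Qed.

Definition cV_head n (m : 'cV[R]_n.+1) : R := m 0 0.
Definition cV_tail n (m : 'cV[R]_n.+1) : 'cV[R]_n := dsubmx (m : 'cV[R]_(1 + n)).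

Lemma cV_split n (m : 'cV[R]_n.+1) : m = col_mx (cV_head m)%:M (cV_tail m) :> 'cV[R]_(1 + n).
Proof.
rewrite -[LHS](vsubmxK (m : 'cV[R]_(1 + n))); congr col_mx.
by rewrite [LHS]mx11_scalar mxE; congr (m _ _)%:M; apply/val_inj.
Qed.

Lemma gauss_fun_schur n (Q : 'M[R]_n.+1) (m : 'cV[R]_n.+1) (v : Rn R n) x : posdef Q ->
  gauss_fun_Rn Q m (tcons (v, x)) =
  gauss_shape (Q 0 0) (cV_head m - (ursubmx (Q : 'M[R]_(1 + n)) *m (vcol v - cV_tail m)) 0 0 / Q 0 0) x *
  gauss_fun_Rn (schur (Q : 'M[R]_(1 + n))) (cV_tail m) v.
Proof.
move=> pQ; have q0 : Q 0 0 != 0 by rewrite gt_eqF// posdef_diag.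
rewrite /gauss_fun_Rn /gauss_shape -expRD vcol_tcons {1}(cV_split m); congr expR.
rewrite (_ : col_mx _ _ - col_mx _ _ = col_mx (x - cV_head m)%:M (vcol v - cV_tail m)); last first.
  by rewrite opp_col_mx add_col_mx; congr col_mx; apply/matrixP => i j; rewrite !mxE; case: eqP => _;
    rewrite ?mulr1n ?mulr0n ?subr0.
have [Qs _] := pQ.
rewrite qf_schur//.
by rewrite opprB addrA; field.
Qed.

(** Integrating the first coordinate leaves a Gaussian function of the Schur complement, and the
    determinant factors accordingly. *)
Lemma integral_gauss_Rn n (Q : 'M[R]_n) (m : 'cV[R]_n) : posdef Q ->
  (\int[lebesgue_Rn R n]_v (gauss_fun_Rn Q m v)%:E =
   (Num.sqrt ((2 * pi) ^+ n / \det Q))%:E)%E.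
Proof.
elim: n Q m => [|n IH] Q m pQ.
  rewrite (@lebesgue_Rn0 R (EFin \o gauss_fun_Rn Q m)); last by apply/measurable_EFinP; exact: measurable_gauss_fun_Rn.
  rewrite /= det_mx00 expr0 divr1 sqrtr1 /gauss_fun_Rn qf_sum big_ord0 mulr0 expR0//.
have q0 : 0 < Q 0 0 by exact: posdef_diag.
have pS := @schur_posdef R n Q pQ.
rewrite lebesgue_RnS; last 2 first.
- by apply/measurable_EFinP; exact: measurable_gauss_fun_Rn.
- by move=> v; rewrite lee_fin gauss_fun_Rn_ge0.
under eq_integral => v _.
  under eq_integral => x _ do rewrite (gauss_fun_schur m v x pQ) mulrC.
  rewrite ge0_integralZ_EFin; [|exact: gauss_fun_Rn_ge0|exact: measurable_gauss_shape|exact: gauss_shape_ge0].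
  rewrite integral_gauss_shape// muleC.
  over.
rewrite ge0_integralZl//; last 3 first.
- by apply/measurable_EFinP; exact: measurable_gauss_fun_Rn.
- by move=> v _; rewrite lee_fin gauss_fun_Rn_ge0.
- by rewrite lee_fin gw_half// sqrtr_ge0.
rewrite IH// gw_half// -EFinM -sqrtrM; last first.
  by rewrite divr_ge0 ?mulr_ge0 ?pi_ge0// ltW.
have [Qs _] := pQ.
congr (Num.sqrt _)%:E; rewrite (@det_schur R n)// ?gt_eqF//.
rewrite exprS; field; rewrite !gt_eqF//; exact: posdef_det.
Qed.

(* [t] is a Schur complement of [Q], i.e. [t x_i^2] is the minimum of the quadratic
   form over the other coordinates. *)
Lemma gauss_Rn_marginal n (Q : 'M[R]_n) (i : 'I_n) : posdef Q ->
  exists t C : R, [/\ 0 < t, t <= Q i i,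
    (forall l : R, (forall x : 'cV[R]_n, l * x i 0 ^+ 2 <= qf Q x) -> l <= t), 0 <= C &
    forall (m : 'cV[R]_n) (g : measurableTypeR R -> R), measurable_fun setT g -> (forall x, 0 <= g x) ->
      (\int[lebesgue_Rn R n]_v (g (tnth v i) * gauss_fun_Rn Q m v)%:E =
       C%:E * \int[mu]_x (g x * gauss_shape t (m i 0) x)%:E)%E].
Proof.
elim: n Q i => [|n IH] Q i pQ; first by case: i.
have q0 : 0 < Q 0 0 by exact: posdef_diag.
have mgi (g : measurableTypeR R -> R) j m (Q' : 'M[R]_n.+1) : measurable_fun setT g ->
    measurable_fun setT (fun v : Rn R n.+1 => g (tnth v j) * gauss_fun_Rn Q' m v).
  move=> mg; apply: measurable_funM; last exact: measurable_gauss_fun_Rn.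
  by apply: (measurableT_comp mg); exact: measurable_tnth.
have [Qs h] := pQ.
have [j ->|->] := unliftP ord0 i.
(* A later coordinate: integrate out the first one and recurse on the Schur complement. *)
- have pS := @schur_posdef R n Q pQ.
  have [t [C [t0 tle tge C0 IHg]]] := IH _ j pS.
  exists t, (C * gw 2^-1 (Q 0 0) 0); split => //.
  + apply: (le_trans tle); rewrite /schur !mxE.
    rewrite (_ : rshift 1 j = lift ord0 j); last exact/val_inj.
    rewrite lerBlDr lerDl mulr_ge0 ?invr_ge0 ?(ltW q0)// big_ord1 !mxE.
    by rewrite -expr2 sqr_ge0.
  + move=> l hl; apply: tge => y.
    (* At the minimizing first coordinate the form equals that of the Schur complement, so lower
       bounds in terms of x_i^2 are inherited. *)
    have := hl (col_mx (- ((ursubmx (Q : 'M[R]_(1 + n)) *m y) 0 0 / Q 0 0))%:M y : 'cV[R]_(1 + n)).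
    rewrite qf_schur ?gt_eqF// addNr expr0n /= mulr0 add0r.
    rewrite (_ : lift ord0 j = rshift 1 j); last exact/val_inj.
    have -> : (col_mx (- ((ursubmx (Q : 'M[R]_(1 + n)) *m y) 0 0 / Q 0 0))%:M y : 'cV[R]_n.+1) (rshift 1 j) 0 = y j 0 by exact: col_mxEd.
    by [].
  + by rewrite mulr_ge0// gw_half// sqrtr_ge0.
  + move=> m g mg g0.
    rewrite lebesgue_RnS; last 2 first.
    * by apply/measurable_EFinP; exact: mgi.
    * by move=> v; rewrite lee_fin mulr_ge0// gauss_fun_Rn_ge0.
    have gv v x : tnth (tcons (v, x) : Rn R n.+1) (lift ord0 j) = tnth v j.
      by rewrite (tnth_nth 0) /= (tnth_nth 0).
    have gg0 v : 0 <= g (tnth v j) * gauss_fun_Rn (schur (Q : 'M[R]_(1 + n))) (cV_tail m) v.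
      by rewrite mulr_ge0// gauss_fun_Rn_ge0.
    under eq_integral => v _.
      under eq_integral => x _ do rewrite gv (gauss_fun_schur m v x pQ) (mulrC (gauss_shape _ _ _)) mulrA.
      rewrite ge0_integralZ_EFin; [|exact: gg0|exact: measurable_gauss_shape|exact: gauss_shape_ge0].
      rewrite integral_gauss_shape// muleC.
      over.
    rewrite ge0_integralZl//; last 3 first.
    * apply/measurable_EFinP; apply: measurable_funM; last exact: measurable_gauss_fun_Rn.
      by apply: (measurableT_comp mg); exact: measurable_tnth.
    * by move=> v _; rewrite lee_fin.
    * by rewrite lee_fin gw_half// sqrtr_ge0.
    rewrite (IHg _ g mg g0) muleA -EFinM (mulrC C); congr (_ * _)%E.
    suff -> : cV_tail m j 0 = m (lift ord0 j) 0 by [].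
    by rewrite mxE; congr (m _ _); exact/val_inj.
(* The first coordinate: integrate out all the others at once. *)
- have pS := @tail_posdef R n Q pQ.
  have uS := posdef_unit pS.
  set S := drsubmx (Q : 'M[R]_(1 + n)) in pS uS.
  pose c := invmx S *m (ursubmx (Q : 'M[R]_(1 + n)))^T.
  pose t := Q 0 0 - (ursubmx (Q : 'M[R]_(1 + n)) *m c) 0 0.
  have qE z y : qf Q (col_mx z%:M y : 'cV[R]_(1 + n)) = t * z ^+ 2 + qf S (y + z *: c).
    exact: qf_schur_tail.
  have h0 z y : (col_mx z%:M y : 'cV[R]_(1 + n)) ord0 0 = z.
    transitivity ((col_mx z%:M y : 'cV[R]_(1 + n)) (lshift n 0) 0).
      by congr (fun_of_matrix _ _ _); exact/val_inj.
    by rewrite col_mxEu mxE eqxx.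
  have t0 : 0 < t.
    have := h (col_mx 1%:M (- c) : 'cV[R]_(1 + n)); rewrite qE expr1n mulr1 scale1r addNr qf0 addr0.
    apply; apply/eqP => e; have := h0 1 (- c); rewrite e mxE => /eqP.
    by rewrite eq_sym oner_eq0.
  exists t, (Num.sqrt ((2 * pi) ^+ n / \det S)); split => //.
  + rewrite lerBlDr lerDl; have := posdef_ge0 c pS.
    have Sc : S *m c = (ursubmx (Q : 'M[R]_(1 + n)))^T by rewrite /c mulmxA mulmxV// mul1mx.
    by rewrite /qf -mulmxA Sc -trmx_mul mx11T.
  + move=> l hl; have := hl (col_mx 1%:M (- c) : 'cV[R]_(1 + n)).
    by rewrite qE h0 !expr1n !mulr1 scale1r addNr qf0 addr0.
  + move=> m g mg g0.
    rewrite lebesgue_RnS_swap; last 2 first.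
    * by apply/measurable_EFinP; exact: mgi.
    * by move=> v; rewrite lee_fin mulr_ge0// gauss_fun_Rn_ge0.
    rewrite -ge0_integralZl; last 4 first.
    * exact: measurableT.
    * by apply/measurable_EFinP; apply: measurable_funM => //; exact: measurable_gauss_shape.
    * by move=> x _; rewrite lee_fin mulr_ge0// gauss_shape_ge0.
    * by rewrite lee_fin sqrtr_ge0.
    apply: eq_integral => x _.
    rewrite -(integral_gauss_Rn (cV_tail m - (x - cV_head m) *: c) pS) muleC.
    rewrite -ge0_integralZ_EFin; last 3 first.
    * by rewrite mulr_ge0// gauss_shape_ge0.
    * exact: measurable_gauss_fun_Rn.
    * exact: gauss_fun_Rn_ge0.
    apply: eq_integral => v _; congr EFin.
    rewrite tnth0 -mulrA; congr (_ * _).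
    rewrite /gauss_fun_Rn /gauss_shape -expRD vcol_tcons {1}(cV_split m); congr expR.
    rewrite (_ : col_mx _ _ - col_mx _ _ = col_mx (x - cV_head m)%:M (vcol v - cV_tail m)); last first.
      by rewrite opp_col_mx add_col_mx; congr col_mx; apply/matrixP => i' j'; rewrite !mxE; case: eqP => _;
        rewrite ?mulr1n ?mulr0n ?subr0.
    rewrite qE opprB addrA addrAC /cV_head.
    by field.
Qed.

Lemma mvn_pdfE n (m : 'cV[R]_n) (S : 'M[R]_n) (v : Rn R n) :
  mvn_pdf m S (vcol v) = (Num.sqrt ((2 * pi) ^+ n * \det S))^-1 * gauss_fun_Rn (invmx S) m v.
Proof. by []. Qed.

Lemma measurable_mvn_pdf n (m : 'cV[R]_n) (S : 'M[R]_n) :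
  measurable_fun setT (fun v : Rn R n => mvn_pdf m S (vcol v)).
Proof.
under eq_fun do rewrite mvn_pdfE.
by apply: measurable_funM => //; exact: measurable_gauss_fun_Rn.
Qed.

Lemma mvn_pdf_ge0 n (m x : 'cV[R]_n) (S : 'M[R]_n) : 0 <= mvn_pdf m S x.
Proof. by rewrite mulr_ge0 ?expR_ge0// invr_ge0 sqrtr_ge0. Qed.

Lemma mvn_pdf_le n (m x : 'cV[R]_n) (S : 'M[R]_n) : posdef S ->
  mvn_pdf m S x <= (Num.sqrt ((2 * pi) ^+ n * \det S))^-1.
Proof.
move=> pS; rewrite /mvn_pdf ler_piMr ?invr_ge0 ?sqrtr_ge0// -expR0 ler_expR mulNr oppr_le0.
by rewrite mulr_ge0//; exact: (posdef_ge0 _ (posdef_inv pS)).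
Qed.

Lemma integral_mvn_pdf n (m : 'cV[R]_n) (S : 'M[R]_n) : posdef S ->
  (\int[lebesgue_Rn R n]_v (mvn_pdf m S (vcol v))%:E = 1)%E.
Proof.
move=> pS; have d0 := posdef_det pS.
under eq_integral do rewrite mvn_pdfE.
rewrite ge0_integralZ_EFin; last 3 first.
- by rewrite invr_ge0 sqrtr_ge0.
- exact: measurable_gauss_fun_Rn.
- exact: gauss_fun_Rn_ge0.
rewrite integral_gauss_Rn; last exact: posdef_inv.
rewrite det_inv invrK -EFinM mulVf// gt_eqF// sqrtr_gt0 mulr_gt0// exprn_gt0//.
by rewrite mulr_gt0// pi_gt0.
Qed.

(** [t] is the precision of the i-th coordinate. The estimates on the sampler go through two bounds
    on it, a diagonal entry from above and a comparison of quadratic forms from below. *)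
Lemma mvn_marginal n (S : 'M[R]_n) (i : 'I_n) : posdef S ->
  exists t : R, [/\ 0 < t, t <= invmx S i i,
    (forall l : R, (forall x : 'cV[R]_n, l * x i 0 ^+ 2 <= qf (invmx S) x) -> l <= t) &
    forall (m : 'cV[R]_n) (g : measurableTypeR R -> R), measurable_fun setT g -> (forall x, 0 <= g x) ->
      (\int[lebesgue_Rn R n]_v (g (tnth v i) * mvn_pdf m S (vcol v))%:E =
       (gw 2^-1 t 0)^-1%:E * \int[mu]_x (g x * gauss_shape t (m i 0) x)%:E)%E].
Proof.
move=> pS; have pQ := posdef_inv pS.
have [t [C [t0 tle tge C0 H]]] := gauss_Rn_marginal i pQ.
exists t; split => // m g mg g0.
set c := (Num.sqrt ((2 * pi) ^+ n * \det S))^-1.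
have c0 : 0 <= c by rewrite invr_ge0 sqrtr_ge0.
have E (f : measurableTypeR R -> R) : measurable_fun setT f -> (forall x, 0 <= f x) ->
  (\int[lebesgue_Rn R n]_v (f (tnth v i) * mvn_pdf m S (vcol v))%:E =
   (c * C)%:E * \int[mu]_x (f x * gauss_shape t (m i 0) x)%:E)%E.
  move=> mf f0.
  under eq_integral do rewrite mvn_pdfE mulrCA.
  rewrite ge0_integralZ_EFin//; last 2 first.
  - apply: measurable_funM; last exact: measurable_gauss_fun_Rn.
    by apply: (measurableT_comp mf); exact: measurable_tnth.
  - by move=> v; rewrite mulr_ge0// gauss_fun_Rn_ge0.
  by rewrite H// muleA -EFinM.
(* The total mass, g = 1, identifies the constant. *)
have c1 : (c * C * gw 2^-1 t 0 = 1)%R.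
  have := E (cst 1) (@measurable_cst _ _ _ _ _ _) (fun=> ler01).
  under eq_integral do rewrite mul1r.
  rewrite integral_mvn_pdf//; under eq_integral do rewrite mul1r.
  by rewrite integral_gauss_shape// => /eqP; rewrite -EFinM eqe => /eqP.
rewrite E//; congr ((_ : R)%:E * _)%E.
have g1 : gw 2^-1 t 0 != 0.
  by apply/eqP => e; move: c1; rewrite e mulr0 => /eqP; rewrite eq_sym oner_eq0.
by apply: (mulIf g1); rewrite c1 mulVf.
Qed.

End gauss_Rn.

(** * Ridge solutions with varying weights *)

Section dot_product.
Context {R : realType}.

Definition dot n (x y : 'cV[R]_n) : R := \sum_i x i 0 * y i 0.

Lemma dotE n (x y : 'cV[R]_n) : dot x y = (x^T *m y) 0 0.
Proof. by rewrite mxE; apply: eq_bigr => i _; rewrite mxE. Qed.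

Lemma dotC n (x y : 'cV[R]_n) : dot x y = dot y x.
Proof. by apply: eq_bigr => i _; rewrite mulrC. Qed.

Lemma dotDl n (x y z : 'cV[R]_n) : dot (x + y) z = dot x z + dot y z.
Proof. by rewrite -big_split; apply: eq_bigr => i _; rewrite mxE mulrDl. Qed.

Lemma dotZl n (c : R) (x y : 'cV[R]_n) : dot (c *: x) y = c * dot x y.
Proof. by rewrite mulr_sumr; apply: eq_bigr => i _; rewrite mxE mulrA. Qed.

Lemma dotDr n (x y z : 'cV[R]_n) : dot x (y + z) = dot x y + dot x z.
Proof. by rewrite dotC dotDl !(dotC x). Qed.

Lemma dotZr n (c : R) (x y : 'cV[R]_n) : dot x (c *: y) = c * dot x y.
Proof. by rewrite dotC dotZl dotC. Qed.

Lemma dotNl n (x y : 'cV[R]_n) : dot (- x) y = - dot x y.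
Proof. by rewrite -scaleN1r dotZl mulN1r. Qed.

Lemma dotNr n (x y : 'cV[R]_n) : dot x (- y) = - dot x y.
Proof. by rewrite dotC dotNl dotC. Qed.

Lemma dot_ge0 n (x : 'cV[R]_n) : 0 <= dot x x.
Proof. by apply: sumr_ge0 => i _; rewrite -expr2 sqr_ge0. Qed.

Lemma sqr_le_dot n (x : 'cV[R]_n) i : x i 0 ^+ 2 <= dot x x.
Proof.
rewrite /dot (bigD1 i)//= -expr2 lerDl; apply: sumr_ge0 => j _.
by rewrite -expr2 sqr_ge0.
Qed.

Lemma dot_eq0 n (x : 'cV[R]_n) : dot x x = 0 -> x = 0.
Proof.
move=> e; apply/colP => i; apply/eqP; rewrite mxE -sqrf_eq0.
by rewrite eq_le sqr_ge0 andbT -e sqr_le_dot.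
Qed.

Lemma dot_mulmx m n (A : 'M[R]_(m, n)) x y : dot x (A *m y) = dot (A^T *m x) y.
Proof. by rewrite !dotE trmx_mul trmxK mulmxA. Qed.

Lemma dot_amgm n (s : R) (x y : 'cV[R]_n) : 0 < s ->
  dot x y <= s * dot x x + (4 * s)^-1 * dot y y.
Proof.
move=> s0; have := dot_ge0 (s *: x - 2^-1 *: y).
rewrite !(dotDl, dotDr, dotNl, dotNr, dotZl, dotZr) (dotC y x) => h.
have {h} : 0 <= s^-1 * (s * (s * dot x x) + - (2^-1 * (s * dot x y)) +
  (- (s * (2^-1 * dot x y)) - - (2^-1 * (2^-1 * dot y y)))).
  by apply: mulr_ge0; [rewrite invr_ge0 ltW | lra].
rewrite [X in _ <= X](_ : _ = s * dot x x + (4 * s)^-1 * dot y y - dot x y) ?subr_ge0//.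
by field; rewrite gt_eqF.
Qed.

Lemma dot_addl_le n (e : R) (x y : 'cV[R]_n) : 0 < e ->
  dot (x + y) (x + y) <= (1 + e) * dot x x + (1 + e^-1) * dot y y.
Proof.
move=> e0; have e2 : 0 < e / 2 by rewrite divr_gt0.
have := dot_amgm x y e2; rewrite !(dotDl, dotDr) (dotC y x).
have -> : (4 * (e / 2))^-1 = e^-1 / 2 by field; rewrite gt_eqF.
by lra.
Qed.

Lemma sum_cauchy_schwarz (I : finType) (f g : I -> R) :
  (\sum_i f i * g i) ^+ 2 <= (\sum_i f i ^+ 2) * \sum_i g i ^+ 2.
Proof.
set a := \sum_i f i ^+ 2; set b := \sum_i g i ^+ 2; set c := \sum_i f i * g i.
have b0 : 0 <= b by apply: sumr_ge0 => i _; exact: sqr_ge0.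
have [be|bn0] := eqVneq b 0.
  suff -> : c = 0 by rewrite expr0n /= be mulr0.
  rewrite /c big1// => i _; have /eqP : g i ^+ 2 = 0.
    apply/eqP; rewrite eq_le sqr_ge0 andbT -be /b (bigD1 i)//= lerDl.
    by apply: sumr_ge0 => j _; exact: sqr_ge0.
  by rewrite sqrf_eq0 => /eqP ->; rewrite mulr0.
have : 0 <= \sum_i (b * f i - c * g i) ^+ 2.
  by apply: sumr_ge0 => i _; exact: sqr_ge0.
rewrite (_ : \sum_i _ = b * (b * a - c ^+ 2)); last first.
  transitivity (\sum_i (b ^+ 2 * f i ^+ 2 - 2 * b * c * (f i * g i) + c ^+ 2 * g i ^+ 2)).
    by apply: eq_bigr => i _; ring.
  by rewrite !big_split /= sumrN -!mulr_sumr -/a -/b -/c; ring.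
by rewrite pmulr_rge0 ?lt_neqAle 1?eq_sym ?bn0// subr_ge0 mulrC.
Qed.

Lemma dot_mulmx_le m n (A : 'M[R]_(m, n)) (x : 'cV[R]_n) :
  dot (A *m x) (A *m x) <= (\sum_i \sum_j A i j ^+ 2) * dot x x.
Proof.
rewrite {1}/dot mulr_suml; apply: ler_sum => i _.
rewrite -expr2 mxE; apply: (le_trans (sum_cauchy_schwarz _ _)).
rewrite (_ : \sum_j x j 0 ^+ 2 = dot x x) //.
Qed.

End dot_product.

Section qbar.
Context {R : realType} (m n : nat).
Variables (B : 'M[R]_(m, n)) (rho : R).
Hypothesis rho0 : 0 < rho.
Implicit Types V x : 'cV[R]_n.

Definition qbar V : 'M[R]_n := rho *: (B^T *m B) + invmx (diag_mx V^T).

Definition pos_vec V := forall i, 0 < V i 0.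

Lemma invmx_diag V : pos_vec V -> invmx (diag_mx V^T) = diag_mx (\row_i (V i 0)^-1).
Proof.
move=> V0; have e : diag_mx V^T *m diag_mx (\row_i (V i 0)^-1) = 1%:M.
  rewrite mulmx_diag; apply/matrixP => i j; rewrite !mxE.
  by case: eqP => // ->; rewrite mulfV ?gt_eqF.
have u : diag_mx V^T \in unitmx by case: (mulmx1_unit e).
by rewrite -[RHS]mul1mx -(mulVmx u) -mulmxA e mulmx1.
Qed.

Lemma qbar_mulE V x : pos_vec V ->
  qbar V *m x = rho *: (B^T *m (B *m x)) + \col_i (x i 0 / V i 0).
Proof.
move=> V0; rewrite /qbar mulmxDl -scalemxAl -mulmxA invmx_diag//; congr (_ + _).
by apply/colP => i; rewrite mul_diag_mx !mxE mulrC.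
Qed.

Lemma qf_qbar V x : pos_vec V ->
  qf (qbar V) x = rho * dot (B *m x) (B *m x) + \sum_i x i 0 ^+ 2 / V i 0.
Proof.
move=> V0; rewrite /qf -mulmxA -dotE qbar_mulE// dotDr dotZr; congr (_ + _).
  by congr (_ * _); rewrite [RHS]dot_mulmx dotC.
by apply: eq_bigr => i _; rewrite mxE expr2 mulrA.
Qed.

Lemma qbar_posdef V : pos_vec V -> posdef (qbar V).
Proof.
move=> V0; split.
  rewrite /qbar linearD linearZ /= trmx_mul trmxK invmx_diag//; congr (_ + _).
  exact: tr_diag_mx.
move=> x x0; rewrite qf_qbar//.
have s0 : 0 <= \sum_i x i 0 ^+ 2 / V i 0.
  by apply: sumr_ge0 => i _; rewrite divr_ge0 ?sqr_ge0// ltW.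
have d0 := dot_ge0 (B *m x).
rewrite lt_neqAle addr_ge0 ?mulr_ge0 ?(ltW rho0)// andbT eq_sym.
apply: contra x0; rewrite paddr_eq0 ?mulr_ge0 ?(ltW rho0)// => /andP[_ /eqP e].
apply/eqP/colP => i; apply/eqP; rewrite mxE -sqrf_eq0.
have h : x i 0 ^+ 2 / V i 0 <= 0.
  rewrite -e (bigD1 i)//= lerDl; apply: sumr_ge0 => j _.
  by rewrite divr_ge0 ?sqr_ge0// ltW.
by rewrite eq_le sqr_ge0 andbT -(mul0r (V i 0)) -ler_pdivrMr.
Qed.

Lemma qbar_ge V x i : pos_vec V -> (V i 0)^-1 * x i 0 ^+ 2 <= qf (qbar V) x.
Proof.
move=> V0; rewrite qf_qbar// mulrC (bigD1 i)//= addrCA lerDl addr_ge0//.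
  by rewrite mulr_ge0 ?(ltW rho0)// dot_ge0.
by apply: sumr_ge0 => j _; rewrite divr_ge0 ?sqr_ge0// ltW.
Qed.

Lemma qbar_diag V i : pos_vec V -> qbar V i i = rho * (\sum_k B k i ^+ 2) + (V i 0)^-1.
Proof.
move=> V0; rewrite /qbar invmx_diag// 4!mxE eqxx mulr1n; congr (_ * _ + _).
  by apply: eq_bigr => k _; rewrite mxE expr2.
by rewrite mxE.
Qed.

(** Least squares with the coordinates outside [S] set to 0. The restricted matrix BS and its Gram
    matrix G have the same row space, so T G = BS for some T; the solution D T^T w is linear in [w],
    and [c] is the squared Frobenius norm of D T^T. *)
Lemma restricted_normal_eq (S : {set 'I_n}) : exists c : R, 0 <= c /\
  forall w : 'cV[R]_m, exists x, [/\ forall j, j \notin S -> x j 0 = 0,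
    forall j, j \in S -> (B^T *m (B *m x - w)) j 0 = 0 & dot x x <= c * dot w w].
Proof.
pose D : 'M[R]_n := diag_mx (\row_j (j \in S)%:R).
pose BS := B *m D; pose G := BS^T *m BS.
have BSk k (K : 'M[R]_(n, k)) : G *m K = 0 -> BS *m K = 0.
  move=> e; apply/matrixP => i j.
  suff : BS *m K *m delta_mx j 0 = 0 :> 'cV_m.
    by move=> /colP/(_ i); rewrite -colE !mxE.
  apply: dot_eq0; rewrite -mulmxA dot_mulmx (mulmxA BS^T) -/G (mulmxA G) e mul0mx.
  by rewrite dotE trmx0 mul0mx mxE.
have sBG : (BS <= G)%MS by rewrite submxE; apply/eqP/BSk/mulmx_coker.
pose T := BS *m pinvmx G.
have TG : T *m G = BS by exact: mulmxKpV.
have Gs : G^T = G by rewrite /G trmx_mul trmxK.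
have Ds : D^T = D by exact: tr_diag_mx.
exists (\sum_i \sum_j (D *m T^T) i j ^+ 2); split.
  by apply: sumr_ge0 => i _; apply: sumr_ge0 => j _; exact: sqr_ge0.
move=> w; exists (D *m T^T *m w); split; last exact: dot_mulmx_le.
- by move=> j jS; rewrite -mulmxA mul_diag_mx !mxE (negbTE jS) mul0r.
- move=> j jS; have : (D *m (B^T *m (B *m (D *m T^T *m w) - w))) j 0 = 0.
    rewrite !mulmxA -Ds -trmx_mul -/BS Ds.
    rewrite mulmxBr !mulmxA -(mulmxA BS^T B D) -/BS -/G -Gs -trmx_mul TG subrr mxE//.
  by rewrite mul_diag_mx !mxE jS mul1r.
Qed.

(* By induction on [S]: the coordinate with the smallest weight is bounded by
   comparing [y] with the unpenalized solution [x], then it is removed. *)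
Lemma ridge_bounded_support k (S : {set 'I_n}) : #|S| = k -> exists C : R, 0 <= C /\
  forall (w : 'cV[R]_m) (V y : 'cV[R]_n), pos_vec V -> (forall j, j \notin S -> y j 0 = 0) ->
    (forall j, j \in S -> rho * (B^T *m (B *m y - w)) j 0 + y j 0 / V j 0 = 0) ->
    dot y y <= C * dot w w.
Proof.
elim: k S => [|k IH] S cS.
  exists 0; split=> // w V y _ yS _; rewrite mul0r /dot big1// => j _.
  by rewrite yS ?mul0r//; move/eqP: cS; rewrite cards_eq0 => /eqP ->; rewrite inE.
have [c [c0 hc]] := restricted_normal_eq S.
(* Stated for every [i], with content only for [i] in [S], so that [choice] turns the constants into
   a function. *)
have CI i : exists C : R, 0 <= C /\ (i \in S -> forall (w : 'cV[R]_m) (V y : 'cV[R]_n), pos_vec V ->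
    (forall j, j \notin S :\ i -> y j 0 = 0) ->
    (forall j, j \in S :\ i -> rho * (B^T *m (B *m y - w)) j 0 + y j 0 / V j 0 = 0) ->
    dot y y <= C * dot w w).
  have [iS|] := boolP (i \in S); last by exists 0.
  have [|C [C0 hC]] := IH (S :\ i); last by exists C.
  by apply/eqP; rewrite -eqSS -cS (cardsD1 i S) iS.
have [C hC] := choice CI.
pose Be i : R := dot (B *m delta_mx i 0) (B *m delta_mx i 0 : 'cV_m).
(* The bound when [i] has the smallest weight: [C i] applied to the shifted data, plus [c] for the
   coordinate [i] itself. Which [i] occurs depends on [V], so the final constant is the sum over all
   [i]. *)
pose F i := C i * (2 + 2 * c * Be i) + c.
have C0 i : 0 <= C i by case: (hC i).
have F0 i : 0 <= F i by rewrite addr_ge0// mulr_ge0// addr_ge0// !mulr_ge0// dot_ge0.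
exists (\sum_i F i); split; first by apply: sumr_ge0 => i _.
move=> w V y V0 yS hy.
have [i0 i0S] : exists i, i \in S by apply/set0Pn; rewrite -cards_eq0 cS.
have [i iS iV] : exists2 i, i \in S & forall j, j \in S -> V i 0 <= V j 0.
  by case: (@Order.TotalTheory.arg_minP _ _ _ i0 (mem S) (fun i => V i 0) i0S) => i iS h; exists i.
have [x [xS hx xw]] := hc w.
(* The penalized solution has a smaller penalty than the unpenalized one: pair the difference of the
   two normal equations with y - x. *)
have yx : \sum_j y j 0 ^+ 2 / V j 0 <= \sum_j x j 0 ^+ 2 / V j 0.
  have h1 : rho * dot (B *m (y - x)) (B *m (y - x)) + \sum_j (y j 0 - x j 0) * (y j 0 / V j 0) = 0.
    transitivity (\sum_j (y j 0 - x j 0) * (rho * (B^T *m (B *m y - w)) j 0 + y j 0 / V j 0)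
      - \sum_j (y j 0 - x j 0) * (rho * (B^T *m (B *m x - w)) j 0)).
      have -> : dot (B *m (y - x)) (B *m (y - x)) =
        \sum_j (y j 0 - x j 0) * (B^T *m (B *m (y - x))) j 0.
        rewrite dot_mulmx dotC; apply: eq_bigr => j _; by rewrite !mxE.
      rewrite mulr_sumr -big_split -sumrB; apply: eq_bigr => j _ /=.
      have -> : B^T *m (B *m (y - x)) = B^T *m (B *m y - w) - B^T *m (B *m x - w).
        by rewrite -[RHS]mulmxBr; congr (_ *m _); rewrite mulmxBr opprB addrA subrK.
      by rewrite [X in rho * (_ * X)]mxE [X in rho * (_ * (_ + X))]mxE; ring.
    rewrite !big1 ?subrr// => j _.
      have [jS|jS] := boolP (j \in S); first by rewrite hx// !mulr0.
      by rewrite yS// xS// subrr mul0r.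
    have [jS|jS] := boolP (j \in S); first by rewrite hy// mulr0.
    by rewrite yS// xS// subrr mul0r.
  have h2 : \sum_j (y j 0 - x j 0) * (y j 0 / V j 0) <= 0.
    by have := mulr_ge0 (ltW rho0) (dot_ge0 (B *m (y - x))); lra.
  have h3 : \sum_j (2^-1 * (y j 0 ^+ 2 / V j 0) - 2^-1 * (x j 0 ^+ 2 / V j 0)) <= 
     \sum_j (y j 0 - x j 0) * (y j 0 / V j 0).
    apply: ler_sum => j _; rewrite -subr_ge0.
    rewrite (_ : _ - _ = (2 * V j 0)^-1 * (y j 0 - x j 0) ^+ 2).
      by rewrite mulr_ge0 ?sqr_ge0// invr_ge0 mulr_ge0// ltW.
    by field; rewrite gt_eqF.
  have := le_trans h3 h2; rewrite sumrB -!mulr_sumr.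
  by lra.
(* As V_i is minimal, the penalty of x is at most |x|^2 / V_i, and V_i cancels: the bound is free of
   [V]. *)
have yi : y i 0 ^+ 2 <= c * dot w w.
  apply: le_trans xw.
  have h1 : y i 0 ^+ 2 / V i 0 <= \sum_j y j 0 ^+ 2 / V j 0.
    rewrite (bigD1 i)//= lerDl; apply: sumr_ge0 => j _.
    by rewrite divr_ge0 ?sqr_ge0// ltW.
  have h2 : \sum_j x j 0 ^+ 2 / V j 0 <= dot x x / V i 0.
    rewrite mulr_suml; apply: ler_sum => j _; rewrite -expr2.
    have [jS|jS] := boolP (j \in S); last by rewrite xS// expr0n /= !mul0r.
    by rewrite ler_wpM2l ?sqr_ge0// lef_pV2 ?posrE// iV.
  by have := le_trans h1 (le_trans yx h2); rewrite ler_pM2r// invr_gt0.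
(* The known coordinate is moved into the data. The residual B y - w is unchanged, so [y'] solves
   the problem on S minus i. *)
pose y' := y - y i 0 *: delta_mx i 0.
pose w' := w - y i 0 *: (B *m delta_mx i 0).
have y'j j : j != i -> y' j 0 = y j 0.
  by move=> ji; rewrite !mxE (negbTE ji) /= mulr0 subr0.
have y'i : y' i 0 = 0 by rewrite !mxE !eqxx mulr1 subrr.
have [_ /(_ iS) hi] := hC i.
have e : B *m y' - w' = B *m y - w.
  by rewrite /y' /w' mulmxBr -scalemxAr opprB addrA subrK.
have {hi} yw' : dot y' y' <= C i * dot w' w'.
  apply: (hi w' V) => //.
  - move=> j; rewrite !inE negb_and negbK => /orP[/eqP ->//|jS].
    by rewrite y'j ?yS//; apply: contraNneq jS => ->.
  - by move=> j; rewrite !inE => /andP[ji jS]; rewrite e y'j// hy.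
have ww' : dot w' w' <= (2 + 2 * c * Be i) * dot w w.
  have := @dot_addl_le _ _ 1 w (- (y i 0 *: (B *m delta_mx i 0))) ltr01.
  rewrite -/w' dotNl dotNr opprK dotZl dotZr mulrA -expr2 -/(Be i) invr1 => h.
  have : y i 0 ^+ 2 * Be i <= c * dot w w * Be i by rewrite ler_wpM2r// dot_ge0.
  by lra.
have ey : dot y y = dot y' y' + y i 0 ^+ 2.
  rewrite /dot (bigD1 i)//= [in RHS](bigD1 i)//= y'i mul0r add0r addrC expr2; congr (_ + _).
  by apply: eq_bigr => j ji; rewrite y'j.
have : dot y y <= F i * dot w w.
  rewrite ey mulrDl; apply: lerD => //; apply: (le_trans yw').
  by rewrite -mulrA ler_wpM2l.
move=> h; apply: (le_trans h); rewrite ler_wpM2r ?dot_ge0// (bigD1 i)//= lerDl.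
by apply: sumr_ge0 => j _.
Qed.

Lemma ridge_bounded (w : 'cV[R]_m) : exists C : R, 0 <= C /\ forall V, pos_vec V ->
  dot (invmx (qbar V) *m (rho *: (B^T *m w))) (invmx (qbar V) *m (rho *: (B^T *m w))) <= C.
Proof.
have [C [C0 hC]] := @ridge_bounded_support _ [set: 'I_n] erefl.
exists (C * dot w w); split; first by rewrite mulr_ge0// dot_ge0.
move=> V V0; apply: (hC w V) => //; first by move=> j; rewrite inE.
move=> j _; set y := invmx _ *m _.
have : qbar V *m y = rho *: (B^T *m w).
  by rewrite mulmxA mulmxV ?mul1mx//; exact/posdef_unit/qbar_posdef.
rewrite qbar_mulE// => /colP/(_ j); rewrite mulmxBr !mxE => h.
by rewrite mulrBr addrAC h subrr.
Qed.

(** Pair the equation with [y] and complete the square in B y. Linear growth in [v] is of lower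
    order than the v^2 produced by the vector of ones. *)
Lemma ridge_energy (w : 'cV[R]_m) (V y : 'cV[R]_n) (v : R) : 0 <= v -> pos_vec V -> (forall i, V i 0 <= v) ->
  qbar V *m y = rho *: (B^T *m w) -> dot y y <= v * (rho * dot w w / 4).
Proof.
move=> v0 V0 Vv e.
have h : qf (qbar V) y = rho * dot (B *m y) w.
  by rewrite /qf -mulmxA -dotE e dotZr dot_mulmx trmxK.
rewrite qf_qbar// in h.
have h4 := @dot_amgm _ _ 1 (B *m y) w ltr01.
have h1 : \sum_i y i 0 ^+ 2 / V i 0 <= rho * dot w w / 4.
  have : rho * dot (B *m y) w <= rho * (1 * dot (B *m y) (B *m y) + (4 * 1)^-1 * dot w w).
    by rewrite ler_wpM2l// ltW.
  by lra.
apply: (@le_trans _ _ (v * \sum_i y i 0 ^+ 2 / V i 0)).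
  rewrite mulr_sumr; apply: ler_sum => i _; rewrite -expr2 mulrCA ler_peMr ?sqr_ge0//.
  by rewrite ler_pdivlMr// mul1r.
by rewrite ler_wpM2l.
Qed.

(** Pairing with x gives t = <x, 1> = rho |B x|^2 + sum x_i^2 / V_i, hence |x|^2 <= v t. The part (1
    - P) 1 is paired with x through B x only, and is absorbed into the share eta of rho |B x|^2.
    What remains is (1 - eta) t <= <P 1, x> + k, so |x| is at most v |P 1| / (1 - eta) to leading
    order. *)
Lemma qbar_ones_le (P : 'M[R]_n) (T : 'M[R]_(n, m)) (eta : R) :
  P^T = P -> 1%:M - P = T *m B -> 0 < eta < 1 ->
  exists C : R, 0 <= C /\ forall (V x : 'cV[R]_n) (v : R), pos_vec V -> 0 < v ->
    (forall i, V i 0 <= v) -> qbar V *m x = const_mx 1 ->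
    dot x x <= (1 - eta) ^- 2 * dot (P *m const_mx 1) (P *m const_mx 1) * v ^+ 2 + C * v.
Proof.
move=> Ps PT /andP[eta0 eta1].
set one : 'cV[R]_n := const_mx 1; set p1 := P *m one.
set c := T^T *m one.
pose C := 2 / (1 - eta) * ((4 * (eta * rho))^-1 * dot c c).
have eta1' : 0 < 1 - eta by rewrite subr_gt0.
exists C; split.
  by rewrite /C !mulr_ge0 ?invr_ge0 ?mulr_ge0 ?dot_ge0 ?(ltW rho0) ?(ltW eta0) ?(ltW eta1').
move=> V x v V0 v0 Vv e.
pose t := dot x one.
have ht : t = rho * dot (B *m x) (B *m x) + \sum_i x i 0 ^+ 2 / V i 0.
  by rewrite -qf_qbar// /qf -mulmxA -dotE e.
have tP : t = dot p1 x + dot (B *m x) c.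
  rewrite /t -[one]mul1mx -(subrK P 1%:M) mulmxDl dotDr addrC; congr (_ + _).
    by rewrite dotC.
  by rewrite /c [RHS]dot_mulmx trmxK mulmxA -PT dot_mulmx linearB /= trmx1 Ps.
have xv : dot x x <= v * t.
  apply: (@le_trans _ _ (v * \sum_i x i 0 ^+ 2 / V i 0)).
    rewrite mulr_sumr; apply: ler_sum => i _; rewrite -expr2 mulrCA ler_peMr ?sqr_ge0//.
    by rewrite ler_pdivlMr// mul1r.
  rewrite ler_wpM2l ?(ltW v0)// ht lerDr mulr_ge0 ?dot_ge0//; exact: ltW.
have h1 := @dot_amgm _ _ (eta * rho) (B *m x) c (mulr_gt0 eta0 rho0).
have sV : 0 <= \sum_i x i 0 ^+ 2 / V i 0.
  by apply: sumr_ge0 => i _; rewrite divr_ge0 ?sqr_ge0// ltW.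
set k := (4 * (eta * rho))^-1 * dot c c in C h1 *.
have h2 : (1 - eta) * t <= dot p1 x + k.
  have : eta * rho * dot (B *m x) (B *m x) <= eta * t by rewrite ht mulrDr mulrA lerDl mulr_ge0// ltW.
  by lra.
have h3 := @dot_amgm _ _ (v / (2 * (1 - eta))) p1 x.
have {}h3 : v * dot p1 x <= (2 * (1 - eta))^-1 * v ^+ 2 * dot p1 p1 + (1 - eta) / 2 * dot x x.
  have /h3 {}h3 : 0 < v / (2 * (1 - eta)) by rewrite divr_gt0// mulr_gt0.
  have : v * dot p1 x <= v * (v / (2 * (1 - eta)) * dot p1 p1 + (4 * (v / (2 * (1 - eta))))^-1 * dot x x).
    by rewrite ler_wpM2l// ltW.
  move=> {}h3; apply: (le_trans h3); rewrite le_eqVlt; apply/orP; left; apply/eqP.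
  by field; rewrite ?gt_eqF.
have h4 : (1 - eta) * dot x x <= v * (dot p1 x + k).
  apply: (@le_trans _ _ ((1 - eta) * (v * t))); first by rewrite ler_wpM2l// ltW.
  by rewrite mulrCA ler_wpM2l// ltW.
have h5 : (1 - eta) / 2 * dot x x <= (2 * (1 - eta))^-1 * v ^+ 2 * dot p1 p1 + v * k by lra.
have g0 : 0 < (1 - eta) / 2 by rewrite divr_gt0.
rewrite -(ler_pM2l g0); apply: (le_trans h5).
rewrite le_eqVlt; apply/orP; left; apply/eqP; rewrite /C.
by field; rewrite ?gt_eqF.
Qed.

Lemma qbar_mean_le (P : 'M[R]_n) (T : 'M[R]_(n, m)) (w : 'cV[R]_m) (mu e : R) :
  P^T = P -> 1%:M - P = T *m B -> 0 < e ->
  exists C : R, 0 <= C /\ forall (V y : 'cV[R]_n) (v : R), pos_vec V -> 0 < v ->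
    (forall i, V i 0 <= v) -> qbar V *m y = rho *: (B^T *m w) + mu *: const_mx 1 ->
    dot y y <= ((1 + e) * mu ^+ 2 * dot (P *m const_mx 1) (P *m const_mx 1) + e) * v ^+ 2 + C.
Proof.
move=> Ps PT e0.
(* Small enough for (1 + d) / (1 - d)^2 <= 1 + e. *)
pose d := e / (4 + 4 * e).
have d0 : 0 < d by rewrite divr_gt0//; lra.
have de : d * (4 + 4 * e) = e by rewrite mulfVK// gt_eqF//; lra.
have d4 : d < 4^-1 by nra.
have dlt : (1 + d) * (1 - d) ^- 2 <= 1 + e.
  rewrite ler_pdivrMr; last by rewrite exprn_gt0//; lra.
  by nra.
have [|C [C0 hC]] := @qbar_ones_le P T d Ps PT; first by rewrite d0 /=; lra.
set N := dot _ _ in hC *.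
have N0 : 0 <= N by exact: dot_ge0.
pose C1 := (1 + d) * mu ^+ 2 * C + (1 + d^-1) * (rho * dot w w / 4).
have C10 : 0 <= C1.
  have i0 : 0 <= d^-1 by rewrite invr_ge0 ltW.
  apply: addr_ge0; apply: mulr_ge0 => //.
  - by rewrite mulr_ge0 ?sqr_ge0//; lra.
  - by lra.
  - by rewrite mulr_ge0// mulr_ge0 ?dot_ge0// ltW.
exists ((4 * e)^-1 * C1 ^+ 2); split; first by rewrite mulr_ge0 ?sqr_ge0// invr_ge0; lra.
move=> V y0 v V0 v0 Vv e0'.
have uQ := posdef_unit (qbar_posdef V0).
have -> : y0 = mu *: (invmx (qbar V) *m const_mx 1) + invmx (qbar V) *m (rho *: (B^T *m w)).
  by rewrite scalemxAr -mulmxDr addrC -e0' mulKmx.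
set x := invmx _ *m const_mx 1; set y := invmx _ *m _.
have hx : dot x x <= (1 - d) ^- 2 * N * v ^+ 2 + C * v by apply: (hC V) => //; rewrite mulKVmx.
have hy : dot y y <= v * (rho * dot w w / 4).
  by apply: (ridge_energy (ltW v0) V0) => //; rewrite mulKVmx.
apply: (le_trans (dot_addl_le (mu *: x) y d0)).
have -> : dot (mu *: x) (mu *: x) = mu ^+ 2 * dot x x by rewrite dotZl dotZr mulrA.
have a1 : (1 + d) * (mu ^+ 2 * dot x x) <= (1 + d) * (mu ^+ 2 * ((1 - d) ^- 2 * N * v ^+ 2 + C * v)).
  by rewrite ler_wpM2l ?ler_wpM2l ?sqr_ge0//; lra.
have a2 : (1 + d^-1) * dot y y <= (1 + d^-1) * (v * (rho * dot w w / 4)).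
  by rewrite ler_wpM2l// addr_ge0// invr_ge0 ltW.
have a3 : (1 + d) * (1 - d) ^- 2 * (mu ^+ 2 * N * v ^+ 2) <= (1 + e) * (mu ^+ 2 * N * v ^+ 2).
  exact: (ler_wpM2r (mulr_ge0 (mulr_ge0 (sqr_ge0 _) N0) (sqr_ge0 _))).
(* The terms linear in v are charged to the spare e v^2. *)
have a4 : C1 * v <= e * v ^+ 2 + (4 * e)^-1 * C1 ^+ 2.
  rewrite -subr_ge0 (_ : _ - _ = e * (v - C1 / (2 * e)) ^+ 2); first by rewrite mulr_ge0 ?sqr_ge0// ltW.
  by field; rewrite gt_eqF.
have a5 : C1 * v = (1 + d) * (mu ^+ 2 * (C * v)) + (1 + d^-1) * (v * (rho * dot w w / 4)).
  by rewrite /C1; ring.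
set D := (1 - d) ^- 2 in a1 a3.
move: a1 a2 a3 a4 a5.
set I := d^-1. set J := (4 * e)^-1 * _. set K1 := rho * _ / 4. nra.
Qed.

End qbar.

(** * The projection behind null smallness *)

Section null_projection.
Context {R : realType} (m n : nat).

(** [P] is the orthogonal projection onto K Null(A), the null space of A K^-1. With W = K U it is W
    G^-1 W^T, so z^T G^-1 z = |P 1|^2 and the last bound is the square of null smallness. If Null(A)
    = 0, then P = 0. *)
Lemma null_smallness_proj (A : 'M[R]_(m, n)) (K : 'M[R]_n) (mu sigma a : R) :
  K \in unitmx -> null_smallness A K mu sigma a -> 0 < sigma ^+ 2 * a + mu ^+ 2 ->
  exists (P : 'M[R]_n) (T : 'M[R]_(n, m)), [/\ P^T = P, 1%:M - P = T *m (A *m invmx K) &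
    mu ^+ 2 / (sigma ^+ 2 * a + mu ^+ 2) * dot (P *m const_mx 1) (P *m const_mx 1) < 1].
Proof.
move=> uK ns s0; set B := A *m invmx K.
(* A matrix that vanishes on the null space of [B] factors through [B]. *)
have fact (P : 'M[R]_n) : (1%:M - P) *m cokermx B = 0 -> exists T : 'M[R]_(n, m), 1%:M - P = T *m B.
  move=> /eqP; rewrite -submxE => h; exists ((1%:M - P) *m pinvmx B).
  by rewrite mulmxKpV.
have kA : ((invmx K *m cokermx B)^T <= kermx A^T)%MS.
  by apply/sub_kermxP; rewrite -trmx_mul mulmxA -/B mulmx_coker trmx0.
case: ns => [r0|[U [UU eU] small]].
  have [|T hT] := fact 0.
    rewrite subr0 mul1mx; have := mxrankS kA; rewrite r0 leqn0 mxrank_eq0 => /eqP/(congr1 trmx).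
    by rewrite trmxK trmx0 => e; rewrite -[LHS](mulKVmx uK) e mulmx0.
  exists 0, T; split => //; first exact: trmx0.
  by rewrite mul0mx dotE mulmx0 mxE mulr0.
set one : 'cV[R]_n := const_mx 1 in small *.
move: small => /=; set G := U^T *m _ *m _ *m _; set z := U^T *m _ *m _ => small.
pose W := K *m U.
have GE : G = W^T *m W by rewrite /G /W trmx_mul !mulmxA.
have pG : posdef G.
  split; first by rewrite GE trmx_mul trmxK.
  move=> x x0.
  have -> : qf G x = dot (W *m x) (W *m x) by rewrite /qf GE dotE (trmx_mul W x) !mulmxA.
  rewrite lt_neqAle dot_ge0 andbT eq_sym.
  apply: contra x0 => /eqP/dot_eq0 e.
  by rewrite -[x]mul1mx -UU -mulmxA -[U *m x](mulKmx uK) [K *m _]mulmxA -/W e !mulmx0.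
have uG := posdef_unit pG; have [Gs _] := pG.
have zE : z = W^T *m one by rewrite /z /W trmx_mul.
pose P := W *m invmx G *m W^T.
have Ps : P^T = P by rewrite /P (trmx_mul (W *m invmx G)) (trmx_mul W) trmxK trmx_inv Gs mulmxA.
have PW : P *m W = W by rewrite /P -!mulmxA -GE mulVmx// mulmx1.
have PP : P *m P = P.
  transitivity (P *m W *m (invmx G *m W^T)); first by rewrite /P !mulmxA.
  by rewrite PW mulmxA.
have [|T hT] := fact P.
  have /submxP[c ec] : ((invmx K *m cokermx B)^T <= U^T)%MS.
    by rewrite (submx_trans kA)//; case/andP: eU.
  have -> : cokermx B = W *m c^T.
    by rewrite /W -mulmxA -[U *m _]trmxK trmx_mul trmxK -ec trmxK mulKVmx.
  by rewrite mulmxA mulmxBl mul1mx PW subrr mul0mx.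
exists P, T; split => //.
have -> : dot (P *m one) (P *m one) = (z^T *m invmx G *m z) 0 0.
  rewrite -{1}Ps -dot_mulmx mulmxA PP dotE zE trmx_mul trmxK /P.
  by rewrite !mulmxA.
set N := _ 0 0 in small *.
have N0 : 0 <= N by exact: (posdef_ge0 _ (posdef_inv pG)).
rewrite (_ : _ * _ = (`|mu| / Num.sqrt (sigma ^+ 2 * a + mu ^+ 2) * Num.sqrt N) ^+ 2); last first.
  by rewrite !exprMn exprVn !sqr_sqrtr// ?real_normK ?num_real// ltW.
by rewrite expr_lt1// mulr_ge0 ?sqrtr_ge0// divr_ge0// sqrtr_ge0.
Qed.

End null_projection.

(** * Two-block Gibbs samplers *)

Section density_measure.
Local Open Scope ereal_scope.
Context d (T : measurableType d) (R : realType) (mu : {measure set T -> \bar R}).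
Variable f : T -> R.

(** The proofs are arguments so that the measure structure can be attached to this very term. *)
Definition density (mf : measurable_fun setT f) (f0 : forall x, (0 <= f x)%R) (A : set T) : \bar R :=
  \int[mu]_(x in A) (f x)%:E.

Hypotheses (mf : measurable_fun setT f) (f0 : forall x, (0 <= f x)%R).

Let density0 : density mf f0 set0 = 0.
Proof. by rewrite /density integral_set0. Qed.

Let density_ge0 A : 0 <= density mf f0 A.
Proof. by apply: integral_ge0 => u _; rewrite lee_fin. Qed.

Let density_sigma_additive : semi_sigma_additive (density mf f0).
Proof.
move=> F mF tF mUF; rewrite /density ge0_integral_bigcup//.
- by apply: is_cvg_ereal_nneg_natsum_cond => n _ _; exact: density_ge0.
- by apply/measurable_EFinP; exact: measurable_funTS.
- by move=> x _; rewrite lee_fin.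
Qed.

HB.instance Definition _ := isMeasure.Build _ _ _ (density mf f0)
  density0 density_ge0 density_sigma_additive.

Lemma integral_density (g : T -> \bar R) : measurable_fun setT g -> (forall x, 0 <= g x) ->
  \int[density mf f0]_x g x = \int[mu]_x (g x * (f x)%:E).
Proof.
move=> mg g0; apply: (@ge0_integral_weighted_pushforward _ _ T T R id f mu (density mf f0)) => //.
Qed.

End density_measure.

Section two_block_gibbs.
Local Open Scope ereal_scope.
Context d (T : measurableType d) (R : realType) (l : {sigma_finite_measure set T -> \bar R}).
Variables (k1 k2 J : T -> T -> R) (D E : set T).
Hypotheses (mD : measurable D) (mE : measurable E) (lE : l (~` E) = 0) (lD : 0 < l D).
Hypotheses (mk1 : measurable_fun setT (fun u : T * T => k1 u.1 u.2))
  (mk2 : measurable_fun setT (fun u : T * T => k2 u.1 u.2))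
  (mJ : measurable_fun setT (fun u : T * T => J u.1 u.2)).
Hypotheses (k10 : forall V M, (0 <= k1 V M)%R) (k20 : forall M W, (0 <= k2 M W)%R)
  (J0 : forall M V, (0 <= J M V)%R).
Hypotheses (k1_1 : forall V, D V -> \int[l]_M (k1 V M)%:E = 1)
  (k2_1 : forall M, E M -> \int[l]_W (k2 M W)%:E = 1)
  (k2_0 : forall M W, ~ D W -> k2 M W = 0%R).
(** [J] is the joint density, [k1] and [k2] its conditionals, and [c] and [e] the corresponding
    marginals. *)
Variables c e : T -> R.
Hypotheses (c0 : forall V, D V -> (0 < c V)%R) (e0 : forall M, (0 <= e M)%R)
  (J1 : forall M V, D V -> J M V = (c V * k1 V M)%R) (JN : forall M V, ~ D V -> J M V = 0%R)
  (J2 : forall M V, E M -> J M V = (e M * k2 M V)%R)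
  (Joo : \int[l]_V \int[l]_M (J M V)%:E < +oo).

Definition two_block (f : T -> \bar R) (V : T) : \bar R :=
  \int[l]_M ((k1 V M)%:E * \int[l]_W ((k2 M W)%:E * f W)).

Lemma measurable_section1 (g : T * T -> \bar R) x : measurable_fun setT g ->
  measurable_fun setT (fun y => g (x, y)).
Proof. by move=> mg; exact: (measurableT_comp mg (pair1_measurable x)). Qed.

Lemma measurable_section2 (g : T * T -> \bar R) y : measurable_fun setT g ->
  measurable_fun setT (fun x => g (x, y)).
Proof. by move=> mg; exact: (measurableT_comp mg (pair2_measurable y)). Qed.

Lemma measurable_integral (g : T -> T -> \bar R) :
  measurable_fun setT (fun u : T * T => g u.1 u.2) -> (forall x y, 0 <= g x y) ->
  measurable_fun setT (fun x => \int[l]_y g x y).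
Proof.
move=> mg g0.
by apply: (@measurable_fun_fubini_tonelli_F _ _ _ _ _ l (fun u => g u.1 u.2)) => // u.
Qed.

Lemma integral_swap (g : T -> T -> \bar R) :
  measurable_fun setT (fun u : T * T => g u.1 u.2) -> (forall x y, 0 <= g x y) ->
  \int[l]_x \int[l]_y g x y = \int[l]_y \int[l]_x g x y.
Proof.
move=> mg g0; apply: (@fubini_tonelli _ _ _ _ _ l l (fun u => g u.1 u.2)) => // u.
Qed.

Lemma measurable_k1 V : measurable_fun setT (k1 V).
Proof. by apply/measurable_EFinP/(@measurable_section1 (fun u => (k1 u.1 u.2)%:E))/measurable_EFinP. Qed.

Lemma measurable_k2 M : measurable_fun setT (k2 M).
Proof. by apply/measurable_EFinP/(@measurable_section1 (fun u => (k2 u.1 u.2)%:E))/measurable_EFinP. Qed.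

Definition inner (f : T -> \bar R) M := \int[l]_W ((k2 M W)%:E * f W).

Lemma measurable_k2f_prod f : measurable_fun setT f ->
  measurable_fun setT (fun u : T * T => (k2 u.1 u.2)%:E * f u.2).
Proof.
move=> mf; apply: emeasurable_funM; first exact/measurable_EFinP.
exact: (measurableT_comp mf measurable_snd).
Qed.

Lemma inner_ge0 f M : (forall x, 0 <= f x) -> 0 <= inner f M.
Proof. by move=> f0; apply: integral_ge0 => W _; rewrite mule_ge0// lee_fin. Qed.

Lemma measurable_inner f : measurable_fun setT f -> (forall x, 0 <= f x) ->
  measurable_fun setT (inner f).
Proof.
move=> mf f0; apply: (@measurable_integral (fun M W => (k2 M W)%:E * f W)).
  exact: measurable_k2f_prod.
by move=> M W; rewrite mule_ge0// lee_fin.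
Qed.

Lemma measurable_k2f f M : measurable_fun setT f -> measurable_fun setT (fun W => (k2 M W)%:E * f W).
Proof. by move=> mf; apply: emeasurable_funM => //; apply/measurable_EFinP; exact: measurable_k2. Qed.

Lemma measurable_k1f_prod g : measurable_fun setT g ->
  measurable_fun setT (fun u : T * T => (k1 u.1 u.2)%:E * g u.2).
Proof.
move=> mf; apply: emeasurable_funM; first exact/measurable_EFinP.
exact: (measurableT_comp mf measurable_snd).
Qed.

Lemma measurable_k1f g V : measurable_fun setT g -> measurable_fun setT (fun M => (k1 V M)%:E * g M).
Proof. by move=> mf; apply: emeasurable_funM => //; apply/measurable_EFinP; exact: measurable_k1. Qed.

Lemma mule_ge0_k1 g V M : (forall x, 0 <= g x) -> 0 <= (k1 V M)%:E * g M.
Proof. by move=> g0; rewrite mule_ge0// lee_fin. Qed.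

Lemma mule_ge0_k2 g M W : (forall x, 0 <= g x) -> 0 <= (k2 M W)%:E * g W.
Proof. by move=> g0; rewrite mule_ge0// lee_fin. Qed.

Lemma ge0_eq_integral_conull (f g : T -> \bar R) : measurable_fun setT f -> measurable_fun setT g ->
  (forall x, 0 <= f x) -> (forall x, 0 <= g x) -> (forall x, E x -> f x = g x) ->
  \int[l]_x f x = \int[l]_x g x.
Proof.
move=> mf mg f0 g0 fg; apply: ge0_ae_eq_integral => //.
exists (~` E); split => //; first exact: measurableC.
by move=> x /= h Ex; apply: h => _; exact: fg.
Qed.

Lemma ge0_le_integral_conull (f g : T -> \bar R) : measurable_fun setT f -> measurable_fun setT g ->
  (forall x, 0 <= f x) -> (forall x, 0 <= g x) -> (forall x, E x -> f x <= g x) ->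
  \int[l]_x f x <= \int[l]_x g x.
Proof.
move=> mf mg f0 g0 fg; apply: ae_ge0_le_integral => //.
exists (~` E); split => //; first exact: measurableC.
by move=> x /= h Ex; apply: h => _; exact: fg.
Qed.

Lemma two_block_markov : markov_on D two_block.
Proof.
split.
- move=> f mf f0; apply: (@measurable_integral (fun V M => (k1 V M)%:E * inner f M)).
    by apply: measurable_k1f_prod; exact: measurable_inner.
  by move=> V M; apply: (@mule_ge0_k1 (inner f)) => x; exact: inner_ge0.
- move=> f V f0; apply: integral_ge0 => M _; apply: (@mule_ge0_k1 (inner f)) => x; exact: inner_ge0.
- move=> f g V mf mg f0 g0 DV; rewrite /two_block.
  rewrite -ge0_integralD//; last 4 first.
  + by move=> M _; apply: (@mule_ge0_k1 (inner f)) => x; exact: inner_ge0.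
  + by apply: measurable_k1f; exact: measurable_inner.
  + by move=> M _; apply: (@mule_ge0_k1 (inner g)) => x; exact: inner_ge0.
  + by apply: measurable_k1f; exact: measurable_inner.
  apply: eq_integral => M _; rewrite -ge0_muleDr; [|exact: inner_ge0|exact: inner_ge0].
  congr (_ * _); rewrite -ge0_integralD//; last 4 first.
  + by move=> W _; exact: mule_ge0_k2.
  + exact: measurable_k2f.
  + by move=> W _; exact: mule_ge0_k2.
  + exact: measurable_k2f.
  by apply: eq_integral => W _; rewrite ge0_muleDr.
- move=> k f V kk0 mf f0 DV; rewrite /two_block -ge0_integralZl//; last 2 first.
  + by apply: measurable_k1f; exact: measurable_inner.
  + by move=> M _; apply: (@mule_ge0_k1 (inner f)) => x; exact: inner_ge0.
  apply: eq_integral => M _; rewrite muleCA; congr (_ * _).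
  rewrite -ge0_integralZl//; last 2 first.
  + exact: measurable_k2f.
  + by move=> W _; exact: mule_ge0_k2.
  by apply: eq_integral => W _; rewrite muleCA.
- move=> f g V mf mg f0 g0 fg DV; apply: ge0_le_integral => //.
  + by move=> M _; apply: (@mule_ge0_k1 (inner f)) => x; exact: inner_ge0.
  + by apply: measurable_k1f; exact: measurable_inner.
  + by apply: measurable_k1f; exact: measurable_inner.
  move=> M _; apply: lee_wpmul2l; first by rewrite lee_fin.
  apply: ge0_le_integral => //.
  + by move=> W _; exact: mule_ge0_k2.
  + exact: measurable_k2f.
  + exact: measurable_k2f.
  move=> W _; have [DW|DW] := pselect (D W).
    by apply: lee_wpmul2l; [rewrite lee_fin|exact: fg].
  by rewrite k2_0// !mul0e.
- move=> V DV; rewrite -[RHS](k1_1 DV); apply: ge0_eq_integral_conull.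
  + by apply: measurable_k1f; apply: (@measurable_inner (fun=> 1)).
  + by apply/measurable_EFinP; exact: measurable_k1.
  + by move=> M; apply: (@mule_ge0_k1 (inner (fun=> 1))) => x; exact: inner_ge0.
  + by move=> M; rewrite lee_fin.
  move=> M EM; rewrite (_ : \int[l]_W _ = 1) ?mule1// -[RHS](k2_1 EM).
  by apply: eq_integral => W _; rewrite mule1.
Qed.

(** A real-valued integral, of the same form as in [posterior_pdf], so that [posterior] has the
    required density by definition. *)
Definition unnorm_pdf V : R := (\int[l]_M J M V)%R.

Let mJE : measurable_fun setT (fun u : T * T => (J u.2 u.1)%:E).
Proof. by apply/measurable_EFinP; exact: (measurableT_comp mJ (@measurable_swap _ _ T T)). Qed.

Lemma integral_J V : \int[l]_M (J M V)%:E = (unnorm_pdf V)%:E.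
Proof.
suff h : \int[l]_M (J M V)%:E \is a fin_num by rewrite /unnorm_pdf /Rintegral fineK.
have [DV|DV] := pselect (D V).
  under eq_integral do rewrite J1//.
  by rewrite ge0_integralZ_EFin ?k1_1 ?mule1// ?ltW ?c0//; exact: measurable_k1.
by rewrite integral0_eq// => M _; rewrite JN.
Qed.

Lemma unnorm_pdfE V : D V -> unnorm_pdf V = c V.
Proof.
move=> DV; apply/eqP; rewrite -eqe -integral_J.
under eq_integral do rewrite J1//.
by rewrite ge0_integralZ_EFin ?k1_1 ?mule1// ?ltW ?c0//; exact: measurable_k1.
Qed.

Lemma unnorm_pdf0 V : ~ D V -> unnorm_pdf V = 0%R.
Proof.
move=> DV; apply/eqP; rewrite -eqe -integral_J.
by rewrite integral0_eq// => M _; rewrite JN.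
Qed.

Lemma unnorm_pdf_ge0 V : (0 <= unnorm_pdf V)%R.
Proof. by rewrite -lee_fin -integral_J integral_ge0// => M _; rewrite lee_fin. Qed.

Lemma measurable_unnorm_pdf : measurable_fun setT unnorm_pdf.
Proof.
apply/measurable_EFinP; rewrite (_ : EFin \o unnorm_pdf = fun V => \int[l]_M (J M V)%:E).
  by apply: (@measurable_integral (fun V M => (J M V)%:E)) => // x y; rewrite lee_fin.
by apply/funext => V; rewrite integral_J.
Qed.

Definition post_mass : R := (\int[l]_V unnorm_pdf V)%R.

Lemma integral_unnorm_pdf : \int[l]_V (unnorm_pdf V)%:E = post_mass%:E.
Proof.
rewrite /post_mass /Rintegral fineK//; rewrite ge0_fin_numE.
  by under eq_integral do rewrite -integral_J.
by apply: integral_ge0 => V _; rewrite lee_fin unnorm_pdf_ge0.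
Qed.

Lemma post_mass_gt0 : (0 < post_mass)%R.
Proof.
rewrite -lte_fin -integral_unnorm_pdf.
apply: (@lt_le_trans _ _ (\int[l]_(V in D) (unnorm_pdf V)%:E)).
  apply: integral_gt0 => //; first by apply/measurable_EFinP; apply: measurable_funTS; exact: measurable_unnorm_pdf.
  by move=> V DV; rewrite unnorm_pdfE// lte_fin c0.
apply: ge0_subset_integral => //; first by apply/measurable_EFinP; exact: measurable_unnorm_pdf.
by move=> V _; rewrite lee_fin unnorm_pdf_ge0.
Qed.

Definition post_pdf V : R := (unnorm_pdf V / post_mass)%R.

Lemma measurable_post_pdf : measurable_fun setT post_pdf.
Proof. by apply: measurable_funM => //; exact: measurable_unnorm_pdf. Qed.

Lemma post_pdf_ge0 V : (0 <= post_pdf V)%R.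
Proof. by rewrite divr_ge0 ?unnorm_pdf_ge0// ltW// post_mass_gt0. Qed.

Definition post_measure : set T -> \bar R := density l measurable_post_pdf post_pdf_ge0.

HB.instance Definition _ := Measure.copy post_measure (density l measurable_post_pdf post_pdf_ge0).

Let post_setT : post_measure setT = 1.
Proof.
rewrite /post_measure /density; under eq_integral do rewrite /post_pdf mulrC.
rewrite ge0_integralZ_EFin ?integral_unnorm_pdf; [|by rewrite invr_ge0 ltW// post_mass_gt0|exact: measurable_unnorm_pdf|exact: unnorm_pdf_ge0].
by rewrite -EFinM mulVf// gt_eqF// post_mass_gt0.
Qed.

HB.instance Definition _ := Measure_isProbability.Build _ _ _ post_measure post_setT.

Definition posterior : probability T R := post_measure.

Lemma posterior_support : posterior (~` D) = 0.
Proof.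
rewrite /posterior /= /post_measure /density; apply: integral0_eq => V DV.
by rewrite /post_pdf unnorm_pdf0// mul0r.
Qed.

Lemma integral_posterior f : measurable_fun setT f -> (forall x, 0 <= f x) ->
  \int[posterior]_x f x = post_mass^-1%:E * \int[l]_V (f V * (unnorm_pdf V)%:E).
Proof.
move=> mf f0; have Z0 := post_mass_gt0.
transitivity (\int[l]_V (f V * (post_pdf V)%:E)).
  exact: (integral_density l measurable_post_pdf post_pdf_ge0).
rewrite -ge0_integralZl//; last 3 first.
- by apply: emeasurable_funM => //; apply/measurable_EFinP; exact: measurable_unnorm_pdf.
- by move=> V _; rewrite mule_ge0// lee_fin unnorm_pdf_ge0.
- by rewrite lee_fin invr_ge0 ltW.
by apply: eq_integral => V _; rewrite /post_pdf mulrC EFinM muleCA.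
Qed.

(** The marginal of V times [k1] is [J], and [J] is also the marginal of M times [k2]: integrating
    in V first turns the sampled V~ into the V of the joint law. Tonelli's theorem is used once in
    each direction. *)
Lemma two_block_stationary f : measurable_fun setT f -> (forall x, 0 <= f x) ->
  \int[posterior]_V two_block f V = \int[posterior]_V f V.
Proof.
move=> mf f0; have mi := measurable_inner mf f0.
have i0 M : 0 <= inner f M by exact: inner_ge0.
rewrite !integral_posterior//; last 2 first.
- exact: (markov_meas two_block_markov).
- by move=> V; exact: (markov_ge0 two_block_markov).
congr (_ * _).
have mJ' : measurable_fun setT (fun u : T * T => (J u.1 u.2)%:E) by exact/measurable_EFinP.
transitivity (\int[l]_V \int[l]_M ((J M V)%:E * inner f M)).
  apply: eq_integral => V _; rewrite muleC -ge0_integralZl//; last 3 first.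
  - exact: measurable_k1f.
  - by move=> M _; exact: (@mule_ge0_k1 (inner f)).
  - by rewrite lee_fin unnorm_pdf_ge0.
  apply: eq_integral => M _; rewrite muleA -EFinM; congr (_%:E * _).
  have [DV|DV] := pselect (D V); first by rewrite unnorm_pdfE// J1.
  by rewrite unnorm_pdf0// mul0r JN.
rewrite (@integral_swap (fun V M => (J M V)%:E * inner f M)); last 2 first.
- by apply: emeasurable_funM => //; exact: (measurableT_comp mi measurable_snd).
- by move=> V M; rewrite mule_ge0// lee_fin.
transitivity (\int[l]_M \int[l]_W ((J M W)%:E * f W)).
  have mJM M : measurable_fun setT (fun V => (J M V)%:E).
    exact: (@measurable_section1 (fun u => (J u.1 u.2)%:E)).
  have mL : measurable_fun setT (fun M => \int[l]_V ((J M V)%:E * inner f M)).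
    apply: (@measurable_integral (fun M V => (J M V)%:E * inner f M)).
      by apply: emeasurable_funM => //; exact: (measurableT_comp mi measurable_fst).
    by move=> M V; rewrite mule_ge0// lee_fin.
  have mRR : measurable_fun setT (fun M => \int[l]_W ((J M W)%:E * f W)).
    apply: (@measurable_integral (fun M W => (J M W)%:E * f W)).
      by apply: emeasurable_funM => //; exact: (measurableT_comp mf measurable_snd).
    by move=> M V; rewrite mule_ge0// lee_fin.
  apply: ge0_eq_integral_conull => //.
  - by move=> M; apply: integral_ge0 => V _; rewrite mule_ge0// lee_fin.
  - by move=> M; apply: integral_ge0 => V _; rewrite mule_ge0// lee_fin.
  move=> M EM; rewrite ge0_integralZr//; last by move=> V _; rewrite lee_fin.
  under eq_integral do rewrite J2//.
  rewrite ge0_integralZ_EFin ?k2_1 ?mule1//; last exact: measurable_k2.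
  rewrite -ge0_integralZl//; last 3 first.
  - exact: measurable_k2f.
  - by move=> W _; exact: mule_ge0_k2.
  - by rewrite lee_fin.
  by apply: eq_integral => W _; rewrite J2// EFinM muleA.
rewrite (@integral_swap (fun M W => (J M W)%:E * f W)); last 2 first.
- by apply: emeasurable_funM => //; exact: (measurableT_comp mf measurable_snd).
- by move=> V M; rewrite mule_ge0// lee_fin.
apply: eq_integral => W _; rewrite ge0_integralZr//; last 2 first.
- exact: (@measurable_section2 (fun u => (J u.1 u.2)%:E)).
- by move=> M _; rewrite lee_fin.
by rewrite integral_J muleC.
Qed.

(** The drift condition cut at the intermediate variable: [F] bounds the mean of L(V~) given M. The
    factorization is kept because the minorization is proved on the sublevel sets of [F]. *)
Definition drift_pair (L F : T -> R) (lam K : R) :=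
  [/\ measurable_fun setT L, (forall x, 0 <= L x)%R, measurable_fun setT F, (forall x, 0 <= F x)%R &
   (forall M, E M -> \int[l]_W ((k2 M W)%:E * (L W)%:E) <= (F M)%:E) /\
   (forall V, D V -> \int[l]_M ((k1 V M)%:E * (F M)%:E) <= (lam * L V + K)%:E)].

Lemma drift_pairD L1 F1 lam1 K1 L2 F2 lam2 K2 :
  drift_pair L1 F1 lam1 K1 -> drift_pair L2 F2 lam2 K2 ->
  drift_pair (fun x => L1 x + L2 x)%R (fun x => F1 x + F2 x)%R (Num.max lam1 lam2) (K1 + K2).
Proof.
move=> [mL1 L10 mF1 F10 [a1 b1]] [mL2 L20 mF2 F20 [a2 b2]]; split.
- exact: measurable_funD.
- by move=> x; rewrite addr_ge0.
- exact: measurable_funD.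
- by move=> x; rewrite addr_ge0.
split.
- move=> M EM; under eq_integral do rewrite EFinD ge0_muleDr ?lee_fin//.
  rewrite ge0_integralD//.
  + by rewrite EFinD leeD ?a1 ?a2.
  + by move=> W _; rewrite -EFinM lee_fin mulr_ge0.
  + by apply: measurable_k2f; exact/measurable_EFinP.
  + by move=> W _; rewrite -EFinM lee_fin mulr_ge0.
  + by apply: measurable_k2f; exact/measurable_EFinP.
- move=> V DV; under eq_integral do rewrite EFinD ge0_muleDr ?lee_fin//.
  rewrite ge0_integralD//.
  + apply: (@le_trans _ _ ((lam1 * L1 V + K1)%:E + (lam2 * L2 V + K2)%:E)).
      by rewrite leeD ?b1 ?b2.
    rewrite -EFinD lee_fin mulrDr.
    have h1 : (lam1 * L1 V <= Num.max lam1 lam2 * L1 V)%R by rewrite ler_wpM2r// le_max lexx.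
    have h2 : (lam2 * L2 V <= Num.max lam1 lam2 * L2 V)%R by rewrite ler_wpM2r// le_max lexx orbT.
    by move: h1 h2; lra.
  + by move=> W _; rewrite -EFinM lee_fin mulr_ge0.
  + by apply: measurable_k1f; exact/measurable_EFinP.
  + by move=> W _; rewrite -EFinM lee_fin mulr_ge0.
  + by apply: measurable_k1f; exact/measurable_EFinP.
Qed.

(* By Markov's inequality [F M <= 2 C] with probability at least 1/2, and on that
   event the law of V~ dominates the measure of density [g]. *)
Lemma two_block_minorization L F lam K (r : R) : (0 <= lam)%R -> drift_pair L F lam K ->
  (forall r : R, exists g : T -> R, exists G : R, [/\ measurable_fun setT g, (forall x, 0 <= g x)%R,
    (0 < G)%R /\ \int[l]_W (g W)%:E = G%:E, (forall W, ~ D W -> g W = 0%R) &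
    forall M W, E M -> (F M <= r)%R -> (g W <= k2 M W)%R]) ->
  exists al : R, (0 < al <= 1)%R /\ exists N : (T -> \bar R) -> \bar R,
  (forall g1 g2 (c : R), measurable_fun setT g1 -> measurable_fun setT g2 ->
    (forall z, 0 <= g1 z) -> (forall z, 0 <= g2 z) -> (0 <= c)%R ->
    (forall z, D z -> c%:E <= g1 z + g2 z) -> 0 <= N g1 /\ 0 <= N g2 /\ c%:E <= N g1 + N g2) /\
  (forall g V, measurable_fun setT g -> (forall z, 0 <= g z) -> D V -> (L V <= r)%R ->
    al%:E * N g <= two_block g V).
Proof.
move=> lam0 [mL L0 mF F0 [a b]] H.
pose C := (1 + `|lam * r + K|)%R.
have C0 : (0 < C)%R by rewrite /C ltr_pwDl.
have C2 : (0 < 2 * C)%R by rewrite mulr_gt0.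
have [g [G [mg g0 [G0 ig] gD gk]]] := H (2 * C)%R.
pose I f := \int[l]_W ((g W)%:E * f W).
have I0 f : (forall x, 0 <= f x) -> 0 <= I f.
  by move=> f0; apply: integral_ge0 => W _; rewrite mule_ge0// lee_fin.
have mgf f : measurable_fun setT f -> measurable_fun setT (fun W => (g W)%:E * f W).
  by move=> mf; apply: emeasurable_funM => //; exact/measurable_EFinP.
have gf0 f W : (forall x, 0 <= f x) -> 0 <= (g W)%:E * f W.
  by move=> f0; rewrite mule_ge0// lee_fin.
have GV0 : (0 <= G^-1)%R by rewrite invr_ge0 ltW.
(* The factor 1/2 is the probability of the event on M and G the total mass of [g]; [N] below is
   integration against g / G. *)
exists (Num.min 1 (G / 2))%R; split.
  by rewrite lt_min ltr01 divr_gt0//= ge_min lexx.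
exists (fun f => G^-1%:E * I f); split.
  move=> g1 g2 k mg1 mg2 g10 g20 k0 kg.
  split; first by rewrite mule_ge0 ?lee_fin ?I0.
  split; first by rewrite mule_ge0 ?lee_fin ?I0.
  rewrite -ge0_muleDr ?I0//.
  have -> : k%:E = G^-1%:E * (k%:E * G%:E).
    by rewrite -!EFinM mulrCA mulVf ?gt_eqF// mulr1.
  apply: lee_wpmul2l; first by rewrite lee_fin.
  rewrite -ig -ge0_integralZl//; last 2 first.
  - exact/measurable_EFinP.
  - by move=> W _; rewrite lee_fin.
  rewrite -ge0_integralD//; last 4 first.
  - by move=> W _; exact: gf0.
  - exact: mgf.
  - by move=> W _; exact: gf0.
  - exact: mgf.
  apply: ge0_le_integral => //.
  - by move=> W _; rewrite -EFinM lee_fin mulr_ge0.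
  - by apply: emeasurable_funM => //; exact/measurable_EFinP.
  - by apply: emeasurable_funD; exact: mgf.
  move=> W _; have [DW|DW] := pselect (D W); last by rewrite gD// !mul0e mule0 adde0.
  by rewrite -ge0_muleDr// muleC; apply: lee_wpmul2l; rewrite ?lee_fin ?kg.
move=> f V mf f0 DV LV.
have mi := measurable_inner mf f0.
pose A := [set M | F M <= 2 * C]%R.
have mA : measurable A.
  rewrite (_ : A = setT `&` F @^-1` `]-oo, (2 * C)%R]%classic); first exact: mF.
  by rewrite setTI; apply/seteqP; split => x; rewrite /A /= in_itv.
pose u M := (k1 V M * \1_A M)%R.
have mu : measurable_fun setT u by apply: measurable_funM; [exact: measurable_k1|exact: measurable_indic].
have u0 M : (0 <= u M)%R by rewrite mulr_ge0.
have half : 2^-1%:E <= \int[l]_M (u M)%:E.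
  (* Integrate 1 <= 1_A + F / (2 C) against [k1 V]. *)
  have h1 : 1 <= \int[l]_M (u M)%:E + 2^-1%:E.
    rewrite -{1}(k1_1 DV).
    apply: (@le_trans _ _ (\int[l]_M ((u M)%:E + (2 * C)^-1%:E * ((k1 V M)%:E * (F M)%:E)))).
      apply: ge0_le_integral => //.
      - by move=> M _; rewrite lee_fin.
      - by apply/measurable_EFinP; exact: measurable_k1.
      - apply: emeasurable_funD; first exact/measurable_EFinP.
        by apply: measurable_funeM; apply: measurable_k1f; exact/measurable_EFinP.
      move=> M _; rewrite -!EFinM -EFinD lee_fin /u mulrCA -mulrDr ler_peMr// indicE.
      have [MA|MA] := boolP (M \in A); first by rewrite lerDl mulr_ge0// invr_ge0 ltW.
      rewrite add0r mulrC ler_pdivlMr// mul1r; apply/ltW; rewrite ltNge; apply: contra MA.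
      by rewrite inE.
    rewrite ge0_integralD//; last 4 first.
    - by move=> M _; rewrite lee_fin.
    - exact/measurable_EFinP.
    - by move=> M _; rewrite -!EFinM lee_fin mulr_ge0 ?mulr_ge0// invr_ge0 ltW.
    - by apply: measurable_funeM; apply: measurable_k1f; exact/measurable_EFinP.
    apply: leeD => //.
    rewrite ge0_integralZl//; last 3 first.
    - by apply: measurable_k1f; exact/measurable_EFinP.
    - by move=> M _; rewrite -!EFinM lee_fin mulr_ge0.
    - by rewrite lee_fin invr_ge0 ltW.
    apply: (@le_trans _ _ ((2 * C)^-1%:E * C%:E)).
      apply: lee_wpmul2l; first by rewrite lee_fin invr_ge0 ltW.
      apply: (le_trans (b _ DV)); rewrite lee_fin /C.
      have h : (lam * L V <= lam * r)%R by rewrite ler_wpM2l.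
      by have := ler_norm (lam * r + K); lra.
    by rewrite -EFinM lee_fin invfM -mulrA mulVf ?gt_eqF// mulr1.
  move: h1; have : 0 <= \int[l]_M (u M)%:E by apply: integral_ge0 => M _; rewrite lee_fin.
  case: (\int[l]_M (u M)%:E) => [z| |]//= _.
  - by rewrite -EFinD !lee_fin; lra.
  - by move=> _; exact: leey.
apply: (@le_trans _ _ (2^-1%:E * I f)).
  rewrite muleA -EFinM; apply: lee_wpmul2r; first exact: I0.
  rewrite lee_fin ler_pdivrMr// mulrC; by rewrite ge_min lexx orbT.
apply: (@le_trans _ _ ((\int[l]_M (u M)%:E) * I f)).
  by apply: lee_wpmul2r => //; exact: I0.
have -> : (\int[l]_M (u M)%:E) * I f = \int[l]_M ((u M)%:E * I f).
  rewrite [RHS]ge0_integralZr//; last 2 first.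
  - by move=> M _; rewrite lee_fin.
  - exact: I0.
  exact/measurable_EFinP.
apply: ge0_le_integral_conull => //.
- by apply: emeasurable_funM => //; exact/measurable_EFinP.
- by apply: measurable_k1f.
- by move=> M; rewrite mule_ge0 ?lee_fin ?I0.
- by move=> M; apply: (@mule_ge0_k1 (inner f)) => x; exact: inner_ge0.
move=> M EM.
rewrite /u EFinM -muleA; apply: lee_wpmul2l; first by rewrite lee_fin.
rewrite indicE; have [/set_mem MA|_] := boolP (M \in A); last by rewrite mul0e; exact: inner_ge0.
rewrite mul1e; apply: ge0_le_integral => //.
- by move=> W _; exact: gf0.
- exact: mgf.
- exact: measurable_k2f.
by move=> W _; apply: lee_wpmul2r => //; rewrite lee_fin; exact: gk.
Qed.

Lemma two_block_ergodic L F lam K : (0 <= lam < 1)%R -> (0 < K)%R -> drift_pair L F lam K ->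
  (forall r : R, exists g : T -> R, exists G : R, [/\ measurable_fun setT g, (forall x, 0 <= g x)%R,
    (0 < G)%R /\ \int[l]_W (g W)%:E = G%:E, (forall W, ~ D W -> g W = 0%R) &
    forall M W, E M -> (F M <= r)%R -> (g W <= k2 M W)%R]) ->
  geometrically_ergodic two_block posterior.
Proof.
move=> lam01 K0 dp H; have /andP[lam0 lam1] := lam01.
have [mL L0 mF F0 [a b]] := dp.
apply: (harris_L2 two_block_markov mD posterior_support _ mL L0 lam01 K0).
- by move=> f mf f0; exact: two_block_stationary.
- move=> V DV; apply: le_trans (b _ DV).
  have mLe : measurable_fun setT (EFin \o L) by exact/measurable_EFinP.
  apply: ge0_le_integral_conull => //.
  + by apply: measurable_k1f; exact: measurable_inner.
  + by apply: measurable_k1f; exact/measurable_EFinP.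
  + by move=> M; apply: (@mule_ge0_k1 (inner (EFin \o L))) => x; apply: inner_ge0 => y; rewrite lee_fin.
  + by move=> M; rewrite -EFinM lee_fin mulr_ge0.
  + by move=> M EM; apply: lee_wpmul2l; [rewrite lee_fin|exact: a].
- by move=> r; exact: (two_block_minorization r lam0 dp H).
Qed.

End two_block_gibbs.

(** * The conditional laws of the model *)

Section measurable_matrix.
Context d (T : measurableType d) (R : realType).

(** [powR] with exponent -1 is the inverse on nonnegative numbers only, whence 1/x = x (x^2)^(-1);
    at x = 0 both sides are 0. *)
Lemma measurable_fun_inv (f : T -> R) : measurable_fun setT f ->
  measurable_fun setT (fun x => (f x)^-1).
Proof.
move=> mf; rewrite (_ : (fun x => _) = fun x => f x * (f x ^+ 2) `^ (-1)).
  by mfun.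
apply/funext => x; rewrite powR_inv1 ?sqr_ge0//.
have [->|f0] := eqVneq (f x) 0; first by rewrite invr0 mul0r.
by rewrite expr2 invfM mulVKf.
Qed.

Lemma measurable_fun_sqrt (f : T -> R) : measurable_fun setT f ->
  measurable_fun setT (fun x => Num.sqrt (f x)).
Proof.
move=> mf; apply: (@measurableT_comp _ _ _ _ _ _ (Num.sqrt : R -> R)) => //.
by apply: continuous_measurable_fun => z; exact: sqrt_continuous.
Qed.

Definition measurable_mx m n (F : T -> 'M[R]_(m, n)) :=
  forall i j, measurable_fun setT (fun x => F x i j).

Lemma measurable_mx_cst m n (A : 'M[R]_(m, n)) : measurable_mx (fun=> A).
Proof. by move=> i j; exact: measurable_cst. Qed.

Lemma measurable_mxD m n (F G : T -> 'M[R]_(m, n)) :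
  measurable_mx F -> measurable_mx G -> measurable_mx (fun x => F x + G x).
Proof.
move=> mF mG i j; under eq_fun do rewrite mxE.
by apply: measurable_funD; [exact: mF|exact: mG].
Qed.

Lemma measurable_mxZ m n (c : T -> R) (F : T -> 'M[R]_(m, n)) :
  measurable_fun setT c -> measurable_mx F -> measurable_mx (fun x => c x *: F x).
Proof.
move=> mc mF i j; under eq_fun do rewrite mxE.
by apply: measurable_funM => //; exact: mF.
Qed.

Lemma measurable_mxB m n (F G : T -> 'M[R]_(m, n)) :
  measurable_mx F -> measurable_mx G -> measurable_mx (fun x => F x - G x).
Proof.
move=> mF mG i j; under eq_fun do rewrite !mxE.
by apply: measurable_funB; [exact: mF|exact: mG].
Qed.

Lemma measurable_mxM m n k (F : T -> 'M[R]_(m, n)) (G : T -> 'M[R]_(n, k)) :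
  measurable_mx F -> measurable_mx G -> measurable_mx (fun x => F x *m G x).
Proof.
move=> mF mG i j; under eq_fun do rewrite mxE.
by apply: measurable_sum => l; apply: measurable_funM; [exact: mF|exact: mG].
Qed.

Lemma measurable_mx_tr m n (F : T -> 'M[R]_(m, n)) :
  measurable_mx F -> measurable_mx (fun x => (F x)^T).
Proof. by move=> mF i j; under eq_fun do rewrite mxE; exact: mF. Qed.

Lemma measurable_det n (F : T -> 'M[R]_n) : measurable_mx F ->
  measurable_fun setT (fun x => \det (F x)).
Proof.
move=> mF; rewrite /determinant; apply: measurable_sum => s.
by apply: measurable_funM => //; apply: measurable_prod => i _; exact: mF.
Qed.

Lemma measurable_invmx n (F : T -> 'M[R]_n) : measurable_mx F ->
  measurable_mx (fun x => invmx (F x)).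
Proof.
move=> mF i j.
have md := measurable_det mF.
have ma : measurable_fun setT (fun x => (\adj (F x)) i j).
  under eq_fun do rewrite mxE /cofactor.
  apply: measurable_funM => //; apply: measurable_det => k l.
  by under eq_fun do rewrite !mxE; exact: mF.
(* On a singular matrix [invmx] returns its argument; elsewhere it is given by cofactors. *)
rewrite (_ : (fun x => _) = fun x => if \det (F x) == 0 then F x i j
  else (\det (F x))^-1 * (\adj (F x)) i j); last first.
  apply/funext => x; rewrite /invmx unitmxE unitfE.
  by case: eqP => //= _; rewrite mxE.
apply: measurable_fun_ifT.
- by apply: measurable_fun_eqr.
- exact: mF.
- by apply: measurable_funM => //; exact: measurable_fun_inv.
Qed.

Lemma measurable_mvn n (m x : T -> 'cV[R]_n) (S : T -> 'M[R]_n) :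
  measurable_mx m -> measurable_mx x -> measurable_mx S ->
  measurable_fun setT (fun u => mvn_pdf (m u) (S u) (x u)).
Proof.
move=> mm mx mS; rewrite /mvn_pdf; apply: measurable_funM.
  apply: measurable_fun_inv; apply: measurable_fun_sqrt.
  by apply: measurable_funM => //; exact: measurable_det.
apply: measurable_fun_expR; apply: measurable_funM => //.
have mxm := measurable_mxB mx mm.
apply: (measurable_mxM (measurable_mxM (measurable_mx_tr mxm) _) mxm).
exact: measurable_invmx.
Qed.

Lemma measurable_mx_vcol n (f : T -> Rn R n) : measurable_fun setT f ->
  measurable_mx (fun x => vcol (f x)).
Proof.
move=> mf i j; under eq_fun do rewrite mxE.
exact: (measurableT_comp (measurable_tnth i) mf).
Qed.

Lemma measurable_mx_diag n (f : T -> 'rV[R]_n) : measurable_mx f ->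
  measurable_mx (fun x => diag_mx (f x)).
Proof.
move=> mf i j; under eq_fun do rewrite mxE.
by case: (i == j); [exact: mf|exact: measurable_cst].
Qed.

End measurable_matrix.

Section gig_law.
Context {R : realType}.
Implicit Types p a b s x : R.
Local Notation mu := (@lebesgue_measure R).

Lemma measurable_gig_kernel d (T : measurableType d) p a (b x : T -> R) :
  measurable_fun setT b -> measurable_fun setT x ->
  measurable_fun setT (fun u => gig_kernel p a (b u) (x u)).
Proof.
move=> mb mx; rewrite /gig_kernel; apply: measurable_fun_ifT => //.
  by apply: measurable_fun_ltr.
apply: measurable_funM; first exact: measurable_fun_powR.
apply: measurable_fun_expR; apply: measurable_funM => //.
apply: measurable_funD; first exact: measurable_funM.
by apply: measurable_funM => //; exact: measurable_fun_inv.
Qed.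

Lemma measurable_gw d (T : measurableType d) l a (b : T -> R) :
  measurable_fun setT b -> measurable_fun setT (fun u => gw l a (b u)).
Proof.
move=> mb.
have m1 : measurable_fun setT (gigW l a : measurableTypeR R -> \bar R).
  apply: (@measurable_fun_fubini_tonelli_F _ _ (measurableTypeR R) (measurableTypeR R) R mu
    (fun u => (gigw l a u.1 u.2)%:E)).
    apply/measurable_EFinP; rewrite /gigw.
    apply: measurable_fun_expR; apply: measurable_funB.
      by apply: measurable_funM => //; exact: measurable_snd.
    apply: measurable_funM => //; apply: measurable_funD.
      apply: measurable_funM => //; apply: measurable_fun_expR; exact: measurable_snd.
    apply: measurable_funM; first exact: measurable_fst.
    by apply: measurable_fun_expR; apply: measurable_funN; exact: measurable_snd.
  by move=> u; rewrite lee_fin ltW// gigw_gt0.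
under eq_fun do rewrite gw_def.
apply: (measurableT_comp _ (measurableT_comp m1 mb)).
exact: fine_measurable.
Qed.

Lemma gig_kernel_ge0 p a b x : 0 <= gig_kernel p a b x.
Proof. by rewrite /gig_kernel; case: ifP => // _; rewrite mulr_ge0 ?powR_ge0 ?expR_ge0. Qed.

Lemma gig_kernel_gt0 p a b x : 0 < x -> 0 < gig_kernel p a b x.
Proof. by move=> x0; rewrite /gig_kernel x0 mulr_gt0 ?powR_gt0 ?expR_gt0. Qed.

Lemma gig_kernel_le p a b b' x : b <= b' -> gig_kernel p a b' x <= gig_kernel p a b x.
Proof.
move=> bb; rewrite /gig_kernel; case: ifP => // x0.
rewrite ler_wpM2l ?powR_ge0// ler_expR !mulNr lerN2 ler_wpM2l// ?invr_ge0// lerD2l.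
by rewrite ler_wpM2r// invr_ge0 ltW.
Qed.

Lemma gig_kernel_exp p a b s u :
  expR u `^ s * gig_kernel p a b (expR u) * expR u = gigw (p + s) a b u.
Proof.
rewrite /gig_kernel expR_gt0 /gigw -!expRM -expRN -!expRD; congr expR.
by ring.
Qed.

Lemma integral_gig_pos p a b s :
  (\int[mu]_(x in `]0%R, +oo[) (x `^ s * gig_kernel p a b x)%:E = gigW (p + s) a b)%E.
Proof.
rewrite (@ge0_integral_exp _ (fun x => (x `^ s * gig_kernel p a b x)%:E)).
- by apply: eq_integral => u _; rewrite -EFinM gig_kernel_exp.
- apply/measurable_EFinP; apply: measurable_funM; first exact: measurable_fun_powR.
  exact: measurable_gig_kernel.
- by move=> x; rewrite lee_fin mulr_ge0 ?powR_ge0 ?gig_kernel_ge0.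
Qed.

Lemma gig_normE p a b :
  \int[mu]_(y in `]0, +oo[) gig_kernel p a b y = gw p a b.
Proof.
rewrite gw_def -[in RHS](addr0 p) -integral_gig_pos /Rintegral; congr fine.
by apply: eq_integral => x _; rewrite powRr0 mul1r.
Qed.

Lemma gig_pdfE p a b x : gig_pdf p a b x = gig_kernel p a b x / gw p a b.
Proof. by rewrite /gig_pdf gig_normE. Qed.

Lemma gw_ge0 l a b : 0 <= gw l a b.
Proof. by rewrite gw_def fine_ge0// ltW// gigW_gt0. Qed.

Lemma gw_le (l c x y : R) : x <= y -> gig_fin l c x -> gig_fin l c y -> gw l c y <= gw l c x.
Proof.
move=> xy f1 f2.
have hu u : gigw l c y u <= gigw l c x u.
  rewrite ler_expR lerD2l lerN2 ler_wpM2l ?invr_ge0// lerD2l.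
  by rewrite ler_wpM2r// expR_ge0.
have h0 u : 0 <= gigw l c y u by rewrite ltW// gigw_gt0.
exact: (@ge0_le_integral_val _ (measurableTypeR R) R lebesgue_measure _ _ _ _ (measurable_gigw l c y) (measurable_gigw l c x) h0 hu
  (integral_gigw f2) (integral_gigw f1)).
Qed.

Lemma gig_pdf_ge0 p a b x : 0 <= gig_pdf p a b x.
Proof. by rewrite gig_pdfE divr_ge0 ?gig_kernel_ge0 ?gw_ge0. Qed.

Lemma measurable_gig_pdf d (T : measurableType d) p a (b x : T -> R) :
  measurable_fun setT b -> measurable_fun setT x ->
  measurable_fun setT (fun u => gig_pdf p a (b u) (x u)).
Proof.
move=> mb mx; under eq_fun do rewrite gig_pdfE.
apply: measurable_funM; first exact: measurable_gig_kernel.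
by apply: measurable_fun_inv; exact: measurable_gw.
Qed.

Lemma gig_moment p a b s : gig_fin p a b -> gig_fin (p + s) a b ->
  (\int[mu]_x (x `^ s * gig_pdf p a b x)%:E = (gw (p + s) a b / gw p a b)%:E)%E.
Proof.
move=> f1 f2.
transitivity (\int[mu]_x ((gw p a b)^-1 * (x `^ s * gig_kernel p a b x))%:E)%E.
  by apply: eq_integral => x _; rewrite gig_pdfE; congr EFin; ring.
rewrite ge0_integralZ_EFin ?invr_ge0 ?gw_ge0//; last 2 first.
- apply: measurable_funM; first exact: measurable_fun_powR.
  exact: measurable_gig_kernel.
- by move=> x; rewrite mulr_ge0 ?powR_ge0 ?gig_kernel_ge0.
rewrite [RHS]EFinM muleC -gwE// -integral_gig_pos; congr (_ * _)%E.
rewrite [RHS]integral_mkcond; apply: eq_integral => x _; rewrite patchE.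
case: ifPn => // /negP; rewrite in_setE /= in_itv /= andbT => /negP x0.
by rewrite /gig_kernel (negbTE x0) mulr0.
Qed.

Lemma integral_gig_pdf p a b : gig_fin p a b -> (\int[mu]_x (gig_pdf p a b x)%:E = 1)%E.
Proof.
move=> f; have := @gig_moment p a b 0 f; rewrite addr0 => /(_ f).
rewrite divff ?gt_eqF ?gw_gt0// => <-; apply: eq_integral => x _.
by rewrite powRr0 mul1r.
Qed.

Lemma gig_prod_pdf_ge0 n p a (b : 'I_n -> R) v : 0 <= gig_prod_pdf p a b v.
Proof. by apply: prodr_ge0 => i _; exact: gig_pdf_ge0. Qed.

Lemma measurable_gig_prod_pdf d (T : measurableType d) n p a (b : 'I_n -> T -> R) (v : T -> Rn R n) :
  (forall i, measurable_fun setT (b i)) -> measurable_fun setT v ->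
  measurable_fun setT (fun u => gig_prod_pdf p a (fun i => b i u) (v u)).
Proof.
move=> mb mv; apply: measurable_prod => i _; apply: measurable_gig_pdf => //.
exact: (measurableT_comp (measurable_tnth i) mv).
Qed.

Lemma integral_gig_prod_pdf n p a (b : 'I_n -> R) : (forall i, gig_fin p a (b i)) ->
  (\int[lebesgue_Rn R n]_v (gig_prod_pdf p a b v)%:E = 1)%E.
Proof.
move=> f; rewrite (@integral_Rn_prod R n (fun i => gig_pdf p a (b i))).
- by rewrite big1// => i _; exact: integral_gig_pdf.
- by move=> i; exact: measurable_gig_pdf.
- by move=> i x; exact: gig_pdf_ge0.
Qed.

Lemma gig_prod_moment n p a (b : 'I_n -> R) s i : (forall i, gig_fin p a (b i)) ->
  gig_fin (p + s) a (b i) ->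
  (\int[lebesgue_Rn R n]_v (gig_prod_pdf p a b v * tnth v i `^ s)%:E =
   (gw (p + s) a (b i) / gw p a (b i))%:E)%E.
Proof.
move=> f fs.
pose F j x := (if j == i then x `^ s else 1) * gig_pdf p a (b j) x.
transitivity (\int[lebesgue_Rn R n]_v (\prod_(j < n) F j (tnth v j))%:E)%E.
  apply: eq_integral => v _; congr EFin; rewrite big_split /= mulrC; congr (_ * _).
  by rewrite (bigD1 i)//= eqxx big1 ?mulr1// => j /negbTE ->.
rewrite integral_Rn_prod; last 2 first.
- move=> j; apply: measurable_funM; last exact: measurable_gig_pdf.
  by case: (j == i); [exact: measurable_fun_powR|exact: measurable_cst].
- by move=> j x; rewrite /F; case: ifP => _; rewrite mulr_ge0 ?powR_ge0 ?gig_pdf_ge0.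
rewrite (bigD1 i)//= [X in (_ * X)%E]big1 ?mule1.
  by rewrite -gig_moment//; apply: eq_integral => x _; rewrite /F eqxx.
move=> j ji; rewrite -[RHS](integral_gig_pdf (f j)); apply: eq_integral => x _.
by rewrite /F (negbTE ji) mul1r.
Qed.

Lemma gig_prod_pdf0 n p a (b : 'I_n -> R) (v : Rn R n) : ~ (pos_vec (vcol v)) ->
  gig_prod_pdf p a b v = 0.
Proof.
move=> h; have [i hi] : exists i, ~ (0 < tnth v i).
  by apply/existsNP => h'; apply: h => i; rewrite mxE; exact: h'.
rewrite /gig_prod_pdf (bigD1 i)//= gig_pdfE /gig_kernel.
by move/negP/negbTE : hi => ->; rewrite !mul0r.
Qed.

End gig_law.

Section matrix_gaussian.
Context {R : realType} (n : nat).

Lemma sqrt_prod (I : finType) (f : I -> R) : (forall i, 0 <= f i) ->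
  Num.sqrt (\prod_i f i) = \prod_i Num.sqrt (f i).
Proof.
move=> f0; suff: 0 <= \prod_i f i /\ Num.sqrt (\prod_i f i) = \prod_i Num.sqrt (f i) by case.
apply: (big_ind2 (fun x y => 0 <= x /\ Num.sqrt x = y)); first by rewrite sqrtr1.
  by move=> x1 x2 y1 y2 [x10 <-] [y10 <-]; rewrite mulr_ge0// sqrtrM.
by move=> i _.
Qed.

Lemma invmxZ (Q : 'M[R]_n) (c : R) : c != 0 -> Q \in unitmx -> invmx (c *: Q) = c^-1 *: invmx Q.
Proof.
move=> c0 uQ; have e : (c *: Q) *m (c^-1 *: invmx Q) = 1%:M.
  by rewrite -scalemxAl -scalemxAr scalerA mulfV// scale1r mulmxV.
have [u _] := mulmx1_unit e.
by rewrite -[RHS]mul1mx -(mulVmx u) -mulmxA e mulmx1.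
Qed.

Lemma qfZ (Q : 'M[R]_n) (c : R) x : qf (c *: Q) x = c * qf Q x.
Proof. by rewrite /qf -scalemxAr -scalemxAl mxE. Qed.

Lemma posdef_scalar (c : R) : 0 < c -> posdef (c%:M : 'M[R]_n).
Proof.
move=> c0; split; first exact: tr_scalar_mx.
move=> x x0; rewrite /qf mul_mx_scalar -scalemxAl mxE mulr_gt0// -dotE.
rewrite lt_neqAle dot_ge0 andbT eq_sym; apply: contra x0 => /eqP e.
by apply/eqP; exact: dot_eq0.
Qed.

Lemma qf_shift (Q : 'M[R]_n) (x y z : 'cV[R]_n) : Q^T = Q -> Q *m y = z ->
  qf Q (x - y) = qf Q x - 2 * dot z x + dot z y.
Proof.
move=> Qs Qy; have bil u v : (u^T *m Q *m v) 0 0 = dot u (Q *m v) by rewrite dotE mulmxA.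
rewrite /qf !bil mulmxBr !dotDl !dotDr !dotNl !dotNr Qy.
have -> : dot y (Q *m x) = dot z x by rewrite dot_mulmx Qs Qy.
by rewrite (dotC x z) (dotC y z); ring.
Qed.

Lemma qf_inv_diag (V x : 'cV[R]_n) : pos_vec V ->
  qf (invmx (diag_mx V^T)) x = \sum_i x i 0 ^+ 2 / V i 0.
Proof.
move=> V0; rewrite invmx_diag// /qf -mulmxA -dotE.
by apply: eq_bigr => i _; rewrite mul_diag_mx !mxE; ring.
Qed.

Lemma mvn_pdf_diag (c V x : 'cV[R]_n) : pos_vec V ->
  mvn_pdf c (diag_mx V^T) x =
  \prod_i ((Num.sqrt (2 * pi * V i 0))^-1 * expR (- 2^-1 * ((x i 0 - c i 0) ^+ 2 / V i 0))).
Proof.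
move=> V0; rewrite /mvn_pdf (_ : (_ *m _ *m _) 0 0 = qf (invmx (diag_mx V^T)) (x - c))//.
rewrite qf_inv_diag// det_diag big_split /=; congr (_ * _); last first.
  rewrite mulr_sumr expR_sum; apply: eq_bigr => i _.
  by rewrite !mxE.
have -> : (2 * pi : R) ^+ n = \prod_(i < n) (2 * pi) by rewrite prodr_const card_ord.
rewrite -big_split /= sqrt_prod -?prodfV; last first.
  by move=> i; rewrite !mxE !mulr_ge0 ?pi_ge0// ltW// V0.
by apply: eq_bigr => i _; rewrite !mxE.
Qed.

End matrix_gaussian.

Section gibbs_kernels.
Context {R : realType} (m n q : nat).
Variables (A : 'M[R]_(m, n)) (K : 'M[R]_n) (X : 'M[R]_(m, q)) (beta : 'cV[R]_q).
Variables (h : 'cV[R]_n) (mu sigma sigma_eps p a b : R) (Y : 'cV[R]_m).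
Hypotheses (sigma_gt0 : 0 < sigma) (sigma_eps_gt0 : 0 < sigma_eps).
Hypothesis gig_pab : gig_params p a b.

Local Notation leb := (lebesgue_Rn R n).
Local Notation B := (A *m invmx K).
Local Notation rho := (sigma ^+ 2 * sigma_eps ^- 2).
Local Notation w := (Y - X *m beta + mu *: (B *m h)).
Local Notation mbar := (rho *: (B^T *m w) + mu *: const_mx 1).
Local Notation Qbar V := (qbar B rho (vcol V)).
Local Notation ta := (tilde_a mu sigma a).
Local Notation bM M i := (b + (tnth M i : R) ^+ 2 / sigma ^+ 2).
Local Notation D := [set V : Rn R n | pos_vec (vcol V)].
Local Notation E := [set M : Rn R n | forall i, tnth M i != 0 :> R].
Local Notation k1 := (M_pdf A K X beta h mu sigma sigma_eps Y).
Local Notation k2 := (V_pdf mu sigma p a b).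
Local Notation J := (joint_pdf A K X beta h mu sigma sigma_eps p a b Y).

Let rho0 : 0 < rho. Proof. by rewrite divr_gt0 ?exprn_gt0. Qed.
Let s20 : 0 < sigma ^+ 2. Proof. exact: exprn_gt0. Qed.

Lemma gig_fin_prior : gig_fin p a b.
Proof.
by case: gig_pab => [[a0 b0]|[-> b0 p0]|[a0 -> p0]]; split; rewrite ?lexx ?a0 ?b0 ?p0 ?orbT ?ltW.
Qed.

Lemma b_ge0 : 0 <= b. Proof. by case: gig_fin_prior. Qed.

Lemma tilde_a_ge0 : 0 <= ta.
Proof. by rewrite addr_ge0 ?divr_ge0 ?sqr_ge0//; case: gig_fin_prior. Qed.

Lemma gig_fin_conditional (c : R) : 0 < c -> gig_fin (p - 2^-1) ta c.
Proof.
move=> c0; split; rewrite ?c0 ?(ltW c0) ?tilde_a_ge0//.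
have a0 : 0 <= mu ^+ 2 / sigma ^+ 2 by rewrite divr_ge0 ?sqr_ge0.
case: gig_pab => [[a1 _]|[_ _ p0]|[a1 _ _]]; apply/orP; [left|right|left].
- by rewrite /tilde_a ltr_wpDr.
- by rewrite subr_lt0 (lt_trans p0)// invr_gt0.
- by rewrite /tilde_a ltr_wpDr.
Qed.

Lemma bM_gt0 (M : Rn R n) i : E M -> 0 < bM M i.
Proof.
move=> EM; rewrite ltr_wpDl ?b_ge0// divr_gt0//.
by rewrite lt_neqAle eq_sym sqrf_eq0 EM sqr_ge0.
Qed.

Lemma measurable_bM i : measurable_fun setT (fun M : Rn R n => bM M i).
Proof.
apply: measurable_funD => //; apply: measurable_funM => //; apply: measurable_funX.
exact: measurable_tnth.
Qed.

Lemma measurable_M_pdf : measurable_fun setT (fun u : Rn R n * Rn R n => k1 u.1 u.2).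
Proof.
have mQ : measurable_mx (fun u : Rn R n * Rn R n => Qbar u.1).
  apply: measurable_mxD; first exact: measurable_mx_cst.
  apply/measurable_invmx/measurable_mx_diag/measurable_mx_tr/measurable_mx_vcol.
  exact: measurable_fst.
apply: measurable_mvn.
- by apply: measurable_mxM; [exact: measurable_invmx|exact: measurable_mx_cst].
- by apply: measurable_mx_vcol; exact: measurable_snd.
- by apply: (measurable_mxZ (c := fun=> sigma ^+ 2)) => //; exact: measurable_invmx.
Qed.

Lemma measurable_V_pdf : measurable_fun setT (fun u : Rn R n * Rn R n => k2 u.1 u.2).
Proof.
apply: (@measurable_gig_prod_pdf R _ (Rn R n * Rn R n)%type n _ _ (fun i u => bM u.1 i) (fun u => u.2)).
  by move=> i; exact: (measurableT_comp (measurable_bM i) measurable_fst).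
exact: measurable_snd.
Qed.

Lemma measurable_joint_pdf : measurable_fun setT (fun u : Rn R n * Rn R n => J u.1 u.2).
Proof.
have m1 : measurable_mx (fun u : Rn R n * Rn R n => vcol u.1) by apply: measurable_mx_vcol; exact: measurable_fst.
have m2 : measurable_mx (fun u : Rn R n * Rn R n => vcol u.2) by apply: measurable_mx_vcol; exact: measurable_snd.
apply: measurable_funM; first apply: measurable_funM.
- apply: (measurable_mvn (x := fun=> Y) (S := fun=> (sigma_eps ^+ 2)%:M)).
  + apply: measurable_mxD; first exact: measurable_mx_cst.
    apply: measurable_mxM; first exact: measurable_mx_cst.
    by apply: measurable_mxB => //; exact: measurable_mx_cst.
  + exact: measurable_mx_cst.
  + exact: measurable_mx_cst.
- apply: measurable_mvn => //; first exact: (measurable_mxZ (c := fun=> mu)).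
  apply: (measurable_mxZ (c := fun=> sigma ^+ 2)) => //.
  by apply: measurable_mx_diag; exact: measurable_mx_tr.
- apply: (@measurable_gig_prod_pdf R _ (Rn R n * Rn R n)%type n _ _ (fun i u => b) (fun u => u.2)) => //.
  exact: measurable_snd.
Qed.

Lemma measurable_pos : measurable D.
Proof.
rewrite (_ : D = \bigcap_(i in [set: 'I_n]) ((fun v : Rn R n => tnth v i) @^-1` `]0, +oo[)).
  apply: fin_bigcap_measurable => // i _.
  by rewrite -[X in measurable X]setTI; apply: (measurable_tnth i).
apply/seteqP; split => v /= hv i.
  by move=> _; rewrite /= in_itv /= andbT; have := hv i; rewrite mxE.
by rewrite mxE; have := hv i I; rewrite /= in_itv /= andbT.
Qed.

Lemma measurable_nonzero : measurable E.
Proof.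
rewrite (_ : E = \bigcap_(i in [set: 'I_n]) ((fun v : Rn R n => tnth v i) @^-1` (~` [set 0]))).
  apply: fin_bigcap_measurable => // i _.
  by rewrite -[X in measurable X]setTI; apply: (measurable_tnth i) => //; apply: measurableC.
apply/seteqP; split => v /= hv i; first by move=> _ /= /eqP; exact/negP/hv.
by apply/eqP; exact: hv.
Qed.

Lemma nonzero_conull : leb (~` E) = 0%E.
Proof.
have mtn i (S : set (measurableTypeR R)) : measurable S -> measurable ((fun v : Rn R n => tnth v i) @^-1` S).
  by move=> mS; rewrite -[X in measurable X]setTI; apply: (measurable_tnth i).
have z i : leb ((fun v : Rn R n => tnth v i) @^-1` [set 0]) = 0%E.
  rewrite -[LHS]mul1e -integral_cst; last exact: mtn.
  rewrite integral_mkcond.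
  transitivity (\int[leb]_v (\prod_(j < n) (if j == i then \1_[set (0 : R)] (tnth v j) else 1))%:E)%E.
    apply: eq_integral => v _; rewrite patchE (bigD1 i)//= eqxx.
    rewrite [X in (_ * X)%:E]big1 ?mulr1; last by move=> j /negbTE ->.
    rewrite indicE; case: ifPn => [/set_mem /= -> |/negP hn]; first by rewrite mem_set.
    by rewrite memNset// => e; apply: hn; rewrite inE.
  rewrite (@integral_Rn_prod R n (fun j x => if j == i then \1_[set (0 : R)] x else 1)).
  - rewrite (bigD1 i)//= [X in (X * _)%E](_ : _ = 0%E) ?mul0e//.
    transitivity (\int[@lebesgue_measure R]_x (\1_[set (0 : R)] x)%:E)%E.
      by apply: eq_integral => x _; rewrite eqxx.
    transitivity (@lebesgue_measure R ([set (0 : R)] `&` setT)); first exact: integral_indic.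
    by rewrite setIT; exact: lebesgue_measure_set1.
  - by move=> j; case: (j == i) => //; exact: measurable_indic.
  - by move=> j x; case: (j == i).
have sub : ~` E `<=` \big[setU/set0]_(i < n) ((fun v : Rn R n => tnth v i) @^-1` [set 0]).
  move=> v /= /existsNP[i /negP]; rewrite negbK => /eqP vi.
  by rewrite (bigD1 i)//=; left.
set U := \big[_/_]_(i < n) _ in sub.
have [mU U0] : measurable U /\ leb U = 0%E.
  apply: (big_ind (fun S => measurable S /\ leb S = 0%E)); first by rewrite measure0.
    by move=> S1 S2 [mS1 S10] [mS2 S20]; split; [exact: measurableU|rewrite measureU0].
  by move=> i _; split; [exact: mtn|exact: z].
apply/eqP; rewrite eq_le measure_ge0 andbT -U0; apply: le_measure; rewrite ?inE//.
by apply: measurableC; exact: measurable_nonzero.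
Qed.

Lemma pos_gt0 : (0 < leb D)%E.
Proof.
pose f (i : 'I_n) (x : R) := \1_(`]0, 1]%classic : set (measurableTypeR R)) x : R.
have i1 : (\int[leb]_v (\prod_(i < n) f i (tnth v i))%:E = 1)%E.
  rewrite (@integral_Rn_prod R n f).
  - rewrite big1// => i _.
    transitivity (@lebesgue_measure R (`]0, 1]%classic `&` setT)); first exact: integral_indic.
    by rewrite setIT lebesgue_measure_itv /= lte_fin ltr01 oppr0 adde0.
  - by move=> i; exact: measurable_indic.
  - by move=> i x; rewrite /f.
have : (\int[leb]_v (\prod_(i < n) f i (tnth v i))%:E <= \int[leb]_v (\1_D v)%:E)%E.
  apply: ge0_le_integral_EFin.
  - by apply: measurable_prod_tnth => i; exact: measurable_indic.
  - by apply: measurable_indic; exact: measurable_pos.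
  - by move=> v; apply: prodr_ge0 => i _; rewrite /f.
  - move=> v; have [DV|DV] := pselect (D v).
      rewrite indicE mem_set//; apply: (@le_trans _ _ (\prod_(i < n) 1)); last by rewrite big1.
      by apply: ler_prod => i _; rewrite /f indicE; case: (_ \in _); rewrite /= ?lexx ?ler01.
    rewrite indicE memNset//.
    have [i hi] : exists i, ~ (0 < tnth v i).
      by apply/existsNP => h'; apply: DV => i; rewrite mxE; exact: h'.
    rewrite (bigD1 i)//= /f indicE memNset ?mul0r//.
    by rewrite /= in_itv /= => /andP[].
rewrite i1 integral_indic//; last exact: measurable_pos.
by rewrite setIT; apply: lt_le_trans.
Qed.

Lemma qbar_cov_posdef (V : Rn R n) : D V -> posdef (sigma ^+ 2 *: invmx (Qbar V)).
Proof. by move=> DV; apply: posdef_scale => //; apply: posdef_inv; exact: qbar_posdef. Qed.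

Lemma integral_M_pdf (V : Rn R n) : D V -> (\int[leb]_M (k1 V M)%:E = 1)%E.
Proof. by move=> DV; apply: integral_mvn_pdf; exact: qbar_cov_posdef. Qed.

Lemma integral_V_pdf (M : Rn R n) : E M -> (\int[leb]_W (k2 M W)%:E = 1)%E.
Proof.
by move=> EM; apply: integral_gig_prod_pdf => i; apply: gig_fin_conditional; exact: bM_gt0.
Qed.

Lemma diag_posdef (V : Rn R n) : D V -> posdef (diag_mx (vcol V)^T).
Proof.
move=> DV; split; first exact: tr_diag_mx.
move=> x x0; have -> : qf (diag_mx (vcol V)^T) x = \sum_i vcol V i 0 * x i 0 ^+ 2.
  by rewrite /qf -mulmxA -dotE; apply: eq_bigr => i _; rewrite mul_diag_mx !mxE mulrCA -expr2.
rewrite lt_neqAle sumr_ge0 ?andbT; last by move=> i _; rewrite mulr_ge0 ?sqr_ge0// ltW.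
rewrite eq_sym; apply: contra x0; rewrite psumr_eq0; last by move=> i _; rewrite mulr_ge0 ?sqr_ge0// ltW.
move=> /allP hx; apply/eqP/colP => i; apply/eqP; rewrite mxE.
have := hx i (mem_index_enum i); rewrite /= mulf_eq0 gt_eqF//=; by rewrite sqrf_eq0.
Qed.

Lemma qf_invdiag (V : Rn R n) x : D V ->
  qf (invmx (sigma ^+ 2 *: diag_mx (vcol V)^T)) x = \sum_i x i 0 ^+ 2 / (sigma ^+ 2 * tnth V i).
Proof.
move=> DV; rewrite invmxZ ?gt_eqF//; last exact/posdef_unit/diag_posdef.
rewrite qfZ invmx_diag// /qf -mulmxA -dotE mulr_sumr.
apply: eq_bigr => i _; rewrite mul_diag_mx !mxE.
by have := DV i; rewrite mxE => V0; field; rewrite !gt_eqF.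
Qed.

(* The [M]-dependent part of [-2 sigma^2 log] of the joint density. *)
Definition gibbs_energy (V M : Rn R n) : R := qf (Qbar V) (vcol M) - 2 * dot mbar (vcol M).

Lemma M_pdf_energy (V : Rn R n) : D V -> exists2 c : R, 0 < c &
  forall M, k1 V M = c * expR (- 2^-1 * (sigma ^- 2 * gibbs_energy V M)).
Proof.
move=> DV; have pQ := @qbar_posdef R m n B rho rho0 _ DV; have uQ := posdef_unit pQ.
have pS := qbar_cov_posdef DV; set S := sigma ^+ 2 *: _ in pS.
set y := invmx (Qbar V) *m mbar.
have Qy : Qbar V *m y = mbar by rewrite mulKVmx.
exists ((Num.sqrt ((2 * pi) ^+ n * \det S))^-1 * expR (- 2^-1 * (sigma ^- 2 * dot mbar y))).
  rewrite mulr_gt0 ?expR_gt0// invr_gt0 sqrtr_gt0 mulr_gt0 ?posdef_det//.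
  by rewrite exprn_gt0// mulr_gt0// pi_gt0.
move=> M; rewrite -mulrA -expRD /M_pdf mvn_pdfE /gauss_fun_Rn; congr (_ * expR _).
rewrite -mulrDr -mulrDr; congr (_ * _).
rewrite invmxZ ?gt_eqF// ?unitmx_inv// invmxK qfZ; congr (_ * _).
rewrite -/y /gibbs_energy.
have [Qs _] := pQ; rewrite (qf_shift (vcol M) Qs Qy).
by ring.
Qed.

(** Expanding the squares, the likelihood and the law of M given V contribute the same M-dependent
    exponent as [M_pdf]; factors free of M go into [c]. Comparing the two forms avoids computing the
    ratio of normalizing constants. *)
Lemma joint_pdf_energy (V : Rn R n) : D V -> exists2 c : R, 0 < c &
  forall M, J M V = c * expR (- 2^-1 * (sigma ^- 2 * gibbs_energy V M)).
Proof.
move=> DV.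
have e20 : 0 < sigma_eps ^+ 2 by exact: exprn_gt0.
have pY : posdef ((sigma_eps ^+ 2)%:M : 'M[R]_m) by exact: posdef_scalar.
have pV : posdef (sigma ^+ 2 *: diag_mx (vcol V)^T).
  by apply: posdef_scale => //; exact: diag_posdef.
have pre k (S : 'M[R]_k) : posdef S -> 0 < (Num.sqrt ((2 * pi) ^+ k * \det S))^-1.
  move=> pS; rewrite invr_gt0 sqrtr_gt0 mulr_gt0 ?posdef_det//.
  by rewrite exprn_gt0// mulr_gt0// pi_gt0.
have gp : 0 < gig_prod_pdf p a (fun=> b) V.
  apply: prodr_gt0 => i _; rewrite gig_pdfE divr_gt0 ?gw_gt0//; last exact: gig_fin_prior.
  by apply: gig_kernel_gt0; have := DV i; rewrite mxE.
pose cY := (Num.sqrt ((2 * pi) ^+ m * \det ((sigma_eps ^+ 2)%:M : 'M[R]_m)))^-1.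
pose cV := (Num.sqrt ((2 * pi) ^+ n * \det (sigma ^+ 2 *: diag_mx (vcol V)^T)))^-1.
exists (cY * cV * gig_prod_pdf p a (fun=> b) V *
  expR (- 2^-1 * (sigma_eps ^- 2 * dot w w + sigma ^- 2 * mu ^+ 2 * \sum_i tnth V i))).
  by rewrite !mulr_gt0 ?expR_gt0 ?pre.
move=> M; rewrite /joint_pdf mvn_pdfE /mvn_pdf -/cY -/cV /gauss_fun_Rn.
rewrite -[RHS]mulrA -[in RHS]expRD -[in RHS]mulrDr.
rewrite [LHS](_ : _ = cY * cV * gig_prod_pdf p a (fun=> b) V *
  (expR (- 2^-1 * qf (invmx (sigma_eps ^+ 2)%:M) (Y - (X *m beta + B *m (vcol M - mu *: h)))) *
   expR (- 2^-1 * qf (invmx (sigma ^+ 2 *: diag_mx (vcol V)^T)) (vcol M - mu *: vcol V)))); last first.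
  by rewrite /qf; ring.
rewrite -expRD -mulrDr; congr (_ * expR (_ * _)).
rewrite qf_invdiag//.
have -> : Y - (X *m beta + B *m (vcol M - mu *: h)) = w - B *m vcol M.
  by rewrite mulmxBr -scalemxAr !opprD opprK; rewrite !addrA addrAC.
have -> : qf (invmx (sigma_eps ^+ 2)%:M) (w - B *m vcol M) =
   sigma_eps ^- 2 * dot (w - B *m vcol M) (w - B *m vcol M).
  by rewrite invmx_scalar /qf mul_mx_scalar -scalemxAl mxE -dotE.
rewrite /gibbs_energy qf_qbar//.
move: (Y - X *m beta + mu *: (B *m h)) => w0.
rewrite !dotDl !dotDr !dotNl !dotNr !dotZl (dotC (B *m vcol M) w0).
have -> : dot (B^T *m w0) (vcol M) = dot w0 (B *m vcol M) by rewrite [RHS]dot_mulmx.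
have -> : dot (const_mx 1) (vcol M) = \sum_i tnth M i.
  by apply: eq_bigr => i _; rewrite !mxE mul1r.
have -> : \sum_i (vcol M - mu *: vcol V) i 0 ^+ 2 / (sigma ^+ 2 * tnth V i) =
  sigma ^- 2 * (\sum_i vcol M i 0 ^+ 2 / vcol V i 0) - 2 * sigma ^- 2 * mu * (\sum_i tnth M i) +
  sigma ^- 2 * mu ^+ 2 * \sum_i tnth V i.
  rewrite !mulr_sumr -sumrB -big_split; apply: eq_bigr => i _ /=.
  have := DV i; rewrite !mxE => V0; field.
  by rewrite !gt_eqF.
set s1 := \sum_i _; set s2 := \sum_i _; set s3 := \sum_i _.
by field; rewrite !gt_eqF.
Qed.

Lemma joint_pdf_M : exists c : Rn R n -> R, (forall V, D V -> 0 < c V) /\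
  forall M V, D V -> J M V = c V * k1 V M.
Proof.
have H V : exists c : R, D V -> 0 < c /\ forall M, J M V = c * k1 V M.
  have [DV|DV] := pselect (D V); last by exists 0.
  have [c1 c10 h1] := joint_pdf_energy DV; have [c2 c20 h2] := M_pdf_energy DV.
  exists (c1 / c2) => _; split; first by rewrite divr_gt0.
  by move=> M; rewrite h1 h2 mulrA mulfVK// gt_eqF.
have [c hc] := choice H; exists c; split.
  by move=> V /hc[].
by move=> M V /hc[_].
Qed.

Lemma joint_pdf0 (M V : Rn R n) : ~ D V -> J M V = 0.
Proof. by move=> DV; rewrite /joint_pdf gig_prod_pdf0 ?mulr0. Qed.

Lemma V_pdf0 (M V : Rn R n) : ~ D V -> k2 M V = 0.
Proof. by move=> DV; rewrite /V_pdf gig_prod_pdf0. Qed.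

(** Conjugacy in one coordinate: (x - mu v)^2 / (sigma^2 v) expands into a term in 1/v added to [b],
    a term in v added to [a], and a cross term free of v, while v^(-1/2) lowers the index by 1/2. *)
Lemma prior_conditional (x v : R) : 0 < v ->
  (Num.sqrt (2 * pi * (sigma ^+ 2 * v)))^-1 * expR (- 2^-1 * ((x - mu * v) ^+ 2 / (sigma ^+ 2 * v))) *
    gig_kernel p a b v =
  (Num.sqrt (2 * pi * sigma ^+ 2))^-1 * expR (mu * x / sigma ^+ 2) *
    gig_kernel (p - 2^-1) ta (b + x ^+ 2 / sigma ^+ 2) v.
Proof.
move=> v0; rewrite /gig_kernel v0 mulrA sqrtrM; last by rewrite !mulr_ge0 ?pi_ge0// ltW.
rewrite invfM -(powR12_sqrt (ltW v0)) -powRN.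
have -> : v `^ (p - 2^-1 - 1) = v `^ (p - 1) * v `^ (- 2^-1).
  by rewrite -powRD; [congr (_ `^ _); ring|rewrite (gt_eqF v0) implybT].
set c := (Num.sqrt _)^-1; set u1 := v `^ (p - 1); set u2 := v `^ _.
transitivity (c * u1 * u2 * (expR (- 2^-1 * ((x - mu * v) ^+ 2 / (sigma ^+ 2 * v))) *
  expR (- 2^-1 * (a * v + b / v)))); first by ring.
transitivity (c * u1 * u2 * (expR (mu * x / sigma ^+ 2) *
  expR (- 2^-1 * (ta * v + (b + x ^+ 2 / sigma ^+ 2) / v)))); last by ring.
rewrite -!expRD; congr (_ * expR _).
by rewrite /tilde_a; field; rewrite !gt_eqF.
Qed.

Lemma joint_pdf_V : exists e : Rn R n -> R, (forall M, 0 <= e M) /\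
  forall M V, E M -> J M V = e M * k2 M V.
Proof.
pose f (M : Rn R n) (i : 'I_n) := (Num.sqrt (2 * pi * sigma ^+ 2))^-1 * expR (mu * tnth M i / sigma ^+ 2) / gw p a b *
  gw (p - 2^-1) ta (bM M i).
exists (fun M => mvn_pdf (X *m beta + B *m (vcol M - mu *: h)) (sigma_eps ^+ 2)%:M Y * \prod_i f M i).
split.
  move=> M; rewrite mulr_ge0 ?mvn_pdf_ge0//; apply: prodr_ge0 => i _.
  by rewrite !mulr_ge0 ?expR_ge0 ?gw_ge0 ?invr_ge0 ?sqrtr_ge0 ?gw_ge0.
move=> M V EM; have [DV|DV] := pselect (D V); last by rewrite joint_pdf0// V_pdf0// mulr0.
have V0 i : 0 < tnth V i by have := DV i; rewrite mxE.
rewrite /joint_pdf -[LHS]mulrA -[RHS]mulrA; congr (_ * _).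
have -> : sigma ^+ 2 *: diag_mx (vcol V)^T = diag_mx (sigma ^+ 2 *: vcol V)^T.
  by apply/matrixP => i j; rewrite !mxE mulrnAr.
rewrite mvn_pdf_diag; last by move=> i; rewrite !mxE mulr_gt0.
rewrite -!big_split /=; apply: eq_bigr => i _; rewrite !gig_pdfE !mxE.
have g1 := gw_gt0 gig_fin_prior; have g2 := gw_gt0 (gig_fin_conditional (bM_gt0 i EM)).
rewrite [LHS]mulrA prior_conditional// /f.
set c0 := (Num.sqrt _)^-1; set c1 := expR _; set c2 := gig_kernel _ _ _ _; set c3 := gw p a b in g1 *.
set c4 := gw _ _ _ in g2 *.
by field; rewrite !gt_eqF.
Qed.

End gibbs_kernels.

(** * Drift and minorization *)

Section gibbs_drift.
Context {R : realType} (m n q : nat).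
Variables (A : 'M[R]_(m, n)) (K : 'M[R]_n) (X : 'M[R]_(m, q)) (beta : 'cV[R]_q).
Variables (h : 'cV[R]_n) (mu sigma sigma_eps p a b : R) (Y : 'cV[R]_m).
Hypotheses (sigma_gt0 : 0 < sigma) (sigma_eps_gt0 : 0 < sigma_eps).
Hypothesis gig_pab : gig_params p a b.

Local Notation leb := (lebesgue_Rn R n).
Local Notation B := (A *m invmx K).
Local Notation rho := (sigma ^+ 2 * sigma_eps ^- 2).
Local Notation w := (Y - X *m beta + mu *: (B *m h)).
Local Notation mbar := (rho *: (B^T *m w) + mu *: const_mx 1).
Local Notation Qbar V := (qbar B rho (vcol V)).
Local Notation ta := (tilde_a mu sigma a).
Local Notation bM M i := (b + (tnth M i : R) ^+ 2 / sigma ^+ 2).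
Local Notation D := [set V : Rn R n | pos_vec (vcol V)].
Local Notation E := [set M : Rn R n | forall i, tnth M i != 0 :> R].
Local Notation k1 := (M_pdf A K X beta h mu sigma sigma_eps Y).
Local Notation k2 := (V_pdf mu sigma p a b).
Local Notation J := (joint_pdf A K X beta h mu sigma sigma_eps p a b Y).
Local Notation p' := (p - 2^-1).
Local Notation mean V := (invmx (Qbar V) *m mbar).

Let rho0 : 0 < rho. Proof. by rewrite divr_gt0 ?exprn_gt0. Qed.
Let s20 : 0 < sigma ^+ 2. Proof. exact: exprn_gt0. Qed.

(** The Gaussian density of Y is bounded by a constant, and the other factors form the prior law of
    (M, V), of mass 1. *)
Lemma joint_pdf_lty : (\int[leb]_V \int[leb]_M (J M V)%:E < +oo)%E.
Proof.
have pY : posdef ((sigma_eps ^+ 2)%:M : 'M[R]_m) by apply: posdef_scalar; exact: exprn_gt0.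
set cY := (Num.sqrt ((2 * pi) ^+ m * \det ((sigma_eps ^+ 2)%:M : 'M[R]_m)))^-1.
have cY0 : 0 <= cY by rewrite invr_ge0 sqrtr_ge0.
have mg : measurable_fun setT (fun V : Rn R n => gig_prod_pdf p a (fun=> b) V).
  by apply: (@measurable_gig_prod_pdf R _ (Rn R n) n _ _ (fun i u => b) id).
have mJ := measurable_joint_pdf A K X beta h mu sigma sigma_eps p a b Y.
have mJ' : measurable_fun setT (fun u : Rn R n * Rn R n => (J u.2 u.1)%:E).
  by apply/measurable_EFinP; exact: (measurableT_comp mJ (@measurable_swap _ _ (Rn R n) (Rn R n))).
have J0 M V : 0 <= J M V by rewrite !mulr_ge0 ?mvn_pdf_ge0 ?gig_prod_pdf_ge0.
apply: (@le_lt_trans _ _ (\int[leb]_V (cY * gig_prod_pdf p a (fun=> b) V)%:E)%E); last first.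
  rewrite ge0_integralZ_EFin//; last by move=> V; exact: gig_prod_pdf_ge0.
  rewrite integral_gig_prod_pdf; last by move=> i; exact: gig_fin_prior.
  by rewrite mule1 ltry.
apply: ge0_le_integral => //.
- by move=> V _; apply: integral_ge0 => M _; rewrite lee_fin.
- by apply: (@measurable_integral _ _ _ leb (fun V M => (J M V)%:E)) => // V M; rewrite lee_fin.
- by apply/measurable_EFinP; apply: measurable_funM.
move=> V _; have [DV|DV] := pselect (D V); last first.
  rewrite integral0_eq; first by rewrite lee_fin mulr_ge0// gig_prod_pdf_ge0.
  by move=> M _; rewrite joint_pdf0.
have pV : posdef (sigma ^+ 2 *: diag_mx (vcol V)^T) by apply: posdef_scale => //; exact: diag_posdef.
rewrite -[leRHS]mule1 -(integral_mvn_pdf (mu *: vcol V) pV) -ge0_integralZ_EFin; last 3 first.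
- by rewrite mulr_ge0// gig_prod_pdf_ge0.
- exact: measurable_mvn_pdf.
- by move=> M; exact: mvn_pdf_ge0.
apply: ge0_le_integral_EFin => //.
- by apply/measurable_EFinP; exact: (@measurable_section1 _ _ _ (fun u => (J u.2 u.1)%:E)).
- by apply: measurable_funM => //; exact: measurable_mvn_pdf.
- move=> M; rewrite /joint_pdf mulrAC.
  rewrite ler_wpM2r ?mvn_pdf_ge0// ler_wpM2r ?gig_prod_pdf_ge0//.
  exact: mvn_pdf_le.
Qed.

(** The kernel and its normalizing integral both decrease in b_i. For b_i in [lo, hi] the density is
    thus at least the kernel at [hi] over the integral at [lo], a fixed multiple of the GIG density
    at [hi]; [G] is the product of these multiples. *)
Lemma gibbs_ergodic (L F : Rn R n -> R) (lam C : R) : 0 <= lam < 1 ->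
  drift_pair leb k1 k2 D E L F lam C ->
  (forall r : R, exists lo hi : R, 0 < lo /\ forall M i, E M -> F M <= r -> lo <= bM M i <= hi) ->
  exists post : probability (Rn R n) R,
    has_posterior_density A K X beta h mu sigma sigma_eps p a b Y post /\
    geometrically_ergodic
      (gibbs_operator A K X beta h mu sigma sigma_eps p a b Y) post.
Proof.
move=> lam01 dp H.
have [c [c0 J1]] := joint_pdf_M A K X beta h mu Y sigma_gt0 sigma_eps_gt0 gig_pab.
have [e [e0 J2]] := joint_pdf_V A K X beta h mu sigma_eps Y sigma_gt0 gig_pab.
have mk1 := measurable_M_pdf A K X beta h mu sigma sigma_eps Y.
have mk2 := @measurable_V_pdf R n mu sigma p a b.
have mJ := measurable_joint_pdf A K X beta h mu sigma sigma_eps p a b Y.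
have J0 M V : 0 <= J M V by rewrite !mulr_ge0 ?mvn_pdf_ge0 ?gig_prod_pdf_ge0.
have k10 V M : 0 <= k1 V M by exact: mvn_pdf_ge0.
have k20 (M V : Rn R n) : 0 <= k2 M V by exact: gig_prod_pdf_ge0.
have k11 V : D V -> (\int[leb]_M (k1 V M)%:E = 1)%E by exact: integral_M_pdf.
have k21 M : E M -> (\int[leb]_W (k2 M W)%:E = 1)%E by exact: integral_V_pdf.
have JN M V : ~ D V -> J M V = 0 by exact: joint_pdf0.
have k2N M V : ~ D V -> k2 M V = 0 by exact: V_pdf0.
exists (posterior (@measurable_pos R n) (pos_gt0 n) mk1 mJ k10 J0 k11 c0 J1 JN joint_pdf_lty); split; first by [].
have dp' : drift_pair leb k1 k2 D E L F lam (`|C| + 1).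
  have [mL L0 mF F0 [d1 d2]] := dp; split => //; split => // V DV.
  apply: (le_trans (d2 V DV)); rewrite lee_fin lerD2l.
  by apply: (le_trans (ler_norm C)); rewrite lerDl.
have C1 : 0 < `|C| + 1 by rewrite ltr_wpDl.
have := (two_block_ergodic (@measurable_pos R n) (@measurable_nonzero R n) (nonzero_conull n)
  (pos_gt0 n) mk1 mk2 mJ k10 k20 J0 k11 k21 k2N c0 e0 J1 JN J2 joint_pdf_lty lam01 C1 dp').
apply.
move=> r; have [lo [hi0 [lo0 hM]]] := H r.
(* If the sublevel set of [F] is empty, nothing forces lo <= hi0. *)
pose hi := Num.max lo hi0.
have hi1 : 0 < hi by rewrite lt_max lo0.
have lohi : lo <= hi by rewrite le_max lexx.
have fin (x : R) : 0 < x -> gig_fin p' ta x by exact: (gig_fin_conditional _ _ gig_pab).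
pose G := (gw p' ta hi / gw p' ta lo) ^+ n.
have G0 : 0 < G by rewrite exprn_gt0// divr_gt0//; exact/gw_gt0/fin.
have mg : measurable_fun setT (fun V : Rn R n => gig_prod_pdf p' ta (fun=> hi) V).
  by apply: (@measurable_gig_prod_pdf R _ (Rn R n) n _ _ (fun i u => hi) id).
exists (fun W => G * gig_prod_pdf p' ta (fun=> hi) W), G; split => //.
- exact: measurable_funM.
- by move=> W; rewrite mulr_ge0 ?(ltW G0)// gig_prod_pdf_ge0.
- split => //; rewrite ge0_integralZ_EFin ?(ltW G0)//; last by move=> V; exact: gig_prod_pdf_ge0.
  by rewrite integral_gig_prod_pdf ?mule1// => i; exact: fin.
- by move=> W DW; rewrite gig_prod_pdf0// mulr0.
- move=> M W EM FM; rewrite /G (_ : _ ^+ n = \prod_(i < n) (gw p' ta hi / gw p' ta lo)); last first.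
    by rewrite prodr_const card_ord.
  rewrite -big_split /=; apply: ler_prod => i _.
  have /andP[l1 l2] := hM M i EM FM.
  have bhi : bM M i <= hi by rewrite le_max l2 orbT.
  have b0 := lt_le_trans lo0 l1.
  apply/andP; split; first by apply: mulr_ge0; [apply: divr_ge0; exact: gw_ge0|exact: gig_pdf_ge0].
  rewrite !gig_pdfE.
  have gh := gw_gt0 (fin _ hi1); have gl := gw_gt0 (fin _ lo0); have gb := gw_gt0 (fin _ b0).
  rewrite (_ : _ / _ * _ = gig_kernel p' ta hi (tnth W i) / gw p' ta lo); last first.
    by move: gh gl; set g1 := gw _ _ hi; set g2 := gw _ _ lo; set g3 := gig_kernel _ _ _ _ => ? ?; field; rewrite !gt_eqF.
  apply: ler_pM; rewrite ?gig_kernel_ge0 ?invr_ge0 ?gw_ge0//; first exact: gig_kernel_le.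
  by rewrite lef_pV2 ?posrE//; apply: gw_le => //; exact: fin.
Qed.

(** The variance 1/t is at most sigma^2 V_i because [Qbar] dominates the inverse of D_V; [t] itself
    is at most the diagonal entry of the precision matrix. The first bound serves the positive
    moments, the second the negative ones. *)
Lemma M_marginal (V : Rn R n) i : D V -> exists t : R, [/\ 0 < t, t^-1 <= sigma ^+ 2 * tnth V i,
  t <= (sigma ^+ 2)^-1 * (rho * (\sum_k B k i ^+ 2) + (tnth V i)^-1) &
  forall g : measurableTypeR R -> R, measurable_fun setT g -> (forall x, 0 <= g x) ->
    (\int[leb]_M ((k1 V M)%:E * (g (tnth M i))%:E) =
     (gw 2^-1 t 0)^-1%:E * \int[@lebesgue_measure R]_x (g x * gauss_shape t (mean V i 0) x)%:E)%E].
Proof.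
move=> DV; have pS := qbar_cov_posdef A K sigma_gt0 sigma_eps_gt0 DV.
have pQ := @qbar_posdef R m n B rho rho0 _ DV; have uQ := posdef_unit pQ.
have V0 : 0 < tnth V i by have := DV i; rewrite mxE.
have [t [t0 tle tge tI]] := mvn_marginal i pS.
have iS : invmx (sigma ^+ 2 *: invmx (Qbar V)) = (sigma ^+ 2)^-1 *: Qbar V.
  by rewrite invmxZ ?gt_eqF// ?unitmx_inv// invmxK.
exists t; split => //.
- have : (sigma ^+ 2 * tnth V i)^-1 <= t.
    apply: tge => x; rewrite iS qfZ invfM -mulrA ler_wpM2l ?invr_ge0 ?(ltW s20)//.
    by have := @qbar_ge R m n B rho rho0 _ x i DV; rewrite mxE.
  by move=> ht; rewrite -[leRHS]invrK lef_pV2 ?posrE// invr_gt0 mulr_gt0.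
- by move: tle; rewrite iS mxE qbar_diag// mxE.
- move=> g mg g0; rewrite -tI//; apply: eq_integral => M _.
  by rewrite -EFinM mulrC.
Qed.

Local Notation half_ratio s := (gw (2^-1 + s) 1 0 / gw 2^-1 1 0).

Lemma M_moment (V : Rn R n) i (g : measurableTypeR R -> R) (bd : R -> R) : D V ->
  measurable_fun setT g -> (forall x, 0 <= g x) ->
  (forall t, 0 < t -> (\int[@lebesgue_measure R]_x (g x * gauss_shape t (mean V i 0) x)%:E <=
    (bd t * gw 2^-1 t 0)%:E)%E) ->
  exists t : R, [/\ 0 < t, t^-1 <= sigma ^+ 2 * tnth V i,
  t <= (sigma ^+ 2)^-1 * (rho * (\sum_k B k i ^+ 2) + (tnth V i)^-1) &
  (\int[leb]_M ((k1 V M)%:E * (g (tnth M i))%:E) <= (bd t)%:E)%E].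
Proof.
move=> DV mg g0 hb; have [t [t0 t1 t2 tI]] := M_marginal i DV.
have gp : 0 < gw (2^-1 : R) t 0 by apply/gw_gt0/gig_fin_gauss => //; rewrite invr_gt0.
exists t; split => //; rewrite tI//.
apply: (@le_trans _ _ ((gw 2^-1 t 0)^-1%:E * (bd t * gw 2^-1 t 0)%:E)%E).
  by apply: lee_wpmul2l; [rewrite lee_fin invr_ge0 ltW|exact: hb].
by rewrite -EFinM mulrCA mulVf ?mulr1// gt_eqF.
Qed.

Lemma M_second_moment (V : Rn R n) i e : D V -> 0 < e ->
  (\int[leb]_M ((k1 V M)%:E * (tnth M i ^+ 2)%:E) <=
   ((1 + e) * mean V i 0 ^+ 2 + (1 + e^-1) * half_ratio 1 * (sigma ^+ 2 * tnth V i))%:E)%E.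
Proof.
move=> DV e0.
have [|||t [t0 t1 _ hI]] := @M_moment V i (fun x => x ^+ 2)
  (fun t => (1 + e) * mean V i 0 ^+ 2 + (1 + e^-1) * half_ratio 1 / t) DV.
- exact: measurable_funX.
- by move=> x; exact: sqr_ge0.
- by move=> t t0; exact: gauss_second_moment.
apply: (le_trans hI); rewrite lee_fin lerD2l ler_wpM2l// mulr_ge0 ?divr_ge0 ?gw_ge0//.
by rewrite addr_ge0// invr_ge0 ltW.
Qed.

Lemma M_pos_moment (V : Rn R n) i s : D V -> 0 < s <= 2^-1 ->
  (\int[leb]_M ((k1 V M)%:E * (`|tnth M i : R| `^ (2 * s))%:E) <=
   (`|mean V i 0| `^ (2 * s) + (sigma ^+ 2) `^ s * tnth V i `^ s * half_ratio s)%:E)%E.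
Proof.
move=> DV /andP[sp s1].
have [|||t [t0 t1 _ hI]] := @M_moment V i (fun x => `|x| `^ (2 * s))
  (fun t => `|mean V i 0| `^ (2 * s) + t `^ (- s) * half_ratio s) DV.
- by mfun.
- by move=> x; exact: powR_ge0.
- by move=> t t0; apply: gauss_pos_moment => //; rewrite sp.
have V0 : 0 < tnth V i by have := DV i; rewrite mxE.
apply: (le_trans hI); rewrite lee_fin lerD2l ler_wpM2r ?divr_ge0 ?gw_ge0//.
rewrite -powRM ?(ltW s20) ?(ltW V0)// powRN -powR_inv1 ?powR_ge0// -powRrM mulrC powRrM powR_inv1 ?(ltW t0)//.
by apply: ge0_ler_powR => //; rewrite ?nnegrE ?invr_ge0 ?mulr_ge0 ?ltW.
Qed.

Lemma M_neg_moment (V : Rn R n) i s : D V -> 0 < s < 2^-1 ->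
  (\int[leb]_M ((k1 V M)%:E * (`|tnth M i : R| `^ (- (2 * s)))%:E) <=
   ((sigma ^+ 2)^-1 `^ s * ((rho * (\sum_k B k i ^+ 2)) `^ s + tnth V i `^ (- s)) *
     half_ratio (- s))%:E)%E.
Proof.
move=> DV /andP[sp s1].
have [|||t [t0 _ t1 hI]] := @M_moment V i (fun x => `|x| `^ (- (2 * s)))
  (fun t => t `^ s * half_ratio (- s)) DV.
- by mfun.
- by move=> x; exact: powR_ge0.
- by move=> t t0; apply: gauss_neg_moment => //; rewrite sp.
have V0 : 0 < tnth V i by have := DV i; rewrite mxE.
have r0 : 0 <= rho * (\sum_k B k i ^+ 2).
  by rewrite mulr_ge0 ?(ltW rho0)//; apply: sumr_ge0 => k _; exact: sqr_ge0.
apply: (le_trans hI); rewrite lee_fin ler_wpM2r ?divr_ge0 ?gw_ge0//.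
apply: (@le_trans _ _ (((sigma ^+ 2)^-1 * (rho * (\sum_k B k i ^+ 2) + (tnth V i)^-1)) `^ s)).
  apply: ge0_ler_powR; rewrite ?nnegrE ?(ltW t0) ?(ltW sp)//.
  by rewrite mulr_ge0 ?invr_ge0 ?addr_ge0 ?invr_ge0 ?(ltW s20) ?(ltW V0).
rewrite [leLHS]powRM ?invr_ge0 ?addr_ge0 ?invr_ge0 ?(ltW s20) ?(ltW V0)//.
rewrite ler_wpM2l ?powR_ge0//.
have -> : tnth V i `^ (- s) = (tnth V i)^-1 `^ s.
  by rewrite -(powR_inv1 (ltW V0)) -powRrM mulN1r.
apply: powRD_le => //; first by rewrite invr_ge0 ltW.
by rewrite sp/=; lra.
Qed.

Definition moment_sum s (W : Rn R n) : R := \sum_i tnth W i `^ s.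

(** Given M the coordinates of V~ are independent and the law of the i-th depends on M_i only. A
    drift condition for a sum of powers thus reduces to a GIG moment bounded by c1 g(M_i) + c0, a
    Gaussian moment bounded by [psi], and a summation. *)
Lemma gibbs_drift_moment s (g : measurableTypeR R -> R) (c1 c0 lam C : R) (psi : Rn R n -> 'I_n -> R) :
  0 <= c1 -> 0 <= c0 -> measurable_fun setT g -> (forall x, 0 <= g x) ->
  (forall x : R, x != 0 -> gig_fin (p' + s) ta (b + x ^+ 2 / sigma ^+ 2) /\
    gw (p' + s) ta (b + x ^+ 2 / sigma ^+ 2) <= (c1 * g x + c0) * gw p' ta (b + x ^+ 2 / sigma ^+ 2)) ->
  (forall V i, D V -> (\int[leb]_M ((k1 V M)%:E * (g (tnth M i))%:E) <= (psi V i)%:E)%E) ->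
  (forall V, D V -> \sum_i (c1 * psi V i + c0) <= lam * moment_sum s V + C) ->
  drift_pair leb k1 k2 D E (moment_sum s) (fun M => \sum_i (c1 * g (tnth M i) + c0)) lam C.
Proof.
move=> c10 c00 mg g0 hV hM hs.
have mt i : measurable_fun setT (fun M : Rn R n => g (tnth M i)).
  by apply: (measurableT_comp mg); exact: measurable_tnth.
have mk1 V : measurable_fun setT (k1 V).
  by apply: measurable_mvn_pdf.
have mk2 (M : Rn R n) : measurable_fun setT (k2 M).
  by apply: (@measurable_gig_prod_pdf R _ (Rn R n) n _ _ (fun i u => bM M i) id).
have mp i : measurable_fun setT (fun W : Rn R n => tnth W i `^ s).
  by apply: measurable_fun_powR; exact: measurable_tnth.
split.
- by apply: measurable_sum.
- by move=> W; apply: sumr_ge0 => i _; exact: powR_ge0.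
- by apply: measurable_sum => i; apply: measurable_funD => //; exact: measurable_funM.
- by move=> M; apply: sumr_ge0 => i _; rewrite addr_ge0// mulr_ge0.
split.
- move=> M EM.
  have fi i : gig_fin p' ta (bM M i) by apply: (gig_fin_conditional _ _ gig_pab); exact: (bM_gt0 sigma_gt0 gig_pab i EM).
  have -> : (\int[leb]_W ((k2 M W)%:E * (moment_sum s W)%:E) =
    \sum_(i < n) \int[leb]_W (k2 M W * tnth W i `^ s)%:E)%E.
    rewrite -ge0_integral_sum//; last 2 first.
    + by move=> i; apply/measurable_EFinP; exact: measurable_funM.
    + by move=> i W _; rewrite lee_fin mulr_ge0 ?powR_ge0 ?gig_prod_pdf_ge0.
    by apply: eq_integral => W _; rewrite /moment_sum -EFinM mulr_sumr sumEFin.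
  rewrite -sumEFin; apply: lee_sum => i _.
  have [f2 le2] := hV _ (EM i).
  rewrite gig_prod_moment// lee_fin ler_pdivrMr ?gw_gt0//.
- move=> V DV.
  have e i : (\int[leb]_M (k1 V M * (c1 * g (tnth M i) + c0))%:E <= (c1 * psi V i + c0)%:E)%E.
    have -> : (\int[leb]_M (k1 V M * (c1 * g (tnth M i) + c0))%:E =
      \int[leb]_M (c1 * (k1 V M * g (tnth M i)) + c0 * k1 V M)%:E)%E.
      by apply: eq_integral => M _; congr EFin; ring.
    have k10 M : 0 <= k1 V M by exact: mvn_pdf_ge0.
    rewrite ge0_integralD_EFin; last 4 first.
    + by do 2 apply: measurable_funM => //.
    + exact: measurable_funM.
    + by move=> M; rewrite !mulr_ge0.
    + by move=> M; rewrite mulr_ge0.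
    rewrite (@ge0_integralZ_EFin _ _ _ leb c1 (fun M => k1 V M * g (tnth M i)))//; last 2 first.
    + exact: measurable_funM.
    + by move=> M; rewrite mulr_ge0.
    rewrite (@ge0_integralZ_EFin _ _ _ leb c0 (k1 V))//.
    rewrite integral_M_pdf// mule1 EFinD leeD2r// EFinM; apply: lee_wpmul2l; first by rewrite lee_fin.
    exact: hM.
  apply: (@le_trans _ _ (\sum_(i < n) (c1 * psi V i + c0)%:E)%E); last first.
    by rewrite sumEFin lee_fin; exact: hs.
  apply: (@le_trans _ _ (\sum_(i < n) \int[leb]_M (k1 V M * (c1 * g (tnth M i) + c0))%:E)%E); last first.
    by apply: lee_sum => i _.
  rewrite -ge0_integral_sum//; last 2 first.
  + by move=> i; apply/measurable_EFinP; apply: measurable_funM => //; apply: measurable_funD => //; exact: measurable_funM.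
  + by move=> i M _; rewrite lee_fin mulr_ge0 ?mvn_pdf_ge0// addr_ge0// mulr_ge0.
  rewrite le_eqVlt; apply/orP; left; apply/eqP; apply: eq_integral => M _.
  by rewrite -EFinM mulr_sumr sumEFin.
Qed.

End gibbs_drift.

Section real_inequalities.
Context {R : realType}.
Implicit Types x y s t : R.

Lemma sqr_powR x s : (x ^+ 2) `^ s = `|x| `^ (2 * s).
Proof. by rewrite -real_normK ?num_real// -powR_mulrn// -powRrM. Qed.

Lemma powR_le_inv x s y : 0 <= x -> 0 < s -> x `^ s <= y -> x <= y `^ s^-1.
Proof.
move=> x0 s0 xy; have e : x = (x `^ s) `^ s^-1.
  by rewrite -powRrM mulfV ?gt_eqF// powRr1.
rewrite e; apply: ge0_ler_powR => //; rewrite ?nnegrE ?powR_ge0 ?invr_ge0 ?(ltW s0)//.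
exact: le_trans (powR_ge0 _ _) xy.
Qed.

Lemma powR_sqr_div x t s : 0 < t -> (x ^+ 2 / t) `^ s = t `^ (- s) * `|x| `^ (2 * s).
Proof.
move=> t0; rewrite powRM ?sqr_ge0 ?invr_ge0 ?(ltW t0)// sqr_powR mulrC.
by rewrite -(powR_inv1 (ltW t0)) -powRrM mulN1r.
Qed.

Lemma sum_term_le (I : finType) (f : I -> R) (r : R) i : (forall j, 0 <= f j) ->
  \sum_j f j <= r -> f i <= r.
Proof.
move=> f0; apply: le_trans; rewrite (bigD1 i)//= lerDl.
by apply: sumr_ge0 => j _.
Qed.

Lemma natr_mul_sum k (x : R) : k%:R * x = \sum_(i < k) x.
Proof. by rewrite sumr_const card_ord mulr_natl. Qed.

Lemma small_perturbation q t : 0 <= q < 1 -> 0 < t -> exists2 e, 0 < e &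
  (1 + e) ^+ 3 * ((1 + e) * q + e / t) + e < 1.
Proof.
(* For e <= 1, (1 + e)^4 <= 1 + 15 e and (1 + e)^3 <= 8, so the left side exceeds q by at most k e;
   [e] makes this at most (1 - q) / 2. *)
move=> /andP[q0 q1] t0; pose k := 16 + 8 / t.
have t80 : 0 < 8 / t by rewrite divr_gt0.
have k0 : 0 < k by rewrite addr_gt0.
pose e := Num.min 1 ((1 - q) / (2 * k)).
have e0 : 0 < e by rewrite lt_min ltr01 divr_gt0 ?mulr_gt0// subr_gt0.
have e1 : e <= 1 by rewrite ge_min lexx.
have ek : e * k <= (1 - q) / 2.
  have : e <= (1 - q) / (2 * k) by rewrite ge_min lexx orbT.
  by rewrite invfM mulrA ler_pdivlMr.
exists e => //.
have h3 : (1 + e) ^+ 3 <= 8 by nra.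
have h4 : (1 + e) ^+ 4 <= 1 + 15 * e by nra.
have et : 0 <= e / t by rewrite divr_ge0// ltW.
have a1 : (1 + e) ^+ 3 * (e / t) <= 8 * (e / t) by rewrite ler_wpM2r.
have a2 : (1 + e) ^+ 4 * q <= (1 + 15 * e) * q by rewrite ler_wpM2r.
have a3 : e * k = 16 * e + 8 * (e / t) by rewrite /k; ring.
have a4 : e * q <= e by rewrite ler_piMr// ltW.
have -> : (1 + e) ^+ 3 * ((1 + e) * q + e / t) = (1 + e) ^+ 4 * q + (1 + e) ^+ 3 * (e / t) by ring.
by lra.
Qed.

End real_inequalities.

(** * Drift conditions in the three regimes *)

Section gibbs_regimes.
Context {R : realType} (m n q : nat).
Variables (A : 'M[R]_(m, n)) (K : 'M[R]_n) (X : 'M[R]_(m, q)) (beta : 'cV[R]_q).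
Variables (h : 'cV[R]_n) (mu sigma sigma_eps p a b : R) (Y : 'cV[R]_m).
Hypotheses (sigma_gt0 : 0 < sigma) (sigma_eps_gt0 : 0 < sigma_eps).
Hypothesis gig_pab : gig_params p a b.

Local Notation leb := (lebesgue_Rn R n).
Local Notation B := (A *m invmx K).
Local Notation rho := (sigma ^+ 2 * sigma_eps ^- 2).
Local Notation w := (Y - X *m beta + mu *: (B *m h)).
Local Notation mbar := (rho *: (B^T *m w) + mu *: const_mx 1).
Local Notation Qbar V := (qbar B rho (vcol V)).
Local Notation ta := (tilde_a mu sigma a).
Local Notation bM M i := (b + (tnth M i : R) ^+ 2 / sigma ^+ 2).
Local Notation D := [set V : Rn R n | pos_vec (vcol V)].
Local Notation E := [set M : Rn R n | forall i, tnth M i != 0 :> R].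
Local Notation k1 := (M_pdf A K X beta h mu sigma sigma_eps Y).
Local Notation k2 := (V_pdf mu sigma p a b).
Local Notation p' := (p - 2^-1).
Local Notation mean V := (invmx (Qbar V) *m mbar).
Local Notation half_ratio s := (gw (2^-1 + s) 1 0 / gw 2^-1 1 0).

Let rho0 : 0 < rho. Proof. by rewrite divr_gt0 ?exprn_gt0. Qed.
Let s20 : 0 < sigma ^+ 2. Proof. exact: exprn_gt0. Qed.
Let b0 : 0 <= b. Proof. exact: (b_ge0 gig_pab). Qed.

Let fin10 (l : R) : 0 < l -> gig_fin l 1 0.
Proof. by move=> l0; apply: gig_fin_gauss. Qed.

Let half0 : 0 < 2^-1 :> R. Proof. by rewrite invr_gt0. Qed.

Lemma drift_inverse_gamma : a = 0 -> mu = 0 -> exists s c1 c0 lam C : R,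
  [/\ 0 < s, 0 < c1, 0 <= c0, 0 <= lam < 1 &
  drift_pair leb k1 k2 D E (moment_sum s)
    (fun M => \sum_i (c1 * `|tnth M i : R| `^ (2 * s) + c0)) lam C].
Proof.
move=> a0 mu0.
have [bp pn] : 0 < b /\ p < 0.
  by case: gig_pab => [[]|[]|[]]; rewrite a0 ?ltxx.
have ta0 : ta = 0 by rewrite /tilde_a a0 mu0 expr0n /= mul0r addr0.
(* s < -p yields 1/2 < -p' - s, the strict inequality behind [lam1]; s <= 1/4 keeps 2s below 1, for
   the subadditivity of |x|^(2s). *)
pose s := Num.min 4^-1 (- p / 2).
have sp : 0 < s by rewrite lt_min invr_gt0 ltr0n/= divr_gt0// oppr_gt0.
have s4 : s <= 4^-1 by rewrite ge_min lexx.
have sle : s <= - p / 2 by rewrite ge_min lexx orbT.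
have n1 : 0 < - p' - s by lra.
have n2 : 0 < - p' by lra.
have n3 : 0 < 2^-1 + s by rewrite addr_gt0.
pose ka1 := gw (- p' - s) 1 0 / gw (- p') 1 0.
pose ka2 := half_ratio s.
have g1 := gw_gt0 (fin10 n1); have g2 := gw_gt0 (fin10 n2).
have g3 := gw_gt0 (fin10 n3); have g4 := gw_gt0 (fin10 half0).
have ka10 : 0 < ka1 by rewrite divr_gt0.
have ka20 : 0 < ka2 by rewrite divr_gt0.
(* [ka2] is the moment ratio at index 1/2 and [ka1] the inverse of the ratio at the larger index -p'
   - s. The powers of sigma^2 from the two half-steps cancel, so [lam] is exactly this product. *)
have lam1 : ka1 * ka2 < 1.
  have ll : 2^-1 < - p' - s by lra.
  have f4 : gig_fin (- p' - s + s) 1 0 by rewrite subrK; exact: fin10.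
  have [_ /(_ ll)] := gw_ratio_index sp (ltW ll) (fin10 half0) (fin10 n1) (fin10 n3) f4.
  rewrite subrK => hlt; rewrite /ka1 /ka2 mulrACA -invfM ltr_pdivrMr ?mulr_gt0// mul1r.
  by rewrite mulrC.
have [Cy [Cy0 hCy]] := @ridge_bounded R m n B rho rho0 w.
pose c1 := ka1 * (sigma ^+ 2) `^ (- s); pose c0 := ka1 * b `^ s.
have c10 : 0 < c1 by rewrite mulr_gt0// powR_gt0.
have c00 : 0 <= c0 by rewrite mulr_ge0 ?powR_ge0// ltW.
exists s, c1, c0, (ka1 * ka2), (n%:R * (c1 * Cy `^ s + c0)); split => //.
  by rewrite mulr_ge0 ?ltW.
apply: (@gibbs_drift_moment _ _ _ _ A K X beta h mu sigma sigma_eps p a b Y _ _ _ s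
  (fun x => `|x| `^ (2 * s)) c1 c0 _ _
  (fun V i => Cy `^ s + (sigma ^+ 2) `^ s * tnth V i `^ s * ka2)) => //.
- exact: ltW.
- by mfun.
- move=> x x0; have c0' : 0 <= x ^+ 2 / sigma ^+ 2 by rewrite divr_ge0 ?sqr_ge0// ltW.
  have cp : 0 < b + x ^+ 2 / sigma ^+ 2 by rewrite ltr_wpDr.
  rewrite ta0; split; first by split; rewrite ?lexx ?(ltW cp) ?cp ?ltxx//=; lra.
  rewrite gw_a0//; last 2 first.
  + by lra.
  + by lra.
  rewrite -[X in X * _ <= _]mulrA -/ka1 ler_wpM2r ?gw_ge0// /c1 /c0 -mulrA -mulrDr mulrC ler_wpM2l ?(ltW ka10)//.
  rewrite -powR_sqr_div// addrC; apply: powRD_le => //.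
  by rewrite sp/=; lra.
- move=> V i DV; have s2 : 0 < s <= 2^-1 by rewrite sp/=; lra.
  apply: le_trans; first exact: M_pos_moment s2.
  rewrite lee_fin lerD2r// -sqr_powR; apply: ge0_ler_powR; rewrite ?nnegrE ?sqr_ge0 ?(ltW sp)//.
  apply: (le_trans (sqr_le_dot _ i)).
  by have := hCy _ DV; rewrite mu0 !scale0r !addr0.
- move=> V DV; rewrite /moment_sum mulr_sumr natr_mul_sum -big_split /=.
  apply: ler_sum => i _; rewrite le_eqVlt; apply/orP; left; apply/eqP.
  have e : (sigma ^+ 2) `^ (- s) * (sigma ^+ 2) `^ s = 1.
    by rewrite -powRD ?addNr ?powRr0// (gt_eqF s20) implybT.
  transitivity (c1 * Cy `^ s + c0 + ka1 * ka2 * tnth V i `^ s * ((sigma ^+ 2) `^ (- s) * (sigma ^+ 2) `^ s)).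
    by rewrite /c1; ring.
  by rewrite e mulr1 addrC.
Qed.

(** With S = sigma^2 ta and N = |P 1|^2, the leading factors are (1 + e)^2 / S from the GIG second
    moment, 1 + e from the Gaussian one and (1 + e) mu^2 N + e from the mean. Their product is (1 +
    e)^3 ((1 + e) Q0 + e / S) with Q0 = mu^2 N / S < 1; the terms linear in V cost one more e. *)
Lemma drift_second_moment : K \in unitmx -> 0 < ta -> null_smallness A K mu sigma a ->
  exists c1 c0 lam C : R, [/\ 0 < c1, 0 <= c0, 0 <= lam < 1 &
  drift_pair leb k1 k2 D E (moment_sum 2)
    (fun M => \sum_i (c1 * (tnth M i : R) ^+ 2 + c0)) lam C].
Proof.
move=> uK ta0 small.
pose S := sigma ^+ 2 * a + mu ^+ 2.
have SE : S = sigma ^+ 2 * ta by rewrite /S /tilde_a; field; rewrite gt_eqF.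
have S0 : 0 < S by rewrite SE mulr_gt0.
have [P [T [Ps PT PN]]] := null_smallness_proj uK small S0.
set N := dot _ _ in PN.
have N0 : 0 <= N by exact: dot_ge0.
pose Q0 := mu ^+ 2 / S * N.
have Q00 : 0 <= Q0 by rewrite mulr_ge0// divr_ge0 ?sqr_ge0// ltW.
have [|e e0 he] := @small_perturbation R Q0 S _ S0; first by rewrite Q00.
have [C0 C00 hC0] := @gw_second_moment R p' ta e ta0 e0.
have [C1 [C10 hC1]] := @qbar_mean_le R m n B rho rho0 P T w mu e Ps PT e0.
pose c1 := (1 + e) ^+ 2 / S; pose c0 := (1 + e) ^+ 2 * (b / ta) + C0.
have e1 : 0 < 1 + e by rewrite addr_gt0.
have c10 : 0 < c1 by rewrite divr_gt0// exprn_gt0.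
have c00 : 0 <= c0 by rewrite addr_ge0// mulr_ge0 ?sqr_ge0// divr_ge0// ltW.
pose lam := (1 + e) ^+ 3 * ((1 + e) * Q0 + e / S) + e.
have lam0 : 0 <= lam.
  apply: addr_ge0; last exact: ltW.
  apply: mulr_ge0; first by rewrite exprn_ge0// ltW.
  by apply: addr_ge0; [apply: mulr_ge0 => //; exact: ltW|apply: divr_ge0; exact: ltW].
pose c2 := c1 * ((1 + e^-1) * half_ratio 1 * sigma ^+ 2).
exists c1, c0, lam, (lam + c1 * ((1 + e) * C1) + n%:R * ((4 * e)^-1 * c2 ^+ 2 + c0)); split => //.
  by rewrite lam0.
apply: (@gibbs_drift_moment _ _ _ _ A K X beta h mu sigma sigma_eps p a b Y _ _ _ 2
  (fun x => x ^+ 2) c1 c0 _ _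
  (fun V i => (1 + e) * mean V i 0 ^+ 2 + (1 + e^-1) * half_ratio 1 * (sigma ^+ 2 * tnth V i))) => //.
- exact: ltW.
- by move=> x; exact: sqr_ge0.
- move=> x x0; have cp : 0 < b + x ^+ 2 / sigma ^+ 2.
    by rewrite ltr_wpDl// divr_gt0// lt_neqAle eq_sym sqrf_eq0 x0 sqr_ge0.
  split; first by split; rewrite ?(ltW ta0) ?(ltW cp) ?ta0 ?cp.
  apply: (le_trans (hC0 _ (ltW cp) (gig_fin_conditional _ _ gig_pab cp))).
  rewrite ler_wpM2r ?gw_ge0// le_eqVlt; apply/orP; left; apply/eqP.
  by rewrite /c1 /c0 SE; field; rewrite !gt_eqF.
- by move=> V i DV; exact: M_second_moment.
- move=> V DV; have V0 i : 0 < tnth V i by have := DV i; rewrite mxE.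
  have mE : moment_sum 2 V = \sum_i tnth V i ^+ 2.
    by apply: eq_bigr => i _; rewrite powR_mulrn// ltW.
  set M2 := moment_sum 2 V in mE *.
  have M20 : 0 <= M2 by rewrite mE; apply: sumr_ge0 => i _; exact: sqr_ge0.
  (* An upper bound for all V_i whose square is the Lyapunov function up to the constant 1, which
     makes it positive. *)
  pose v := Num.sqrt (1 + M2).
  have v2 : v ^+ 2 = 1 + M2 by rewrite sqr_sqrtr// addr_ge0.
  have v0 : 0 < v by rewrite sqrtr_gt0 ltr_wpDr.
  have Vv i : vcol V i 0 <= v.
    rewrite mxE -(@ler_pXn2r _ 2)// ?nnegrE ?(ltW (V0 i)) ?(ltW v0)// v2 mE (bigD1 i)//= addrCA lerDl.
    by rewrite addr_ge0//; apply: sumr_ge0 => j _; exact: sqr_ge0.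
  have hm : dot (mean V) (mean V) <= ((1 + e) * mu ^+ 2 * N + e) * v ^+ 2 + C1.
    apply: (hC1 (vcol V)) => //; rewrite mulKVmx//.
    by apply/posdef_unit/qbar_posdef.
  have s1 : \sum_i (c1 * ((1 + e) * mean V i 0 ^+ 2 + (1 + e^-1) * half_ratio 1 * (sigma ^+ 2 * tnth V i)) + c0) <=
     c1 * ((1 + e) * dot (mean V) (mean V)) + e * M2 + n%:R * ((4 * e)^-1 * c2 ^+ 2 + c0).
    rewrite mE natr_mul_sum !mulr_sumr -!big_split /=.
    apply: ler_sum => i _; rewrite -expr2.
    have : c2 * tnth V i <= e * tnth V i ^+ 2 + (4 * e)^-1 * c2 ^+ 2.
      rewrite -subr_ge0 (_ : _ - _ = e * (tnth V i - c2 / (2 * e)) ^+ 2).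
        by rewrite mulr_ge0 ?sqr_ge0// ltW.
      by field; rewrite gt_eqF.
    have -> : c2 * tnth V i = c1 * ((1 + e^-1) * half_ratio 1 * (sigma ^+ 2 * tnth V i)) by rewrite /c2; ring.
    rewrite [c1 * (_ + _)]mulrDr; set X1 := c1 * (_ * (sigma ^+ 2 * _)).
    by set X2 := c1 * _; set X3 := (4 * e)^-1 * _; lra.
  apply: (le_trans s1); rewrite [in leRHS]addrA lerD2r.
  have : c1 * ((1 + e) * dot (mean V) (mean V)) <= c1 * ((1 + e) * (((1 + e) * mu ^+ 2 * N + e) * v ^+ 2 + C1)).
    by rewrite ler_wpM2l ?(ltW c10)// ler_wpM2l ?(ltW e1).
  have -> : c1 * ((1 + e) * (((1 + e) * mu ^+ 2 * N + e) * v ^+ 2 + C1)) =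
     (lam - e) * (1 + M2) + c1 * ((1 + e) * C1).
    by rewrite v2 /lam /c1 /Q0; field; rewrite gt_eqF.
  by lra.
Qed.

(** For small b the moment of order -s at index -m0 is about A1 b^(-s), and the Gaussian step
    multiplies by [ka]; A1 ka < 1 is the strict monotonicity of the ratio between the indices m0 and
    1/2 - s. *)
Lemma drift_negative_moment : 0 < a -> 0 < p -> b = 0 ->
  exists s c1 c0 lam C : R, [/\ 0 < s, 0 < c1, 0 <= c0, 0 <= lam < 1 &
  drift_pair leb k1 k2 D E (moment_sum (- s))
    (fun M => \sum_i (c1 * `|tnth M i : R| `^ (- (2 * s)) + c0)) lam C].
Proof.
move=> a0 pp bE.
have ta0 : 0 < ta by rewrite ltr_wpDr// divr_ge0 ?sqr_ge0// ltW.
(* Lowering p to [p0] makes m0 = 1/2 - p0 positive whatever p is, so that [gw_neg_moment] applies.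
   Then s = p0 / 2 gives m0 < 1/2 - s. *)
pose p0 := Num.min p 4^-1.
have p00 : 0 < p0 by rewrite lt_min pp invr_gt0 ltr0n.
have p0p : p0 <= p by rewrite ge_min lexx.
have p04 : p0 <= 4^-1 by rewrite ge_min lexx orbT.
pose s := p0 / 2; have sp : 0 < s by rewrite divr_gt0.
have sE : p0 = 2 * s by rewrite /s; field.
pose m0 := 2^-1 - p0.
have m00 : 0 < m0 by rewrite /m0; lra.
have n1 : 0 < m0 + s by rewrite addr_gt0.
have n2 : 0 < 2^-1 - s by lra.
have g1 := gw_gt0 (fin10 m00); have g2 := gw_gt0 (fin10 n1).
have g3 := gw_gt0 (fin10 n2); have g4 := gw_gt0 (fin10 half0).
pose A1 := gw (m0 + s) 1 0 / gw m0 1 0; pose ka := half_ratio (- s).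
have A10 : 0 < A1 by rewrite divr_gt0.
have ka0 : 0 < ka by rewrite divr_gt0.
have Aka : A1 < ka^-1.
  have ll : m0 < 2^-1 - s by rewrite /m0; lra.
  have f4 : gig_fin (2^-1 - s + s) 1 0 by rewrite subrK; exact: fin10.
  have [_ /(_ ll)] := gw_ratio_index sp (ltW ll) (fin10 m00) (fin10 n2) (fin10 n1) f4.
  rewrite subrK => hlt; rewrite /A1 /ka invf_div ltr_pdivrMr// mulrAC ltr_pdivlMr//.
(* Strictly between A1, as [gw_neg_moment] demands, and 1 / ka, so that k ka < 1. *)
pose k := (A1 + ka^-1) / 2.
have Ak : A1 < k by rewrite /k; lra.
have kka : k * ka < 1.
  rewrite -(ltr_pdivlMr _ _ ka0) mul1r /k; lra.
have k0 : 0 < k by rewrite (lt_trans A10).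
have [C0 C00 hC0] := @gw_neg_moment R m0 ta s k m00 ta0 sp Ak.
pose c1 := k * (sigma ^+ 2) `^ s.
have c10 : 0 < c1 by rewrite mulr_gt0// powR_gt0.
pose be i := (rho * (\sum_k B k i ^+ 2)) `^ s.
exists s, c1, C0, (k * ka), (\sum_i (k * ka * be i + C0)); split => //.
  by rewrite kka mulr_ge0 ?ltW.
apply: (@gibbs_drift_moment _ _ _ _ A K X beta h mu sigma sigma_eps p a b Y _ _ _ (- s)
  (fun x => `|x| `^ (- (2 * s))) c1 C0 _ _
  (fun V i => (sigma ^+ 2)^-1 `^ s * (be i + tnth V i `^ (- s)) * ka)) => //.
- exact: ltW.
- by mfun.
- move=> x x0; have cp : 0 < b + x ^+ 2 / sigma ^+ 2.
    by rewrite ltr_wpDl// divr_gt0// lt_neqAle eq_sym sqrf_eq0 x0 sqr_ge0.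
  set c := b + _ in cp *.
  have cE : c `^ (- s) = (sigma ^+ 2) `^ s * `|x| `^ (- (2 * s)).
    by rewrite /c bE add0r powR_sqr_div// opprK mulrN.
  have fin l : gig_fin l ta c by split; rewrite ?(ltW ta0) ?(ltW cp) ?ta0 ?cp.
  split; first exact: fin.
  have gm := gw_gt0 (fin (- m0)).
  (* The ratio of the moments of orders -s and 0 decreases with the index, and p' >= -m0, so the
     estimate at index -m0 covers p'. *)
  have [|h1 _] := @gw_ratio_index R s (- m0 - s) (p' - s) ta c sp _ (fin _) (fin _) (fin _) (fin _).
    by rewrite /m0; lra.
  rewrite !subrK in h1.
  rewrite -(ler_pM2l gm); apply: (le_trans h1).
  have h2 := hC0 _ cp.
  have gp := gw_gt0 (fin p').
  have : gw p' ta c * gw (- m0 - s) ta c <= gw p' ta c * ((k * c `^ (- s) + C0) * gw (- m0) ta c).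
    by rewrite ler_wpM2l// ltW.
  move=> h3; apply: (le_trans h3); rewrite cE /c1 le_eqVlt; apply/orP; left; apply/eqP; ring.
- by move=> V i DV; apply: M_neg_moment => //; rewrite sp/=; lra.
- move=> V DV; rewrite /moment_sum mulr_sumr -big_split /=.
  apply: ler_sum => i _; rewrite le_eqVlt; apply/orP; left; apply/eqP.
  have e : (sigma ^+ 2) `^ s * (sigma ^+ 2)^-1 `^ s = 1.
    by rewrite -powRM ?invr_ge0 ?(ltW s20)// mulfV ?gt_eqF// powR1.
  transitivity (k * ka * (be i + tnth V i `^ (- s)) * ((sigma ^+ 2) `^ s * (sigma ^+ 2)^-1 `^ s) + C0).
    by rewrite /c1; ring.
  by rewrite e mulr1; ring.
Qed.

End gibbs_regimes.

Theorem proposition2p6 (R : realType) (m n q : nat)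
    (A : 'M[R]_(m, n)) (K : 'M[R]_n) (X : 'M[R]_(m, q)) (beta : 'cV[R]_q)
    (h : 'cV[R]_n) (mu sigma sigma_eps p a b : R) (Y : 'cV[R]_m)
    (K_inv : K \in unitmx) (sigma_gt0 : 0 < sigma)
    (sigma_eps_gt0 : 0 < sigma_eps) (gig_pab : gig_params p a b)
    (regime :
      [\/ a = 0 /\ mu = 0,
          [/\ a = 0, 0 < b, p < 0, mu != 0 &
              null_smallness A K mu sigma a] |
          [/\ 0 < a, b = 0, 0 < p &
              null_smallness A K mu sigma a]]) :
  exists post : probability (Rn R n) R,
    has_posterior_density A K X beta h mu sigma sigma_eps p a b Y post /\
    geometrically_ergodic
      (gibbs_operator A K X beta h mu sigma sigma_eps p a b Y) post.
Proof.
have s20 : 0 < sigma ^+ 2 by exact: exprn_gt0.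
have b0 := b_ge0 gig_pab.
have hi_le (c1 c0 r y t : R) : 0 < c1 -> 0 <= c0 -> c1 * y + c0 <= r -> y <= r / c1.
  by move=> c10 c00 le; rewrite ler_pdivlMr// mulrC; apply: le_trans le; rewrite lerDl.
case: regime => [[a0 mu0]|[a0 bp pn mun small]|[a0 bE pp small]].
- have [s [c1 [c0 [lam [C [sp c10 c00 lam01 dp]]]]]] :=
    drift_inverse_gamma A K X beta h Y sigma_gt0 sigma_eps_gt0 gig_pab a0 mu0.
  have bp : 0 < b by case: gig_pab => [[]|[]|[]]; rewrite a0 ?ltxx.
  apply: (gibbs_ergodic sigma_gt0 sigma_eps_gt0 gig_pab lam01 dp) => r.
  (* Since b > 0, only an upper bound on M_i^2 has to be read off [F]. *)
  exists b, (b + (r / c1) `^ s^-1 / sigma ^+ 2); split => // M i EM FM.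
  rewrite lerDl divr_ge0 ?sqr_ge0 ?(ltW s20)//= lerD2l ler_wpM2r ?invr_ge0 ?(ltW s20)//.
  apply: powR_le_inv => //; first exact: sqr_ge0.
  rewrite sqr_powR; apply: (hi_le _ c0 _ _ 0) => //.
  apply: (@sum_term_le _ _ (fun i => c1 * `|tnth M i : R| `^ (2 * s) + c0)) FM => j.
  by rewrite addr_ge0// mulr_ge0 ?powR_ge0// ltW.
- have ta0 : 0 < tilde_a mu sigma a.
    by rewrite /tilde_a a0 add0r divr_gt0// lt_neqAle eq_sym sqrf_eq0 mun sqr_ge0.
  have [c1 [c0 [lam [C [c10 c00 lam01 dp]]]]] :=
    drift_second_moment X beta h Y sigma_gt0 sigma_eps_gt0 gig_pab K_inv ta0 small.
  apply: (gibbs_ergodic sigma_gt0 sigma_eps_gt0 gig_pab lam01 dp) => r.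
  exists b, (b + r / c1 / sigma ^+ 2); split => // M i EM FM.
  rewrite lerDl divr_ge0 ?sqr_ge0 ?(ltW s20)//= lerD2l ler_wpM2r ?invr_ge0 ?(ltW s20)//.
  apply: (hi_le _ c0 _ _ 0) => //.
  apply: (@sum_term_le _ _ (fun i => c1 * (tnth M i : R) ^+ 2 + c0)) FM => j.
  by rewrite addr_ge0// mulr_ge0 ?sqr_ge0// ltW.
- have ta0 : 0 < tilde_a mu sigma a by rewrite ltr_wpDr// divr_ge0 ?sqr_ge0// ltW.
  have [c1 [c0 [lam [C [c10 c00 lam01 dp]]]]] :=
    drift_second_moment X beta h Y sigma_gt0 sigma_eps_gt0 gig_pab K_inv ta0 small.
  have [s [d1 [d0 [lam' [C' [sp d10 d00 lam01' dp']]]]]] :=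
    drift_negative_moment A K X beta h mu Y sigma_gt0 sigma_eps_gt0 gig_pab a0 pp bE.
  have k10 (V M : Rn R n) : 0 <= M_pdf A K X beta h mu sigma sigma_eps Y V M by exact: mvn_pdf_ge0.
  have k20 (M V : Rn R n) : 0 <= V_pdf mu sigma p a b M V by exact: gig_prod_pdf_ge0.
  have dpp := drift_pairD (measurable_M_pdf A K X beta h mu sigma sigma_eps Y)
    (@measurable_V_pdf R n mu sigma p a b) k10 k20 dp dp'.
  have lam2 : 0 <= Num.max lam lam' < 1.
    by move/andP: lam01 => [l0 l1]; move/andP: lam01' => [l0' l1']; rewrite le_max l0 gt_max l1.
  apply: (gibbs_ergodic sigma_gt0 sigma_eps_gt0 gig_pab lam2 dpp) => r.
  (* [r] is an arbitrary real; the maximum with 1 keeps y positive. *)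
  pose y := Num.max 1 (r / d1).
  have y0 : 0 < y `^ s^-1 by apply: powR_gt0; rewrite lt_max ltr01.
  exists ((y `^ s^-1)^-1 / sigma ^+ 2), (r / c1 / sigma ^+ 2).
  split; first by rewrite divr_gt0// invr_gt0.
  move=> M i EM FM; rewrite bE add0r.
  have f1 j : 0 <= c1 * (tnth M j : R) ^+ 2 + c0 by rewrite addr_ge0// mulr_ge0 ?sqr_ge0// ltW.
  have f2 j : 0 <= d1 * `|tnth M j : R| `^ (- (2 * s)) + d0 by rewrite addr_ge0// mulr_ge0 ?powR_ge0// ltW.
  have F1 : \sum_j (c1 * (tnth M j : R) ^+ 2 + c0) <= r.
    by apply: le_trans FM; rewrite lerDl; apply: sumr_ge0 => j _.
  have F2 : \sum_j (d1 * `|tnth M j : R| `^ (- (2 * s)) + d0) <= r.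
    by apply: le_trans FM; rewrite lerDr; apply: sumr_ge0 => j _.
  have M20 : 0 < (tnth M i : R) ^+ 2 by rewrite lt_neqAle eq_sym sqrf_eq0 EM sqr_ge0.
  apply/andP; split; rewrite ler_wpM2r ?invr_ge0 ?(ltW s20)//.
  (* d1 |M_i|^(-2s) <= r bounds M_i^2 from below. As b = 0, this is the lower bound on the GIG
     parameter. *)
  + rewrite -[leRHS]invrK lef_pV2 ?posrE// ?invr_gt0//.
    apply: powR_le_inv => //; first by rewrite invr_ge0 ltW.
    rewrite -(powR_inv1 (ltW M20)) -powRrM mulN1r sqr_powR mulrN.
    rewrite le_max; apply/orP; right; apply: (hi_le _ d0 _ _ 0) => //.
    exact: (@sum_term_le _ _ (fun j => d1 * `|tnth M j : R| `^ (- (2 * s)) + d0) r i f2 F2).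
  + apply: (hi_le _ c0 _ _ 0) => //.
    exact: (@sum_term_le _ _ (fun j => c1 * (tnth M j : R) ^+ 2 + c0) r i f1 F1).
Qed.
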